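(* In the functional linear model with deterministic design described in the context, suppose the positive integers $k_n$ satisfy $k_n\asymp(\log n)^{d_0}$ for some constant $d_0\in(0,1/2)$. Furthermore, suppose $\epsilon$ is sub-Gaussian, i.e. there is a constant $C_\epsilon>0$ with $E\{\exp(t\epsilon)\}\le\exp(C_\epsilon t^2)$ for all $t\in\mathbb R$, and that $$\max_{1\le\nu\le n}\sum_{i=1}^n\omega_{i\nu}^4=o\big(n^{8/5}(\log\log n)^{-14/5}\big).$$ Then for any $\bar\alpha\in(0,1)$, under $H_0:\beta=0$, $$P(AT_n\le c_{\bar\alpha})\to1-\bar\alpha\quad\text{as }n\to\infty,$$ where $c_{\bar\alpha}=-\log(-\log(1-\bar\alpha))$.
   Context: Model: $Y_i=\int_0^1X_i(t)\beta(t)dt+\epsilon_i$, $i=1,\dots,n$, with $X_i$ deterministic functions on $[0,1]$ and $\epsilon_i$ i.i.d. copies of $\epsilon$, which has mean zero and unit variance. Empirical basis: let $\widehat C(s,t)=n^{-1}\sum_{i=1}^nX_i(s)X_i(t)$, $\widehat V(\beta,\tilde\beta)=\int_0^1\int_0^1\widehat C(s,t)\beta(s)\tilde\beta(t)dsdt$, and let $\widehat\varphi_1,\dots,\widehat\varphi_n$ be (deterministic) functions on $[0,1]$ with $\widehat V(\widehat\varphi_\nu,\widehat\varphi_\mu)=\delta_{\nu\mu}$, $1\le\nu,\mu\le n$. Put $\omega_{i\nu}=\int_0^1X_i(t)\widehat\varphi_\nu(t)dt$ and $\Omega=(\omega_{i\nu})_{1\le i,\nu\le n}$, so that $\Omega^T\Omega=nI_n$.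 Test statistic: for integers $k\ge1$, let $\lambda_k=c_0^{2k}n^{-4k/(4k+1)}(\log\log n)^{2k/(4k+1)}$ with a constant $c_0>0$ not depending on $k$, $\Lambda_k=\mathrm{diag}(1^{2k},2^{2k},\dots,n^{2k})$, $d_\nu(k)=1/(1+\lambda_k\nu^{2k})$, and let $a_{ij}(k)$ be the $(i,j)$ entry of $A_k=n^{-1}\Omega(I_n+\lambda_k\Lambda_k)^{-1}\Omega^T$. With $Y=(Y_1,\dots,Y_n)^T$, $\mathrm{PLRT}_k$ is given by $-2n\,\mathrm{PLRT}_k=Y^T\Omega(nI_n+n\lambda_k\Lambda_k)^{-1}\Omega^TY$, and $$\tilde\tau_k=\frac{-2n\,\mathrm{PLRT}_k-\sum_{\nu=1}^nd_\nu(k)}{(2\sum_{i\ne j}a_{ij}^2(k))^{1/2}},\qquad AT_n^*=\max_{1\le k\le k_n}\tilde\tau_k,\qquad AT_n=B_n(AT_n^*-B_n),$$ where $B_n>0$ satisfies $2\pi B_n^2\exp(B_n^2)=k_n^2$. *)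

(* Defs.v *)
From HB Require Import structures.
From mathcomp Require Import all_boot all_order all_algebra.
From mathcomp Require Import all_classical all_reals all_analysis.

Set Implicit Arguments.
Unset Strict Implicit.
Unset Printing Implicit Defensive.

Import Order.TTheory GRing.Theory Num.Theory.
Import numFieldNormedType.Exports.

Local Open Scope classical_set_scope.
Local Open Scope ring_scope.

(* Functions on [0, 1] are represented by functions on the whole real line of
   which only the restriction to `[0, 1] is ever used.  Indices i, nu, mu
   in {1, ..., n} are represented by ordinals of 'I_n, hence shifted by one. *)

Section Probability.
Context {d : measure_display} {T : measurableType d} {R : realType}.
Variable P : probability T R.

Definition mutually_independent (X : nat -> {RV P >-> R}) : Prop :=
  forall (J : seq nat) (A : nat -> set R), uniq J ->
    (forall i, measurable (A i)) ->
    P (\big[setI/setT]_(i <- J) (X i @^-1` A i))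
      = (\prod_(i <- J) P (X i @^-1` A i))%E.

Definition iid_copies (Z : {RV P >-> R}) (X : nat -> {RV P >-> R}) : Prop :=
  mutually_independent X /\
  forall (i : nat) (A : set R), measurable A ->
    distribution P (X i) A = distribution P Z A.

Definition sub_gaussian (Z : {RV P >-> R}) : Prop :=
  exists C : R, 0 < C /\
    forall t : R, ('M_P Z t <= (expR (C * t ^+ 2))%:E)%E.

End Probability.

Section Design.
Context {R : realType}.
Variable n : nat.

Definition integral01 (f : R -> R) : R :=
  \int[lebesgue_measure]_(t in `[0, 1]) f t.

Definition integrable01 (f : R -> R) : Prop :=
  (@lebesgue_measure R).-integrable `[0, 1] (EFin \o f).

Definition Chat (X : 'I_n -> R -> R) (s t : R) : R :=
  n%:R^-1 * \sum_(i < n) X i s * X i t.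

Definition Vhat (X : 'I_n -> R -> R) (b b' : R -> R) : R :=
  integral01 (fun t => integral01 (fun s => Chat X s t * b s * b' t)).

(* The integrability clause says that the integrals defining the entries
   omega_{i nu} (and hence Vhat (phi nu) (phi mu)) are genuine. *)
Definition empirical_basis (X phi : 'I_n -> R -> R) : Prop :=
  (forall i nu : 'I_n, integrable01 (fun t => X i t * phi nu t)) /\
  (forall nu mu : 'I_n, Vhat X (phi nu) (phi mu) = (nu == mu)%:R).

Definition Omega (X phi : 'I_n -> R -> R) : 'M[R]_n :=
  \matrix_(i, nu) integral01 (fun t => X i t * phi nu t).

Definition response (X : 'I_n -> R -> R) (beta : R -> R) (e : 'I_n -> R) :
    'cV[R]_n :=
  \col_i (integral01 (fun t => X i t * beta t) + e i).

End Design.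

Section Statistic.
Context {R : realType}.
Variable c0 : R.

Definition lambda (n k : nat) : R :=
  c0 ^+ (2 * k) * n%:R `^ (- ((4 * k)%:R / (4 * k + 1)%:R))
  * ln (ln n%:R) `^ ((2 * k)%:R / (4 * k + 1)%:R).

Definition Lambda (n k : nat) : 'M[R]_n :=
  diag_mx (\row_(nu < n) nu.+1%:R ^+ (2 * k)).

Definition dcoef (n k nu : nat) : R := 1 / (1 + lambda n k * nu%:R ^+ (2 * k)).

Definition Amat (n : nat) (W : 'M[R]_n) (k : nat) : 'M[R]_n :=
  n%:R^-1 *: (W *m invmx (1%:M + lambda n k *: Lambda n k) *m W^T).

Definition PLRT (n : nat) (W : 'M[R]_n) (Y : 'cV[R]_n) (k : nat) : R :=
  - (2 * n%:R)^-1 *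
  (Y^T *m W *m invmx (n%:R%:M + (n%:R * lambda n k) *: Lambda n k)
   *m W^T *m Y) ord0 ord0.

Definition tau (n : nat) (W : 'M[R]_n) (Y : 'cV[R]_n) (k : nat) : R :=
  (- (2 * n%:R) * PLRT W Y k - \sum_(1 <= nu < n.+1) dcoef n k nu)
  / Num.sqrt (2 * \sum_(i < n) \sum_(j < n | i != j) Amat W k i j ^+ 2).

(* The default value tau 1 of the iterated maximum is one of its terms as
   soon as 1 <= kn. *)
Definition ATstar (n : nat) (W : 'M[R]_n) (Y : 'cV[R]_n) (kn : nat) : R :=
  \big[Num.max/tau W Y 1]_(1 <= k < kn.+1) tau W Y k.

Definition AT (n : nat) (W : 'M[R]_n) (Y : 'cV[R]_n) (kn : nat) (B : R) : R :=
  B * (ATstar W Y kn - B).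

End Statistic.

(* Main.v *)
Require Import Defs.
From HB Require Import structures.
From mathcomp Require Import all_boot all_order all_algebra.
From mathcomp Require Import all_classical all_reals all_analysis.
From mathcomp Require Import measurable_realfun.
From mathcomp Require Import ring lra.

Set Implicit Arguments.
Unset Strict Implicit.
Unset Printing Implicit Defensive.

Import Order.TTheory GRing.Theory Num.Theory.
Import numFieldNormedType.Exports.

Local Open Scope classical_set_scope.
Local Open Scope ring_scope.

(** Under the null hypothesis each statistic is a quadratic form in the noise.
    Its diagonal part, built on [eps_i^2 - 1], has a variance controlled by the
    fourth powers of the [omega_(i,nu)], and Chebyshev's inequality discards it
    for all [k <= k_n] at once.  The off-diagonal parts live on bandwidths
    [lambda_k^(1/2k)] of different orders of magnitude in [n], which makes them
    nearly orthogonal.  For a smooth cutoff [g], the mean of the product over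
    [k] of [g (Q_k)], with [Q_k] the off-diagonal form, is compared with the
    power of the Gaussian mean of [g] by trading one factor at a time against
    its Gaussian mean through Stein's equation, the error being bounded by
    leaving out one noise variable and expanding.  This error is polynomial in
    [k_n] times a power of [exp (- log n / k_n^2)], and vanishes because
    [d0 < 1/2].  Hence the maximum behaves like that of [k_n] independent normal
    variables, whose limit at the level [B_n] is the Gumbel law. *)

(** * Random variables with all moments, and their means *)

Section Moments.
Context d (T : measurableType d) (R : realType) (P : probability T R).
Implicit Types f g : T -> R.

(** Why crude estimates suffice. The forms [Q_k] are symmetric with zero diagonal, hence affine in
    each noise variable: removing one is exact, and mean 0 with variance 1 cancels the expansion up
    to second order, so the remainder needs only the fourth moment. The equation defining [B_n]
    reads 1 / gpdf(B_n) = k_n / B_n, so a bound that loses 1 / gpdf at the level loses only a factor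
    k_n. The Gumbel scale at [B_n] is 1 / B_n, hence the cutoff must fall within eta / B_n, which
    costs B_n^2, at most 2 log log n. Origin of the exponents 8/5 and 14/5: with h_k =
    lambda_k^(1/2k), one has n^(8/5) (log log n)^(-14/5) = n^2 (log log n)^(-3) h_1 / c0. The sum of
    the d_nu(k) is at most 4 / h_k and the squared normalisation at least 1 / (8 h_k), so the
    diagonal part has variance at most a multiple of (log log n)^(-3) h_1 / h_k. This beats the
    B_n^2 of Chebyshev's inequality, and summing over k is harmless because h_1 / h_k is tiny for k
    >= 2. *)

Definition mean f : R := \int[P]_x f x.

(** This class contains the noise and the bounded measurable functions and is stable under sums and
    products, so integrability conditions below are settled by the shape of the integrand. *)
Definition all_moments f :=
  measurable_fun setT f /\
  forall p : nat, P.-integrable setT (EFin \o (fun x => `|f x| ^+ p)).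

Lemma all_moments_measurable f : all_moments f -> measurable_fun setT f.
Proof. by case. Qed.

Lemma all_moments_integrable f :
  all_moments f -> P.-integrable setT (EFin \o f).
Proof.
move=> [mf /(_ 1%N)]; apply: le_integrable => //.
  exact/measurable_EFinP.
by move=> x _ /=; rewrite expr1 normr_id.
Qed.

Lemma le_all_moments f g : measurable_fun setT f -> all_moments g ->
  (forall x, `|f x| <= `|g x|) -> all_moments f.
Proof.
move=> mf [mg ig] fg; split=> // p.
apply: (le_integrable _ _ _ (ig p)) => //.
  apply/measurable_EFinP; apply: measurable_funX.
  exact: measurableT_comp.
move=> x _ /=; rewrite lee_fin !normrX !normr_id.
by apply: lerXn2r; rewrite ?nnegrE.
Qed.

Lemma all_moments_cst (c : R) : all_moments (fun=> c).
Proof.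
by split=> [|p]; [exact: measurable_cst|exact: finite_measure_integrable_cst].
Qed.

Lemma all_momentsM f g :
  all_moments f -> all_moments g -> all_moments (fun x => f x * g x).
Proof.
move=> [mf If] [mg Ig]; split; first exact: measurable_funM.
move=> p.
(* Pointwise, |f g|^p <= |f|^(2p) + |g|^(2p). *)
have I2 := integrableD measurableT (If (p * 2)%N) (Ig (p * 2)%N).
apply: (le_integrable _ _ _ I2) => //.
  apply/measurable_EFinP; apply: measurable_funX.
  by apply: measurableT_comp => //; exact: measurable_funM.
move=> x _ /=; rewrite lee_fin normrX normr_id normrM exprMn [leRHS]ger0_norm ?addr_ge0 ?exprn_ge0// !exprM.
have := sqr_ge0 (`|f x| ^+ p - `|g x| ^+ p).
have h1 : 0 <= `|f x| ^+ p by apply: exprn_ge0.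
have h2 : 0 <= `|g x| ^+ p by apply: exprn_ge0.
nra.
Qed.

Lemma all_momentsX f p : all_moments f -> all_moments (fun x => f x ^+ p).
Proof.
move=> nf; elim: p => [|p IH]; first exact: all_moments_cst.
rewrite (_ : (fun x => _) = (fun x => f x * f x ^+ p)); first exact: all_momentsM.
by apply/funext => x; rewrite exprS.
Qed.

Lemma all_moments_norm f : all_moments f -> all_moments (fun x => `|f x|).
Proof.
move=> nf; apply: (le_all_moments _ nf) => [|x]; last by rewrite normr_id.
by apply: measurableT_comp => //; case: nf.
Qed.

Lemma all_momentsD f g :
  all_moments f -> all_moments g -> all_moments (fun x => f x + g x).
Proof.
move=> nf ng.
have [mf If] := nf; have [mg Ig] := ng.
split; first exact: measurable_funD.
move=> p.
have aux h : all_moments h -> P.-integrable setT (EFin \o (fun x => `|h x *+ 2| ^+ p)).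
  move=> nh; have [_] := all_momentsM nh (all_moments_cst 2) => /(_ p).
  by under eq_fun do rewrite mulr_natr.
(* As |f + g| is at most twice the larger of |f| and |g|, its p-th power is at most |2 f|^p + |2
   g|^p. *)
have I2 := integrableD measurableT (aux _ nf) (aux _ ng).
apply: (le_integrable _ _ _ I2) => //.
  apply/measurable_EFinP; apply: measurable_funX.
  by apply: measurableT_comp => //; exact: measurable_funD.
move=> x _ /=; rewrite lee_fin normrX normr_id [leRHS]ger0_norm ?addr_ge0 ?exprn_ge0//.
have [fg|gf] := leP `|f x| `|g x|.
- apply: (@le_trans _ _ (`|g x *+ 2| ^+ p)); last by rewrite lerDr exprn_ge0.
  apply: lerXn2r => //; rewrite ?nnegrE// (le_trans (ler_normD _ _))//.
  by rewrite normrMn mulr2n lerD2r.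
- apply: (@le_trans _ _ (`|f x *+ 2| ^+ p)); last by rewrite lerDl exprn_ge0.
  apply: lerXn2r => //; rewrite ?nnegrE// (le_trans (ler_normD _ _))//.
  by rewrite normrMn mulr2n lerD2l ltW.
Qed.

Lemma all_momentsZ (c : R) f : all_moments f -> all_moments (fun x => c * f x).
Proof. exact: all_momentsM (all_moments_cst c). Qed.

Lemma all_momentsB f g :
  all_moments f -> all_moments g -> all_moments (fun x => f x - g x).
Proof.
move=> nf ng.
rewrite (_ : (fun x => _) = (fun x => f x + (-1) * g x)).
  by apply: all_momentsD => //; exact: all_momentsZ.
by apply/funext => x; rewrite mulN1r.
Qed.

Lemma all_moments_sum (I : Type) (s : seq I) (Q : pred I) (F : I -> T -> R) :
  (forall i, all_moments (F i)) -> all_moments (fun x => \sum_(i <- s | Q i) F i x).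
Proof.
move=> nF; elim: s => [|i s IH].
  under eq_fun do rewrite big_nil.
  exact: all_moments_cst.
under eq_fun do rewrite big_cons.
by case: (Q i) => //; exact: all_momentsD.
Qed.

Lemma all_moments_bounded f (c : R) :
  measurable_fun setT f -> (forall x, `|f x| <= c) -> all_moments f.
Proof.
move=> mf fc; apply: (le_all_moments mf (all_moments_cst c)) => x.
exact: le_trans (fc x) (ler_norm c).
Qed.

Lemma mean_cst (c : R) : mean (fun=> c) = c.
Proof. by rewrite /mean Rintegral_cst//= [X in fine X](probability_setT P) mulr1. Qed.

Lemma meanD f g : all_moments f -> all_moments g ->
  mean (fun x => f x + g x) = mean f + mean g.
Proof.
by move=> nf ng; rewrite /mean RintegralD//; exact: all_moments_integrable.
Qed.

Lemma meanB f g : all_moments f -> all_moments g ->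
  mean (fun x => f x - g x) = mean f - mean g.
Proof.
by move=> nf ng; rewrite /mean RintegralB//; exact: all_moments_integrable.
Qed.

Lemma meanZ (c : R) f : all_moments f -> mean (fun x => c * f x) = c * mean f.
Proof.
by move=> nf; rewrite /mean RintegralZl//; exact: all_moments_integrable.
Qed.

Lemma mean_sum (I : Type) (s : seq I) (Q : pred I) (F : I -> T -> R) :
  (forall i, all_moments (F i)) ->
  mean (fun x => \sum_(i <- s | Q i) F i x) = \sum_(i <- s | Q i) mean (F i).
Proof.
move=> nF; elim: s => [|i s IH].
  under eq_fun do rewrite big_nil.
  by rewrite big_nil mean_cst.
rewrite big_cons; under eq_fun do rewrite big_cons.
case: (Q i) => //; rewrite meanD ?IH//; exact: all_moments_sum.
Qed.

Lemma le_mean f g : all_moments f -> all_moments g -> (forall x, f x <= g x) ->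
  mean f <= mean g.
Proof.
by move=> nf ng fg; apply: le_Rintegral => //; exact: all_moments_integrable.
Qed.

Lemma mean_ge0 f : (forall x, 0 <= f x) -> 0 <= mean f.
Proof. by move=> f0; exact: Rintegral_ge0. Qed.

Lemma le_norm_mean f : all_moments f -> `|mean f| <= mean (fun x => `|f x|).
Proof.
by move=> nf; apply: le_normr_Rintegral => //; exact: all_moments_integrable.
Qed.

Lemma norm_mean_le f g : all_moments f -> all_moments g ->
  (forall x, `|f x| <= g x) -> `|mean f| <= mean g.
Proof.
move=> nf ng fg; apply: (le_trans (le_norm_mean nf)).
by apply: le_mean => //; exact: all_moments_norm.
Qed.

Lemma mean_sqr_le f : all_moments f -> mean f ^+ 2 <= mean (fun x => f x ^+ 2).
Proof.
move=> nf; set m := mean f.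
have n2 := all_momentsX 2 nf.
have : 0 <= mean (fun x => (f x - m) ^+ 2) by apply: mean_ge0 => x; exact: sqr_ge0.
rewrite (_ : (fun x => _) = (fun x => f x ^+ 2 - (2 * m) * f x + m ^+ 2)); last first.
  by apply/funext => x; ring.
have nm := all_momentsZ (2 * m) nf.
rewrite meanD; [|exact: all_momentsB|exact: all_moments_cst].
rewrite meanB// meanZ// mean_cst -/m; lra.
Qed.

End Moments.

(** * Independence of one variable from all the others *)

Section Independence.
Context d (T : measurableType d) (R : realType) (P : probability T R).

(** The joint law and the product of the marginal laws agree on rectangles, hence everywhere, and
    Fubini factorises the integral of the product. *)
Lemma mean_mul_indep (U V : {mfun T >-> R}) :
  (forall A B : set R, measurable A -> measurable B ->
     P (U @^-1` A `&` V @^-1` B) = (P (U @^-1` A) * P (V @^-1` B))%E) ->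
  all_moments P U -> all_moments P V ->
  mean P (fun x => U x * V x) = mean P U * mean P V.
Proof.
move=> UV nU nV.
pose Z : T -> R * R := fun x => (U x, V x).
have mZ : measurable_fun setT Z by apply: measurable_fun_pair.
pose ZZ : {mfun T >-> (R * R)%type} := HB.pack Z (isMeasurableFun.Build _ _ _ _ Z mZ).
pose f : R * R -> \bar R := fun z => (z.1 * z.2)%:E.
have mf : measurable_fun setT f.
  by apply/measurable_EFinP; apply: measurable_funM.
have E : forall X : set (R * R), measurable X ->
    (distribution P U \x distribution P V)%E X = distribution P ZZ X.
  apply: product_measure_unique => A B mA mB.
  exact: UV.
have If : P.-integrable setT (f \o Z).
  exact: (all_moments_integrable (all_momentsM nU nV)).
have If' : (distribution P ZZ).-integrable setT f.
  exact: (@integrable_pushforward _ _ _ _ _ Z mZ P setT f mf If).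
have If2 : (distribution P U \x distribution P V)%E.-integrable setT f.
  apply/integrableP; split => //.
  rewrite (@eq_measure_integral _ _ _ _ (distribution P ZZ)) //.
    by case/integrableP : If'.
  by move=> A mA _; exact: E.
have := integral12_prod_meas1 If2.
rewrite (@eq_measure_integral _ _ _ _ (distribution P ZZ)) //; last first.
  by move=> A mA _; exact: E.
rewrite (@integral_pushforward _ _ _ _ _ Z mZ P setT f mf If)//.
rewrite preimage_setT /mean /Rintegral => <-.
have idm : measurable_fun setT (EFin : R -> \bar R) by exact/measurable_EFinP.
have IV : (\int[distribution P V]_y y%:E = \int[P]_x (V x)%:E)%E.
  by rewrite (@integral_pushforward _ _ _ _ _ V _ P setT EFin)//;
    exact: all_moments_integrable.
have IU : (\int[distribution P U]_y y%:E = \int[P]_x (U x)%:E)%E.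
  by rewrite (@integral_pushforward _ _ _ _ _ U _ P setT EFin)//;
    exact: all_moments_integrable.
have iV : (distribution P V).-integrable setT (EFin : R -> \bar R).
  by apply: (@integrable_pushforward _ _ _ _ _ V _ P setT EFin) => //;
    exact: all_moments_integrable.
have iU : (distribution P U).-integrable setT (EFin : R -> \bar R).
  by apply: (@integrable_pushforward _ _ _ _ _ U _ P setT EFin) => //;
    exact: all_moments_integrable.
have fV : (\int[P]_x (V x)%:E)%E \is a fin_num.
  by apply: integrable_fin_num => //; exact: all_moments_integrable.
have fU : (\int[P]_x (U x)%:E)%E \is a fin_num.
  by apply: integrable_fin_num => //; exact: all_moments_integrable.
rewrite /fubini_F /f /=.
under eq_integral => x _.
  under eq_integral do rewrite EFinM.
  rewrite (integralZl measurableT iV) IV -(fineK fV) muleC.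
  over.
by rewrite /= (integralZl measurableT iU) IU -{1}(fineK fU) -EFinM/= mulrC.
Qed.

Variable X : nat -> {RV P >-> R}.

(** Cylinder events in finitely many variables other than the i-th: a pi-system. Since [free_of]
    asks for measurability with respect to the sigma-algebra it generates, independence from [X i]
    becomes a check on how a function is built. *)
Definition away (i : nat) : set (set T) :=
  [set S | exists J : seq nat, exists A : nat -> set R,
    [/\ uniq J, i \notin J, (forall j, measurable (A j)) &
        S = [set w | forall j, j \in J -> A j (X j w)]]].

Definition free_of (i : nat) (V : T -> R) : Prop :=
  measurable_fun (setT : set (g_sigma_algebraType (away i)))
    (V : g_sigma_algebraType (away i) -> R).

Lemma bigcap_preimages (J : seq nat) (A : nat -> set R) :
  \big[setI/setT]_(j <- J) (X j @^-1` A j)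
    = [set w | forall j, j \in J -> A j (X j w)].
Proof. by rewrite -bigcap_seq. Qed.

Lemma setI_closed_away i : setI_closed (away i).
Proof.
move=> _ _ [J1 [A1 [u1 n1 m1 ->]]] [J2 [A2 [u2 n2 m2 ->]]].
exists (undup (J1 ++ J2)).
exists (fun j => (if j \in J1 then A1 j else setT) `&` (if j \in J2 then A2 j else setT)).
split.
- exact: undup_uniq.
- by rewrite mem_undup mem_cat negb_or n1.
- by move=> j; apply: measurableI; case: ifP.
- apply/seteqP; split=> w /=.
    move=> [h1 h2] j _; split.
      by case: ifP => // /h1.
    by case: ifP => // /h2.
  move=> h; split=> j jJ; have := h j; rewrite mem_undup mem_cat jJ ?orbT => /(_ erefl) [].
    by [].
  by [].
Qed.

Lemma away_measurable i : away i `<=` measurable.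
Proof.
move=> S [J [A [_ _ mA ->]]]; rewrite -bigcap_preimages.
by apply: bigsetI_measurable => j _; exact: measurable_funPTI.
Qed.

Lemma sigma_away_measurable i : <<s away i >> `<=` measurable.
Proof.
apply: smallest_sub; last exact: away_measurable.
exact: sigma_algebra_measurable.
Qed.

Lemma free_of_measurable i V : free_of i V -> measurable_fun setT V.
Proof.
move=> fV _ B mB; apply: (@sigma_away_measurable i).
exact: (fV measurableT B mB).
Qed.

Hypothesis indep : mutually_independent X.

(** A pi-lambda argument: for fixed [A] the events satisfying the factorisation form a
    lambda-system, and on [away i] the claim is mutual independence for [i :: J] compared with
    [J]. *)
Lemma indep_away i (A : set R) (S : set T) : measurable A -> <<s away i >> S ->
  P (X i @^-1` A `&` S) = (P (X i @^-1` A) * P S)%E.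
Proof.
move=> mA.
pose H := [set S : set T | measurable S /\
   P (X i @^-1` A `&` S) = (P (X i @^-1` A) * P S)%E].
suff : <<s away i >> `<=` H by move=> h /h [].
have mXA : measurable (X i @^-1` A) by exact: measurable_funPTI.
apply: lambda_system_subset.
- exact: setI_closed_away.
- apply/dynkin_lambda_system; split.
  + by split; [exact: measurableT|rewrite setIT probability_setT mule1].
  + move=> B [mB PB]; split; first exact: measurableC.
    rewrite -setDE measureD//; last first.
      exact: (le_lt_trans (probability_le1 P mXA) (ltry 1)).
    rewrite [X in (_ - X)%E]PB [X in (_ = _ * X)%E]probability_setC//.
    have aux (a b : \bar R) : a \is a fin_num -> b \is a fin_num ->
        (a - a * b = a * (1 - b))%E.
      move=> fa fb; rewrite -(fineK fa) -(fineK fb).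
      by rewrite -EFinM -!EFinB -EFinM mulrBr mulr1.
    by apply: aux; exact: fin_num_measure.
  + move=> F tF HF; have mF k : measurable (F k) by have [] := HF k.
    split; first exact: bigcup_measurable.
    rewrite setI_bigcupr !measure_bigcup//.
    * have aux (a : \bar R) (f : nat -> \bar R) : a \is a fin_num ->
          (forall k, 0 <= f k)%E ->
          (\sum_(0 <= k <oo | k \in [set: nat]) (a * f k) =
           a * \sum_(0 <= k <oo | k \in [set: nat]) f k)%E.
        by move=> fa f0; rewrite -(fineK fa) nneseriesZl.
      rewrite -aux//; last exact: fin_num_measure.
      by apply: eq_eseriesr => k _; exact: (HF k).2.
    * by move=> k _; exact: measurableI.
    * exact: trivIset_setIl.
- move=> S0 AS; split; first exact: away_measurable AS.
  case: AS => J [A0 [uJ iJ mA0 ->]].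
  (* The index [i] is adjoined with its own event; as [i] is not in [J], nothing changes on [J]. *)
  pose A' j := if j == i then A else A0 j.
  have mA' j : measurable (A' j) by rewrite /A'; case: ifP.
  have uiJ : uniq (i :: J) by rewrite /= iJ.
  have eqJ j : j \in J -> A' j = A0 j.
    by rewrite /A'; case: eqP => // -> h; rewrite h in iJ.
  have := indep uiJ mA'; rewrite !big_cons -(indep uJ mA').
  rewrite !bigcap_preimages {1 2 3}/A' eqxx.
  suff -> : [set w | forall j, j \in J -> A' j (X j w)] =
            [set w | forall j, j \in J -> A0 j (X j w)] by [].
  by apply/seteqP; split=> w /= h j jJ; have := h j jJ; rewrite eqJ.
- by move=> *; exact: subsetT.
Qed.

Lemma mean_mul_free i (u : R -> R) (V : T -> R) : measurable_fun setT u ->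
  free_of i V -> all_moments P (fun w => u (X i w)) -> all_moments P V ->
  mean P (fun w => u (X i w) * V w) = mean P (fun w => u (X i w)) * mean P V.
Proof.
move=> mu fV nU nV.
have mV := free_of_measurable fV.
have mU : measurable_fun setT (fun w => u (X i w)) by case: nU.
pose U' : {mfun T >-> R} := HB.pack (fun w => u (X i w))
  (isMeasurableFun.Build _ _ _ _ (fun w => u (X i w)) mU).
pose V' : {mfun T >-> R} := HB.pack V (isMeasurableFun.Build _ _ _ _ V mV).
apply: (@mean_mul_indep U' V') => // A B mA mB.
have mA' : measurable (u @^-1` A) by rewrite -[_ @^-1` _]setTI; exact: mu.
apply: (indep_away mA').
by have := fV measurableT B mB; rewrite setTI.
Qed.

End Independence.

(** * Closure properties of functions free of one variable *)

Section FreeAlgebra.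
Context d (T : measurableType d) (R : realType) (P : probability T R).
Variable X : nat -> {RV P >-> R}.

Lemma free_of_cst i (c : R) : free_of X i (fun=> c).
Proof. exact: measurable_cst. Qed.

Lemma free_of_var i j : j != i -> free_of X i (X j).
Proof.
move=> ji _ B mB; apply: sub_sigma_algebra.
exists [:: j]; exists (fun=> B); split => //.
  by rewrite inE eq_sym.
rewrite setTI; apply/seteqP; split=> w /=.
  by move=> h k; rewrite inE => /eqP ->.
by apply; rewrite inE.
Qed.

Lemma free_ofD i U V : free_of X i U -> free_of X i V -> free_of X i (fun w => U w + V w).
Proof. exact: measurable_funD. Qed.

Lemma free_ofM i U V : free_of X i U -> free_of X i V -> free_of X i (fun w => U w * V w).
Proof. exact: measurable_funM. Qed.

Lemma free_of_comp i (u : R -> R) V : measurable_fun setT u ->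
  free_of X i V -> free_of X i (fun w => u (V w)).
Proof. by move=> mu fV; exact: (measurableT_comp mu fV). Qed.

Lemma free_of_sum i (I : Type) (s : seq I) (Q : pred I) (F : I -> T -> R) :
  (forall j, Q j -> free_of X i (F j)) ->
  free_of X i (fun w => \sum_(j <- s | Q j) F j w).
Proof.
move=> nF; elim: s => [|j s IH].
  under eq_fun do rewrite big_nil.
  exact: free_of_cst.
under eq_fun do rewrite big_cons.
by case Qj: (Q j) => //; apply: free_ofD => //; exact: nF.
Qed.

Lemma free_of_prod i (I : Type) (s : seq I) (F : I -> T -> R) :
  (forall j, free_of X i (F j)) ->
  free_of X i (fun w => \prod_(j <- s) F j w).
Proof.
move=> nF; elim: s => [|j s IH].
  under eq_fun do rewrite big_nil.
  exact: free_of_cst.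
under eq_fun do rewrite big_cons.
exact: free_ofM.
Qed.

End FreeAlgebra.

(** * Moments of linear and quadratic forms in the noise *)

Section Noise.
Context d (T : measurableType d) (R : realType) (P : probability T R).

(** What the comparison retains of the i.i.d. sub-Gaussian errors: independence, finiteness of all
    moments, and the first, second and fourth moments. *)
Record noise (e : nat -> {RV P >-> R}) (mu4 : R) : Prop := Noise {
  noise_indep : mutually_independent e;
  noise_moments : forall i, all_moments P (e i);
  noise_mean : forall i, mean P (e i) = 0;
  noise_sqr : forall i, mean P (fun w => e i w ^+ 2) = 1;
  noise_fourth : forall i, mean P (fun w => e i w ^+ 4) = mu4 }.

Variables (e : nat -> {RV P >-> R}) (mu4 : R).
Hypothesis He : noise e mu4.

Lemma noiseX i p : all_moments P (fun w => e i w ^+ p).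
Proof. exact/all_momentsX/(noise_moments He). Qed.

Lemma mean_noiseM i p V : free_of e i V -> all_moments P V ->
  mean P (fun w => e i w ^+ p * V w) = mean P (fun w => e i w ^+ p) * mean P V.
Proof.
move=> fV nV; apply: (@mean_mul_free _ _ _ _ e (noise_indep He) i (fun x => x ^+ p)) => //.
exact: noiseX.
Qed.

Lemma mean_noise1 i V : free_of e i V -> all_moments P V ->
  mean P (fun w => e i w * V w) = 0.
Proof.
move=> fV nV; have := mean_noiseM 1 fV nV.
under eq_fun do rewrite expr1.
by under [X in _ = mean _ X * _ -> _]eq_fun do rewrite expr1; rewrite (noise_mean He) mul0r.
Qed.

Lemma mean_noise2 i V : free_of e i V -> all_moments P V ->
  mean P (fun w => e i w ^+ 2 * V w) = mean P V.
Proof. by move=> fV nV; rewrite mean_noiseM// (noise_sqr He) mul1r. Qed.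

Lemma fourth_moment_ge1 : 1 <= mu4.
Proof.
have := mean_sqr_le (noiseX 0 2); rewrite (noise_sqr He) expr1n.
by under eq_fun do rewrite -exprM; rewrite (noise_fourth He).
Qed.

Variable n : nat.
Implicit Types (s : seq 'I_n) (c : 'I_n -> R) (M : 'I_n -> 'I_n -> R).

Definition lin s c (w : T) : R := \sum_(j <- s) c j * e j w.

Lemma all_moments_lin s c : all_moments P (lin s c).
Proof.
apply: all_moments_sum => j; apply: all_momentsZ; exact: (noise_moments He).
Qed.

Lemma free_of_lin s c (i : 'I_n) : i \notin s -> free_of e i (lin s c).
Proof.
move=> is_; rewrite /lin; under eq_fun do rewrite big_seq.
apply: free_of_sum => j js; apply: free_ofM; first exact: free_of_cst.
by apply: free_of_var; apply: contraNneq is_ => /ord_inj <-.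
Qed.

Lemma lin_cons i s c w : lin (i :: s) c w = c i * e i w + lin s c w.
Proof. by rewrite /lin big_cons. Qed.

Lemma mean_lin s c : mean P (lin s c) = 0.
Proof.
rewrite mean_sum => [|j]; last by apply: all_momentsZ; exact: (noise_moments He).
rewrite big1// => j _; rewrite meanZ ?(noise_mean He) ?mulr0//.
exact: (noise_moments He).
Qed.

Lemma mean_lin_sqr s c : uniq s ->
  mean P (fun w => lin s c w ^+ 2) = \sum_(j <- s) c j ^+ 2.
Proof.
elim: s => [|i s IH] /=.
  by move=> _; under eq_fun do rewrite /lin big_nil expr0n/=; rewrite mean_cst big_nil.
move=> /andP[is_ us]; rewrite big_cons -IH//.
have nL := all_moments_lin s c; have fL := free_of_lin c is_.
under eq_fun => w.
  rewrite lin_cons (_ : _ ^+ 2 = c i ^+ 2 * e i w ^+ 2 +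
    (2 * c i * (e i w * lin s c w) + lin s c w ^+ 2)); last by ring.
  over.
have n1 := all_momentsM (noise_moments He i) nL.
rewrite meanD; last 2 first.
- exact/all_momentsZ/noiseX.
- by apply: all_momentsD; [exact: all_momentsZ|exact: all_momentsX].
rewrite meanD; [|exact: all_momentsZ|exact: all_momentsX].
rewrite meanZ; last exact: noiseX.
by rewrite meanZ// mean_noise1// (noise_sqr He) mulr1 mulr0 add0r.
Qed.

(** One variable is split off at a time. Of the odd terms of the binomial expansion, one vanishes
    because the remaining form has mean zero, the other because the variable has. The middle term is
    absorbed by the square on the right since [mu4] is at least 1. *)
Lemma mean_lin_pow4 s c : uniq s ->
  mean P (fun w => lin s c w ^+ 4) <= 3 * mu4 * (\sum_(j <- s) c j ^+ 2) ^+ 2.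
Proof.
elim: s => [|i s IH] /=.
  move=> _; under eq_fun do rewrite /lin big_nil expr0n/=.
  by rewrite mean_cst big_nil expr0n mulr0.
move=> /andP[is_ us]; rewrite big_cons; have {}IH := IH us.
have nL := all_moments_lin s c; have fL := free_of_lin c is_.
have nLp p : all_moments P (fun w => lin s c w ^+ p) by exact: all_momentsX.
have fLp p : free_of e i (fun w => lin s c w ^+ p).
  exact: (free_of_comp (@exprn_measurable R _ p)).
have nM p q : all_moments P (fun w => e i w ^+ p * lin s c w ^+ q).
  by apply: all_momentsM => //; exact: noiseX.
under eq_fun => w.
  rewrite lin_cons (_ : _ ^+ 4 = c i ^+ 4 * e i w ^+ 4 +
    (4 * c i ^+ 3 * (e i w ^+ 3 * lin s c w ^+ 1) +
    (6 * c i ^+ 2 * (e i w ^+ 2 * lin s c w ^+ 2) +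
    (4 * c i * (e i w ^+ 1 * lin s c w ^+ 3) + lin s c w ^+ 4)))); last by ring.
  over.
rewrite meanD; last 2 first.
- exact/all_momentsZ/noiseX.
- by do 3 (apply: all_momentsD; first exact: all_momentsZ).
rewrite meanD; last 2 first.
- exact: all_momentsZ.
- by do 2 (apply: all_momentsD; first exact: all_momentsZ).
rewrite meanD; last 2 first.
- exact: all_momentsZ.
- by apply: all_momentsD; first exact: all_momentsZ.
rewrite meanD//; last exact: all_momentsZ.
rewrite meanZ; last exact: noiseX.
rewrite !meanZ// !mean_noiseM// (noise_fourth He) (noise_sqr He) mean_lin_sqr//.
have -> : mean P (fun w => e i w ^+ 1) = 0.
  by under eq_fun do rewrite expr1; exact: (noise_mean He).
have -> : mean P (fun w => lin s c w ^+ 1) = 0.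
  by under eq_fun do rewrite expr1; exact: mean_lin.
set S := \sum_(j <- s) _ in IH *.
have S0 : 0 <= S by apply: sumr_ge0 => j _; exact: sqr_ge0.
have m1 := fourth_moment_ge1.
have c0 : 0 <= c i ^+ 2 by exact: sqr_ge0.
set m := mean P _ in IH *; set y := c i ^+ 2 in c0 *.
rewrite (_ : c i ^+ 4 = y ^+ 2); last by rewrite /y -exprM.
have h1 : 0 <= (mu4 - 1) * (y * S) by apply: mulr_ge0; [lra|exact: mulr_ge0].
have h2 : 0 <= mu4 * y ^+ 2 by rewrite mulr_ge0 ?sqr_ge0// (le_trans ler01).
nra.
Qed.

(** The subtracted trace is the mean of the double sum over distinct indices, so the form is
    centred. *)
Definition quad s M (w : T) : R :=
  \sum_(i <- s) \sum_(j <- s) M i j * (e i w * e j w) - \sum_(i <- s) M i i.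

Lemma all_moments_quad s M : all_moments P (quad s M).
Proof.
apply: all_momentsB; last exact: all_moments_cst.
do 2 apply: all_moments_sum => ?.
by apply: all_momentsZ; apply: all_momentsM; exact: (noise_moments He).
Qed.

Lemma free_of_quad s M (i : 'I_n) : i \notin s -> free_of e i (quad s M).
Proof.
move=> is_.
have aux (j : 'I_n) : j \in s -> free_of e i (e j).
  by move=> js; apply: free_of_var; apply: contraNneq is_ => /ord_inj <-.
apply: free_ofD; last exact: free_of_cst.
under eq_fun do rewrite big_seq.
apply: free_of_sum => j js.
under eq_fun do rewrite big_seq.
apply: free_of_sum => k ks.
by apply: free_ofM; [exact: free_of_cst|apply: free_ofM; exact: aux].
Qed.

Lemma quad_cons i s M w : quad (i :: s) M w =
  quad s M w + e i w * lin s (fun j => M i j + M j i) w + M i i * (e i w ^+ 2 - 1).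
Proof.
rewrite /quad !big_cons.
under [X in _ + X - _]eq_bigr do rewrite big_cons.
rewrite big_split/= /lin mulr_sumr.
rewrite (_ : \sum_(j <- s) e i w * _ = \sum_(j <- s) M i j * (e i w * e j w) +
  \sum_(j <- s) M j i * (e j w * e i w)); first by ring.
by rewrite -big_split/=; apply: eq_bigr => j _; ring.
Qed.

(** By [quad_cons] a new variable adds a multiple of it by a linear form and a multiple of its
    centred square. These two increments and the previous form are pairwise uncorrelated, so the
    second moments add up. *)
Lemma mean_quad_sqr s M : uniq s -> mean P (fun w => quad s M w ^+ 2)
  <= (2 + mu4) * \sum_(i <- s) \sum_(j <- s) M i j ^+ 2.
Proof.
elim: s => [|i s IH] /=.
  move=> _; under eq_fun do rewrite /quad !big_nil subr0 expr0n/=.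
  by rewrite mean_cst big_nil mulr0.
move=> /andP[is_ us]; have {}IH := IH us.
pose c := fun j => M i j + M j i.
have nL := all_moments_lin s c; have fL := free_of_lin c is_.
have nQ := all_moments_quad s M; have fQ := free_of_quad M is_.
set L := lin s c in nL fL; set Q := quad s M in nQ fQ IH.
have nE p : all_moments P (fun w => e i w ^+ p) by exact: noiseX.
have nLQ : all_moments P (fun w => L w * Q w) by exact: all_momentsM.
have fLQ : free_of e i (fun w => L w * Q w) by exact: free_ofM.
have nL2 : all_moments P (fun w => L w ^+ 2) by exact: all_momentsX.
have nQ2 : all_moments P (fun w => Q w ^+ 2) by exact: all_momentsX.
have fL2 : free_of e i (fun w => L w ^+ 2) by exact: (free_of_comp (@exprn_measurable R _ 2)).
have nLE p : all_moments P (fun w => e i w ^+ p * L w) by exact: all_momentsM.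
have nQE p : all_moments P (fun w => e i w ^+ p * Q w) by exact: all_momentsM.
have nLQE : all_moments P (fun w => e i w * (L w * Q w)).
  by apply: all_momentsM => //; exact: (noise_moments He).
have nL2E : all_moments P (fun w => e i w ^+ 2 * L w ^+ 2) by exact: all_momentsM.
pose a := M i i.
under eq_fun => w.
  rewrite quad_cons -/c -/L -/Q -/a.
  rewrite (_ : _ ^+ 2 = Q w ^+ 2 + (e i w ^+ 2 * L w ^+ 2 +
    (a ^+ 2 * e i w ^+ 4 + ((- 2 * a ^+ 2) * e i w ^+ 2 + (a ^+ 2 +
    (2 * (e i w * (L w * Q w)) +
    (2 * a * (e i w ^+ 2 * Q w) + ((- 2 * a) * Q w +
    (2 * a * (e i w ^+ 3 * L w) + (- 2 * a) * (e i w ^+ 1 * L w)))))))))); last by ring.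
  over.
rewrite meanD//; last first.
  by do 8 (apply: all_momentsD; [exact: all_moments_cst || exact: all_momentsZ || by []|]);
    exact: all_momentsZ.
do 7 (rewrite meanD; [|exact: all_moments_cst || exact: all_momentsZ || by []|
  by repeat (apply: all_momentsD; [exact: all_moments_cst || exact: all_momentsZ || by []|]);
    exact: all_momentsZ]).
rewrite meanD; [|exact: all_momentsZ|exact: all_momentsZ].
rewrite mean_cst !meanZ// !mean_noiseM// mean_noise1// (noise_fourth He).
rewrite (noise_sqr He).
have -> : mean P L = 0 by exact: mean_lin.
rewrite mean_lin_sqr//.
have m1 := fourth_moment_ge1.
rewrite !big_cons (_ : \sum_(k <- s) \sum_(j <- i :: s) M k j ^+ 2 =
  \sum_(k <- s) M k i ^+ 2 + \sum_(k <- s) \sum_(j <- s) M k j ^+ 2); last first.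
  by rewrite -big_split/=; apply: eq_bigr => k _; rewrite big_cons.
rewrite -/a; have H : \sum_(j <- s) c j ^+ 2 <= 2 * \sum_(j <- s) M i j ^+ 2 + 2 * \sum_(j <- s) M j i ^+ 2.
  rewrite !mulr_sumr -big_split/=; apply: ler_sum => j _.
  have := sqr_ge0 (M i j - M j i); rewrite /c; nra.
set S1 := \sum_(j <- s) M i j ^+ 2 in H *; set S2 := \sum_(j <- s) M j i ^+ 2 in H *.
have S10 : 0 <= S1 by apply: sumr_ge0 => j _; exact: sqr_ge0.
have S20 : 0 <= S2 by apply: sumr_ge0 => j _; exact: sqr_ge0.
have h1 : 0 <= mu4 * S1 by rewrite mulr_ge0// (le_trans ler01).
have h2 : 0 <= mu4 * S2 by rewrite mulr_ge0// (le_trans ler01).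
have a0 : 0 <= a ^+ 2 by exact: sqr_ge0.
lra.
Qed.

End Noise.

(** * Taylor bounds for products of smooth functions *)

Section SmoothProducts.
Context (R : realType).
Implicit Types (f g : R -> R) (x h : nat -> R) (s : seq nat).

(** The scaling is that of a fixed profile compressed to a window of width 1 / L: one derivative
    costs [L], two cost [L ^+ 2]. The function [g] stands for the derivative of [f] and enters
    through these estimates. *)
Record C11 (L : R) f g : Prop := MkC11 {
  C11_meas : measurable_fun setT f;
  C11_dmeas : measurable_fun setT g;
  C11_le1 : forall t, `|f t| <= 1;
  C11_dle : forall t, `|g t| <= L;
  C11_lip : forall t u, `|f (t + u) - f t| <= L * `|u|;
  C11_dlip : forall t u, `|g (t + u) - g t| <= L ^+ 2 * `|u|;
  C11_taylor : forall t u, `|f (t + u) - f t - u * g t| <= L ^+ 2 * u ^+ 2 }.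

Variables (L : R) (f f' : nat -> R -> R).
Hypothesis (L0 : 0 <= L).

Definition prodF s x := \prod_(k <- s) f k (x k).
(** For [s] without repetition and [l] in [s], the partial derivative of [prodF] in the variable
    [l]. *)
Definition dprodF s l x := f' l (x l) * \prod_(k <- rem l s) f k (x k).
Definition norm1 s h := \sum_(k <- s) `|h k|.

Lemma norm1_ge0 s h : 0 <= norm1 s h.
Proof. by apply: sumr_ge0. Qed.

Lemma prodF_le1 s x : (forall k, k \in s -> C11 L (f k) (f' k)) -> `|prodF s x| <= 1.
Proof.
elim: s => [|k s IH] H; rewrite /prodF ?big_nil ?normr1// big_cons normrM.
apply: mulr_ile1 => //; first by apply: (C11_le1 (H k _)); rewrite mem_head.
by apply: IH => j js; apply: H; rewrite inE js orbT.
Qed.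

Lemma prodF_lip s x h : (forall k, k \in s -> C11 L (f k) (f' k)) ->
  `|prodF s (fun k => x k + h k) - prodF s x| <= L * norm1 s h.
Proof.
elim: s => [|k s IH] H; rewrite /prodF /norm1 ?big_nil ?subrr ?normr0 ?mulr0//.
rewrite !big_cons.
have Hk : C11 L (f k) (f' k) by apply: H; rewrite mem_head.
have Hs j : j \in s -> C11 L (f j) (f' j) by move=> js; apply: H; rewrite inE js orbT.
have {}IH := IH Hs.
rewrite -!/(prodF s _) -/(norm1 s _).
set a := f k _; set b := f k _; set A := prodF s _ in IH *; set B := prodF s _ in IH *.
have hA : `|A| <= 1 by exact: prodF_le1.
have hb : `|b| <= 1 by exact: (C11_le1 Hk).
have -> : a * A - b * B = (a - b) * A + b * (A - B) by ring.
rewrite [leRHS]mulrDr (le_trans (ler_normD _ _))// lerD// normrM.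
- rewrite -[leRHS]mulr1; apply: ler_pM => //; exact: (C11_lip Hk).
- by rewrite -[leRHS]mul1r; apply: ler_pM.
Qed.

Lemma dprodF_le s l x : (forall k, k \in s -> C11 L (f k) (f' k)) -> l \in s ->
  `|dprodF s l x| <= L.
Proof.
move=> H ls; rewrite /dprodF normrM -[leRHS]mulr1; apply: ler_pM => //.
  exact: (C11_dle (H l ls)).
by apply: prodF_le1 => k /mem_rem; exact: H.
Qed.

Lemma dprodF_lip s l x h : (forall k, k \in s -> C11 L (f k) (f' k)) -> l \in s ->
  `|dprodF s l (fun k => x k + h k) - dprodF s l x| <= L ^+ 2 * norm1 s h.
Proof.
move=> H ls; rewrite /dprodF /norm1 [in leRHS](big_rem l)//= -/(norm1 _ _).
have Hr k : k \in rem l s -> C11 L (f k) (f' k) by move=> /mem_rem; exact: H.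
rewrite -!/(prodF _ _).
have hF := prodF_lip x h Hr.
set A := prodF _ _ in hF *; set B := prodF _ _ in hF *.
have hA : `|A| <= 1 by exact: prodF_le1.
have hb := C11_dle (H l ls) (x l).
have hl := C11_dlip (H l ls) (x l) (h l).
set a := f' l _ in hl *; set b := f' l _ in hb hl *.
have -> : a * A - b * B = (a - b) * A + b * (A - B) by ring.
rewrite [leRHS]mulrDr (le_trans (ler_normD _ _))// lerD// normrM.
- by rewrite -[leRHS]mulr1; apply: ler_pM.
- by rewrite expr2 -mulrA; apply: ler_pM.
Qed.

Lemma prodF_taylor s x h : uniq s -> (forall k, k \in s -> C11 L (f k) (f' k)) ->
  `|prodF s (fun k => x k + h k) - prodF s x - \sum_(l <- s) h l * dprodF s l x|
    <= L ^+ 2 * norm1 s h ^+ 2.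
Proof.
elim: s => [|k s IH] us H.
  by rewrite /prodF /norm1 !big_nil !subrr normr0 mulr_ge0 ?sqr_ge0.
move: us => /= /andP[ks us].
have Hk : C11 L (f k) (f' k) by apply: H; rewrite mem_head.
have Hs j : j \in s -> C11 L (f j) (f' j) by move=> js; apply: H; rewrite inE js orbT.
have {}IH := IH us Hs.
rewrite /prodF /norm1 !big_cons -!/(prodF s _) -!/(norm1 s _).
have hF := prodF_lip x h Hs.
have -> : \sum_(l <- s) h l * dprodF (k :: s) l x =
    f k (x k) * \sum_(l <- s) h l * dprodF s l x.
  rewrite mulr_sumr; apply: eq_big_seq => l ls.
  rewrite /dprodF /= ifN ?big_cons; last by apply: contraNneq ks => ->.
  by ring.
have -> : dprodF (k :: s) k x = f' k (x k) * prodF s x by rewrite /dprodF /= eqxx.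
set D := \sum_(l <- s) _ in IH *.
set A := prodF s _ in IH hF *; set B := prodF s _ in IH hF *.
have hA : `|A| <= 1 by exact: prodF_le1.
have hb : `|f k (x k)| <= 1 by exact: (C11_le1 Hk).
have hd : `|f' k (x k)| <= L by exact: (C11_dle Hk).
have ht := C11_taylor Hk (x k) (h k).
set a := f k (x k + h k) in ht *; set b := f k _ in hb ht *.
set a' := f' k _ in hd ht *.
(* The Taylor remainder of the new factor, that of the old product, and a mixed term. Their bounds
   are parts of the expanded square of [|h k|] plus [norm1 s h], which contains the mixed term
   twice. *)
have -> : a * A - b * B - (h k * (a' * B) + b * D) =
  (a - b - h k * a') * A + (b * (A - B - D) + (h k * a') * (A - B)) by ring.
have N0 := norm1_ge0 s h.
apply: (@le_trans _ _ (L ^+ 2 * h k ^+ 2 + (L ^+ 2 * norm1 s h ^+ 2 +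
   (`|h k| * L) * (L * norm1 s h)))).
  rewrite (le_trans (ler_normD _ _))// lerD// ?normrM.
    by rewrite -[leRHS]mulr1; apply: ler_pM.
  rewrite (le_trans (ler_normD _ _))// lerD// ?normrM.
    by rewrite -[leRHS]mul1r; apply: ler_pM.
  by apply: ler_pM => //; rewrite ?mulr_ge0// ler_wpM2l.
rewrite -(real_normK (num_real (h k))).
have : 0 <= L ^+ 2 * (`|h k| * norm1 s h) by rewrite !mulr_ge0// sqr_ge0.
rewrite [X in _ -> _ <= X](_ : _ = L ^+ 2 * `|h k| ^+ 2 + (L ^+ 2 * norm1 s h ^+ 2 +
  (`|h k| * L) * (L * norm1 s h)) + L ^+ 2 * (`|h k| * norm1 s h)); last by ring.
by rewrite lerDl.
Qed.

End SmoothProducts.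

(** * Quadratic forms without diagonal and their gradients *)

Section QuadraticForms.
Context d (T : measurableType d) (R : realType) (P : probability T R).
Variables (e : nat -> {RV P >-> R}) (mu4 : R).
Hypothesis He : noise e mu4.
Variable n : nat.
Variable b : nat -> 'I_n -> 'I_n -> R.

(** For symmetric [b k] with zero diagonal, the partial derivative of [qform k] in the i-th noise
    variable; the half in [qform] makes each unordered pair count once. *)
Definition xi k (i : 'I_n) : T -> R := lin e (index_enum 'I_n) (b k i).

Definition qform k (w : T) : R := 2^-1 * \sum_(i < n) e i w * xi k i w.

Lemma all_moments_xi k i : all_moments P (xi k i).
Proof. exact: (all_moments_lin He). Qed.

Lemma all_moments_qform k : all_moments P (qform k).
Proof.
apply: all_momentsZ; apply: all_moments_sum => i.
by apply: all_momentsM; [exact: (noise_moments He)|exact: all_moments_xi].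
Qed.

Lemma free_of_xi k (i : 'I_n) : b k i i = 0 -> free_of e i (xi k i).
Proof.
move=> b0; apply: free_of_sum => j _.
have [->|ji] := eqVneq j i.
  by rewrite b0; under eq_fun do rewrite mul0r; exact: free_of_cst.
by apply: free_ofM; [exact: free_of_cst|exact: free_of_var].
Qed.

(** Such a form is affine in each variable with slope [xi k i], so subtracting this one term removes
    the variable exactly. *)
Lemma free_of_qform_rest k (i : 'I_n) : (forall j, b k j j = 0) ->
  (forall j l, b k j l = b k l j) ->
  free_of e i (fun w => qform k w - e i w * xi k i w).
Proof.
move=> b0 bs.
rewrite (_ : (fun w => _) = (fun w => 2^-1 * \sum_(j < n | j != i)
    \sum_(l < n | l != i) b k j l * (e j w * e l w))).
  apply: free_ofM; first exact: free_of_cst.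
  apply: free_of_sum => j ji; apply: free_of_sum => l li.
  by apply: free_ofM; [exact: free_of_cst|apply: free_ofM; exact: free_of_var].
apply/funext => w; rewrite /qform (bigD1 i)//=.
have -> : \sum_(j < n | j != i) e j w * xi k j w =
   e i w * xi k i w + \sum_(j < n | j != i)
    \sum_(l < n | l != i) b k j l * (e j w * e l w).
  have -> : e i w * xi k i w = \sum_(j < n | j != i) b k j i * (e j w * e i w).
    rewrite /xi /lin (bigD1 i)//= b0 mul0r add0r mulr_sumr.
    by apply: eq_bigr => j _; rewrite bs; ring.
  rewrite -big_split/=; apply: eq_bigr => j ji.
  rewrite /xi /lin (bigD1 i)//= mulrDr mulr_sumr; congr (_ + _); first by ring.
  by apply: eq_bigr => l _; ring.
set S := \sum_(j < n | _) _; set c := e i w * _.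
by lra.
Qed.

(** The inner product of the gradients of two forms, which Stein's method needs to be nearly
    constant: its mean is the inner product of the two matrices, its fluctuation a centred form in
    their product. *)
Lemma sum_xi_mul k l w : \sum_(i < n) xi k i w * xi l i w =
  quad e (index_enum 'I_n) (fun j m => \sum_(i < n) b k i j * b l i m) w
  + \sum_(i < n) \sum_(j < n) b k i j * b l i j.
Proof.
rewrite /quad [X in _ - X]exchange_big/= subrK.
under [RHS]eq_bigr do under eq_bigr do rewrite mulr_suml.
under [RHS]eq_bigr do rewrite exchange_big/=.
rewrite [RHS]exchange_big/=; apply: eq_bigr => i _.
rewrite /xi /lin big_distrlr/=; apply: eq_bigr => j _; apply: eq_bigr => m _.
by ring.
Qed.

Lemma mean_norm_quad M (q : R) : 0 <= q ->
  \sum_(i < n) \sum_(j < n) M i j ^+ 2 <= q ^+ 2 ->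
  mean P (fun w => `|quad e (index_enum 'I_n) M w|) <= (2 + mu4) * q.
Proof.
move=> q0 Mq; have nQ := all_moments_quad He (index_enum 'I_n) M.
have m1 := fourth_moment_ge1 He.
have h : mean P (fun w => `|quad e (index_enum 'I_n) M w|) ^+ 2 <= ((2 + mu4) * q) ^+ 2.
  apply: (le_trans (mean_sqr_le (all_moments_norm nQ))).
  under eq_fun do rewrite real_normK ?num_real//.
  apply: (le_trans (mean_quad_sqr He M (index_enum_uniq _))).
  rewrite exprMn; apply: (@le_trans _ _ ((2 + mu4) * q ^+ 2)).
    by rewrite ler_wpM2l// addr_ge0// (le_trans ler01).
  rewrite ler_wpM2r ?sqr_ge0// expr2 ler_peMr//; lra.
rewrite -(@ler_pXn2r _ 2)// nnegrE ?mean_ge0// mulr_ge0//; lra.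
Qed.

Lemma sqr_norm1_le (s : seq nat) (h : nat -> R) :
  norm1 s h ^+ 2 <= (size s)%:R * \sum_(l <- s) h l ^+ 2.
Proof.
rewrite expr2 /norm1 big_distrlr/=.
apply: (@le_trans _ _ (\sum_(k <- s) \sum_(l <- s) (2^-1 * h k ^+ 2 + 2^-1 * h l ^+ 2))).
  apply: ler_sum => k _; apply: ler_sum => l _.
  rewrite -(real_normK (num_real (h k))) -(real_normK (num_real (h l))).
  have := sqr_ge0 (`|h k| - `|h l|); nra.
rewrite [leLHS](eq_bigr (fun k => (size s)%:R * (2^-1 * h k ^+ 2) +
    \sum_(l <- s) 2^-1 * h l ^+ 2)); last first.
  by move=> k _; rewrite big_split/= big_const_seq count_predT iter_addr_0 mulr_natl.
rewrite big_split/= [X in _ + X]big_const_seq count_predT iter_addr_0.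
rewrite -!mulr_sumr -[X in _ + X]mulr_natl; set S := \sum_(l <- s) _; lra.
Qed.

(** Young's inequality |x| y^2 <= th x^2 / 2 + y^4 / (2 th), with the weight matched to the row
    bound: the fourth moment is quadratic in the row sum, and one of its two factors, at most th^2,
    turns 1 / th into th. *)
Lemma mean_norm_xi_sqr k l i (th : R) : 0 < th ->
  \sum_(j < n) b l i j ^+ 2 <= th ^+ 2 ->
  mean P (fun w => `|xi k i w| * xi l i w ^+ 2) <=
  2^-1 * th * \sum_(j < n) b k i j ^+ 2 + 3 / 2 * mu4 * th * \sum_(j < n) b l i j ^+ 2.
Proof.
move=> t0 bt; have nk := all_moments_xi k i; have nl := all_moments_xi l i.
have n2 := all_momentsX 2 nk; have n4 := all_momentsX 4 nl.
have m1 := fourth_moment_ge1 He.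
set Bl := \sum_(j < n) _ in bt *.
have B0 : 0 <= Bl by apply: sumr_ge0 => j _; exact: sqr_ge0.
apply: (@le_trans _ _ (mean P (fun w => 2^-1 * th * xi k i w ^+ 2 +
    (2^-1 * th^-1) * xi l i w ^+ 4))).
  apply: le_mean.
  - apply: all_momentsM; [exact: all_moments_norm|exact: all_momentsX].
  - by apply: all_momentsD; exact: all_momentsZ.
  move=> w; set x := xi k i w; set y := xi l i w.
  rewrite -(real_normK (num_real x)) (_ : y ^+ 4 = (y ^+ 2) ^+ 2); last by rewrite -exprM.
  have := sqr_ge0 (th * `|x| - y ^+ 2).
  rewrite (_ : (_ - _) ^+ 2 = 2 * th * (2^-1 * th * `|x| ^+ 2 +
     2^-1 * th^-1 * (y ^+ 2) ^+ 2 - `|x| * y ^+ 2)).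
    by rewrite pmulr_rge0 ?mulr_gt0// subr_ge0.
  by field; rewrite gt_eqF.
rewrite meanD ?meanZ//; [|exact: all_momentsZ|exact: all_momentsZ].
rewrite (mean_lin_sqr He)//; last exact: index_enum_uniq.
rewrite lerD2l.
have := mean_lin_pow4 He (b l i) (index_enum_uniq 'I_n); rewrite -/Bl -/(xi l i) => h.
apply: (@le_trans _ _ (2^-1 * th^-1 * (3 * mu4 * Bl ^+ 2))).
  by rewrite ler_wpM2l// mulr_ge0// ?invr_ge0// ltW.
rewrite (_ : _ * _ = (3 / 2 * mu4 * Bl * th^-1) * Bl); last by ring.
rewrite (_ : 3 / 2 * mu4 * th * Bl = (3 / 2 * mu4 * Bl * th^-1) * th ^+ 2).
  apply: ler_wpM2l => //; rewrite !mulr_ge0// ?invr_ge0 ?ltW//; lra.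
by field; rewrite gt_eqF.
Qed.

End QuadraticForms.

(** * Approximate Gaussian integration by parts *)

Section SteinComparison.
Context d (T : measurableType d) (R : realType) (P : probability T R).
Variables (e : nat -> {RV P >-> R}) (mu4 : R).
Hypothesis He : noise e mu4.
Variable n : nat.

(** Norm 2 gives [qform] unit variance. Small rows mean that no single variable is influential,
    small products that the gradient inner products concentrate, small traces that distinct forms
    are nearly uncorrelated. One [th] measures all three. *)
Record nearly_orthogonal (s : seq nat) (b : nat -> 'I_n -> 'I_n -> R) (th : R) : Prop := {
  no_sym : forall k i j, b k i j = b k j i;
  no_diag : forall k i, b k i i = 0;
  no_norm : forall k, k \in s -> \sum_(i < n) \sum_(j < n) b k i j ^+ 2 = 2;
  no_row : forall k i, k \in s -> \sum_(j < n) b k i j ^+ 2 <= th ^+ 2;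
  no_prod : forall k l, k \in s -> l \in s ->
    \sum_(j < n) \sum_(m < n) (\sum_(i < n) b k i j * b l i m) ^+ 2 <= th ^+ 2;
  no_trace : forall k l, k \in s -> l \in s -> k != l ->
    `|\sum_(i < n) \sum_(j < n) b k i j * b l i j| <= th }.

Lemma all_moments_prod (I : Type) (s : seq I) (F : I -> T -> R) :
  (forall k, all_moments P (F k)) -> all_moments P (fun w => \prod_(k <- s) F k w).
Proof.
move=> nF; elim: s => [|k s IH].
  under eq_fun do rewrite big_nil.
  exact: all_moments_cst.
under eq_fun do rewrite big_cons.
exact: all_momentsM.
Qed.

Section Functions.
Variables (L : R) (f f' : nat -> R -> R).
Hypothesis (HC : forall k, C11 L (f k) (f' k)).

Lemma all_moments_C11 k V : measurable_fun setT V -> all_moments P (fun w => f k (V w)).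
Proof.
move=> mV; apply: (@all_moments_bounded _ _ _ _ _ 1).
  exact: (measurableT_comp (C11_meas (HC k)) mV).
by move=> w; exact: (C11_le1 (HC k)).
Qed.

Lemma all_moments_dC11 k V : measurable_fun setT V -> all_moments P (fun w => f' k (V w)).
Proof.
move=> mV; apply: (@all_moments_bounded _ _ _ _ _ L).
  exact: (measurableT_comp (C11_dmeas (HC k)) mV).
by move=> w; exact: (C11_dle (HC k)).
Qed.

Lemma all_moments_prodF s (V : nat -> T -> R) : (forall k, measurable_fun setT (V k)) ->
  all_moments P (fun w => prodF f s (V ^~ w)).
Proof. by move=> mV; apply: all_moments_prod => k; exact: all_moments_C11. Qed.

Lemma all_moments_dprodF s l (V : nat -> T -> R) : (forall k, measurable_fun setT (V k)) ->
  all_moments P (fun w => dprodF f f' s l (V ^~ w)).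
Proof.
move=> mV; apply: all_momentsM; first exact: all_moments_dC11.
by apply: all_moments_prod => k; exact: all_moments_C11.
Qed.

Lemma free_of_prodF i s (V : nat -> T -> R) : (forall k, free_of e i (V k)) ->
  free_of e i (fun w => prodF f s (V ^~ w)).
Proof.
move=> fV; apply: free_of_prod => k.
exact: (free_of_comp (C11_meas (HC k)) (fV k)).
Qed.

Lemma free_of_dprodF i s l (V : nat -> T -> R) : (forall k, free_of e i (V k)) ->
  free_of e i (fun w => dprodF f f' s l (V ^~ w)).
Proof.
move=> fV; apply: free_ofM; first exact: (free_of_comp (C11_dmeas (HC l)) (fV l)).
apply: free_of_prod => k; exact: (free_of_comp (C11_meas (HC k)) (fV k)).
Qed.

Variables (b : nat -> 'I_n -> 'I_n -> R) (s : seq nat) (th : R) (k0 : nat).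
Hypotheses (Hb : nearly_orthogonal s b th) (us : uniq s) (k0s : k0 \in s).
Hypotheses (L1 : 1 <= L) (th0 : 0 < th).

Let W k := qform e b k.
Let X k i := xi e b k i.
Let F V := prodF f s V.
Let D l V := dprodF f f' s l V.
Let S i w := norm1 s (fun l => X l i w).

Let L0 : 0 <= L. Proof. exact: le_trans ler01 L1. Qed.

Let mW k : measurable_fun setT (W k).
Proof. by case: (all_moments_qform He b k). Qed.

Let nX k i : all_moments P (X k i).
Proof. exact: (all_moments_xi He). Qed.

Let ne i : all_moments P (e i).
Proof. exact: (noise_moments He). Qed.

Let nS i : all_moments P (S i).
Proof. by apply: all_moments_sum => k; exact: all_moments_norm. Qed.

(** When [E] is a noise variable of which [x], [V] and [h] are free, the term in [E * (x * F V)] has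
    mean zero and the next two cancel in the mean, leaving the difference estimated in
    [stein_coordinate]. Only even powers of [E] appear on the right, so second and fourth moments
    suffice. *)
Lemma stein_coordinate_pointwise (E x : R) (U V : nat -> R) (h : nat -> R) :
  U = (fun k => V k + E * h k) ->
  `|E * x * F U - E * (x * F V) - E ^+ 2 * (x * \sum_(l <- s) h l * D l V)
    + x * (\sum_(l <- s) h l * D l V) - \sum_(l <- s) x * h l * D l U|
  <= L ^+ 2 * ((2^-1 + E ^+ 2 + 2^-1 * E ^+ 4) * (`|x| * norm1 s h ^+ 2)).
Proof.
move=> EU.
have HCs : forall k, k \in s -> C11 L (f k) (f' k) by [].
have := prodF_taylor L0 V (fun k => E * h k) us HCs.
rewrite -EU -!/(F _) => h1.
have N1 : norm1 s (fun k => E * h k) = `|E| * norm1 s h.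
  by rewrite /norm1 mulr_sumr; apply: eq_bigr => k _; rewrite normrM.
have h2 l : l \in s -> `|D l U - D l V| <= L ^+ 2 * (`|E| * norm1 s h).
  move=> ls; have := dprodF_lip V (fun k => E * h k) HCs ls.
  by rewrite -EU -!/(D _ _) N1.
rewrite N1 in h1.
have N0 := norm1_ge0 s h.
set S0 := norm1 s h in h1 h2 N1 N0 *.
have E1 : \sum_(l <- s) E * h l * D l V = E * \sum_(l <- s) h l * D l V.
  by rewrite mulr_sumr; apply: eq_bigr => l _; rewrite mulrA.
rewrite E1 in h1.
have E2 : x * (\sum_(l <- s) h l * D l V) - \sum_(l <- s) x * h l * D l U
  = x * \sum_(l <- s) h l * (D l V - D l U).
  rewrite !mulr_sumr -sumrB; apply: eq_bigr => l _; ring.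
rewrite -addrA E2.
set Q := \sum_(l <- s) h l * D l V in h1 *.
have h3 : `|\sum_(l <- s) h l * (D l V - D l U)| <= L ^+ 2 * (`|E| * S0) * S0.
  rewrite {2}/S0 /norm1 mulr_sumr (le_trans (ler_norm_sum _ _ _))//.
  rewrite big_seq [leRHS]big_seq; apply: ler_sum => l ls.
  by rewrite normrM mulrC; apply: ler_pM => //; rewrite distrC; exact: h2.
set Z := \sum_(l <- s) h l * (D l V - D l U) in h3 *.
have -> : E * x * F U - E * (x * F V) - E ^+ 2 * (x * Q) + x * Z =
   x * (E * (F U - F V - E * Q) + Z) by ring.
rewrite normrM.
apply: (@le_trans _ _ (`|x| * (`|E| * (L ^+ 2 * (`|E| * S0) ^+ 2) + L ^+ 2 * (`|E| * S0) * S0))).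
  apply: ler_wpM2l => //; apply: (le_trans (ler_normD _ _)).
  by apply: lerD => //; rewrite normrM; apply: ler_wpM2l.
set y := `|E|.
have y0 : 0 <= y by exact: normr_ge0.
rewrite (_ : E ^+ 2 = y ^+ 2); last by rewrite real_normK ?num_real.
rewrite (_ : E ^+ 4 = y ^+ 4); last first.
  by rewrite -[4%N]/(2 * 2)%N !exprM real_normK ?num_real.
rewrite (_ : `|x| * _ = L ^+ 2 * ((y ^+ 3 + y) * (`|x| * S0 ^+ 2))); last by ring.
apply: ler_wpM2l; first exact: sqr_ge0.
apply: ler_wpM2r; first by rewrite mulr_ge0 ?sqr_ge0.
(* Half the sum of these two squares is 1/2 + y^2 + y^4 / 2 - (y^3 + y). *)
have := sqr_ge0 (y - 1); have := sqr_ge0 (y ^+ 2 - y).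
rewrite (_ : (y ^+ 2 - y) ^+ 2 = y ^+ 4 - 2 * y ^+ 3 + y ^+ 2); last by ring.
rewrite (_ : (y - 1) ^+ 2 = y ^+ 2 - 2 * y + 1); last by ring.
lra.
Qed.

Lemma stein_coordinate (i : 'I_n) :
  `|mean P (fun w => e i w * X k0 i w * F (W ^~ w))
    - mean P (fun w => \sum_(l <- s) X k0 i w * X l i w * D l (W ^~ w))|
  <= 2 * mu4 * L ^+ 2 * mean P (fun w => `|X k0 i w| * S i w ^+ 2).
Proof.
(* The forms with the i-th variable left out. *)
pose V k w := W k w - e i w * X k i w.
have fV k : free_of e i (V k).
  apply: free_of_qform_rest; first exact: (no_diag Hb).
  by move=> *; exact: (no_sym Hb).
have mV k : measurable_fun setT (V k) by exact: free_of_measurable (fV k).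
have fX k : free_of e i (X k i) by apply: free_of_xi; exact: (no_diag Hb).
pose Y w := X k0 i w * \sum_(l <- s) X l i w * D l (V ^~ w).
have nDV l : all_moments P (fun w => D l (V ^~ w)) by exact: all_moments_dprodF.
have nFV : all_moments P (fun w => F (V ^~ w)) by exact: all_moments_prodF.
have nDW l : all_moments P (fun w => D l (W ^~ w)) by exact: all_moments_dprodF.
have nFW : all_moments P (fun w => F (W ^~ w)) by exact: all_moments_prodF.
have nY : all_moments P Y.
  apply: all_momentsM => //; apply: all_moments_sum => l; exact: all_momentsM.
have fY : free_of e i Y.
  apply: free_ofM => //; apply: free_of_sum => l _.
  by apply: free_ofM => //; exact: free_of_dprodF.
pose p w := e i w * X k0 i w * F (W ^~ w).
pose q w := \sum_(l <- s) X k0 i w * X l i w * D l (W ^~ w).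
have np : all_moments P p by do 2 apply: all_momentsM => //.
have nq : all_moments P q.
  by apply: all_moments_sum => l; do 2 apply: all_momentsM => //.
have nXF : all_moments P (fun w => X k0 i w * F (V ^~ w)) by exact: all_momentsM.
have m0 : mean P (fun w => e i w * (X k0 i w * F (V ^~ w))) = 0.
  by apply: (mean_noise1 He) => //; apply: free_ofM => //; exact: free_of_prodF.
have m1 : mean P (fun w => e i w ^+ 2 * Y w) = mean P Y by exact: (mean_noise2 He).
have n0 : all_moments P (fun w => e i w * (X k0 i w * F (V ^~ w))) by exact: all_momentsM.
have n1 : all_moments P (fun w => e i w ^+ 2 * Y w).
  by apply: all_momentsM => //; exact: (noiseX He).
have nA := all_momentsB np n0; have nB := all_momentsB nA n1.
have nC := all_momentsD nB nY; have nR := all_momentsB nC nq.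
have -> : mean P p - mean P q = mean P (fun w => p w - e i w * (X k0 i w * F (V ^~ w))
    - e i w ^+ 2 * Y w + Y w - q w).
  by rewrite meanB// meanD// meanB// meanB// m0 m1; ring.
pose Z w := `|X k0 i w| * S i w ^+ 2.
have nZ : all_moments P Z.
  by apply: all_momentsM; [exact: all_moments_norm|exact: all_momentsX].
have fZ : free_of e i Z.
  apply: free_ofM; first exact: (free_of_comp (@normr_measurable R setT) (fX k0)).
  apply: (free_of_comp (@exprn_measurable R _ 2)); apply: free_of_sum => l _.
  exact: (free_of_comp (@normr_measurable R setT) (fX l)).
have nEZ r : all_moments P (fun w => e i w ^+ r * Z w).
  by apply: all_momentsM => //; exact: (noiseX He).
pose G w := L ^+ 2 * (2^-1 * Z w + (e i w ^+ 2 * Z w + 2^-1 * (e i w ^+ 4 * Z w))).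
have nG0 : all_moments P (fun w => e i w ^+ 2 * Z w + 2^-1 * (e i w ^+ 4 * Z w)).
  by apply: all_momentsD => //; exact: all_momentsZ.
have nG1 : all_moments P (fun w => 2^-1 * Z w + (e i w ^+ 2 * Z w + 2^-1 * (e i w ^+ 4 * Z w))).
  by apply: all_momentsD => //; exact: all_momentsZ.
have nG : all_moments P G by exact: all_momentsZ.
apply: (@le_trans _ _ (mean P G)).
  apply: norm_mean_le => // w.
  have EW : W ^~ w = (fun k => V k w + e i w * X k i w).
    by apply/funext => k; rewrite /V subrK.
  apply: (le_trans (stein_coordinate_pointwise (X k0 i w) EW)).
  rewrite /G /Z -/(S i w) le_eqVlt; apply/orP; left.
  by apply/eqP; ring.
rewrite meanZ// meanD//; last exact: all_momentsZ.
rewrite meanD//; last exact: all_momentsZ.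
rewrite !meanZ// !(mean_noiseM He)// (noise_sqr He) (noise_fourth He) mul1r.
have hm := fourth_moment_ge1 He.
have Z0 : 0 <= mean P Z by apply: mean_ge0 => w; rewrite mulr_ge0 ?sqr_ge0.
set z := mean P Z in Z0 *.
rewrite (_ : 2 * mu4 * L ^+ 2 * z = L ^+ 2 * (2 * mu4 * z)); last by ring.
apply: ler_wpM2l; first exact: sqr_ge0.
have : 0 <= (mu4 - 1) * z by apply: mulr_ge0; lra.
lra.
Qed.

(** One factor [size s] comes from Cauchy-Schwarz on the squared sum, the other from the sum over
    [l]; summing rows over [i] gives the norm 2, independently of [n]. *)
Lemma sum_mean_third :
  \sum_(i < n) mean P (fun w => `|X k0 i w| * S i w ^+ 2)
    <= 4 * mu4 * (size s)%:R ^+ 2 * th.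
Proof.
have hm := fourth_moment_ge1 He.
pose m : R := (size s)%:R.
pose Bs k i := \sum_(j < n) b k i j ^+ 2.
have nXX l i : all_moments P (fun w => `|X k0 i w| * X l i w ^+ 2).
  by apply: all_momentsM; [exact: all_moments_norm|exact: all_momentsX].
have h (i : 'I_n) : mean P (fun w => `|X k0 i w| * S i w ^+ 2) <=
   m * \sum_(l <- s) (2^-1 * th * Bs k0 i + 3 / 2 * mu4 * th * Bs l i).
  apply: (@le_trans _ _ (mean P (fun w => m * \sum_(l <- s) `|X k0 i w| * X l i w ^+ 2))).
    apply: le_mean.
    - by apply: all_momentsM; [exact: all_moments_norm|exact: all_momentsX].
    - by apply: all_momentsZ; apply: all_moments_sum.
    move=> w; rewrite -mulr_sumr [leRHS]mulrCA; apply: ler_wpM2l => //.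
    exact: sqr_norm1_le.
  rewrite meanZ; last exact: all_moments_sum.
  apply: ler_wpM2l => //; rewrite mean_sum//.
  rewrite big_seq [leRHS]big_seq; apply: ler_sum => l ls.
  by apply: (mean_norm_xi_sqr He) => //; exact: (no_row Hb).
apply: (le_trans (ler_sum _ (fun i _ => h i))).
rewrite -mulr_sumr exchange_big/=.
have -> : \sum_(l <- s) \sum_(i < n) (2^-1 * th * Bs k0 i + 3 / 2 * mu4 * th * Bs l i)
   = \sum_(l <- s) (th + 3 * mu4 * th).
  apply: eq_big_seq => l ls; rewrite big_split/= -!mulr_sumr !(no_norm Hb)//.
  by field.
rewrite big_const_seq count_predT iter_addr_0 -/m.
rewrite [leLHS](_ : _ = m ^+ 2 * (th + 3 * mu4 * th)); last first.
  by rewrite -[X in m * X]mulr_natl -/m; ring.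
rewrite (_ : 4 * mu4 * m ^+ 2 * th = m ^+ 2 * (4 * mu4 * th)); last by ring.
apply: ler_wpM2l; first exact: sqr_ge0.
have : 0 <= (mu4 - 1) * th by rewrite mulr_ge0 ?subr_ge0// ltW.
lra.
Qed.

(** For Gaussian forms both means would agree up to covariances. Summing [stein_coordinate] over [i]
    produces half of the gradient inner products against the partial derivatives; the index [k0] has
    trace 2 and yields the main term, while other traces and all fluctuations are errors. *)
Lemma stein_prod :
  `|mean P (fun w => W k0 w * F (W ^~ w)) - mean P (fun w => D k0 (W ^~ w))|
   <= 6 * mu4 ^+ 2 * (size s)%:R ^+ 2 * L ^+ 2 * th.
Proof.
have hm := fourth_moment_ge1 He.
pose m : R := (size s)%:R.
have m1 : 1 <= m by rewrite ler1n; case: (s) k0s.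
have nDW l : all_moments P (fun w => D l (W ^~ w)) by exact: all_moments_dprodF.
have nFW : all_moments P (fun w => F (W ^~ w)) by exact: all_moments_prodF.
pose A (i : 'I_n) := mean P (fun w => e i w * X k0 i w * F (W ^~ w)).
pose C (i : 'I_n) := mean P (fun w => \sum_(l <- s) X k0 i w * X l i w * D l (W ^~ w)).
have nXX l i : all_moments P (fun w => X k0 i w * X l i w) by exact: all_momentsM.
have nXXD l i : all_moments P (fun w => X k0 i w * X l i w * D l (W ^~ w)).
  exact: all_momentsM.
have EA : mean P (fun w => W k0 w * F (W ^~ w)) = 2^-1 * \sum_(i < n) A i.
  rewrite -mean_sum => [|i]; last by do 2 apply: all_momentsM => //.
  rewrite -meanZ; last by apply: all_moments_sum => i; do 2 apply: all_momentsM => //.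
  by congr mean; apply/funext => w; rewrite /W /qform -!mulrA mulr_suml.
pose M l := fun j q => \sum_(i < n) b k0 i j * b l i q.
pose tr l := \sum_(i < n) \sum_(j < n) b k0 i j * b l i j.
pose Qd l := quad e (index_enum 'I_n) (M l).
have nQ l : all_moments P (Qd l) by exact: (all_moments_quad He).
have nDQ l : all_moments P (fun w => D l (W ^~ w) * Qd l w) by exact: all_momentsM.
have EC : \sum_(i < n) C i = \sum_(l <- s)
     (mean P (fun w => D l (W ^~ w) * Qd l w) + tr l * mean P (fun w => D l (W ^~ w))).
  rewrite /C; under eq_bigr do rewrite mean_sum//.
  rewrite exchange_big/=; apply: eq_bigr => l _.
  rewrite -mean_sum// -meanZ// -meanD//; last exact: all_momentsZ.
  congr mean; apply/funext => w; rewrite -mulr_suml sum_xi_mul -/(M l) -/(tr l) -/(Qd l w).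
  ring.
have tr0 : tr k0 = 2.
  rewrite -(no_norm Hb k0s); apply: eq_bigr => i _; apply: eq_bigr => j _.
  by rewrite expr2.
have HCs : forall k, k \in s -> C11 L (f k) (f' k) by [].
have Dle l w : l \in s -> `|D l (W ^~ w)| <= L by move=> ls; apply: dprodF_le.
have hQ l : l \in s -> `|mean P (fun w => D l (W ^~ w) * Qd l w)| <= L * ((2 + mu4) * th).
  move=> ls; apply: (@le_trans _ _ (mean P (fun w => L * `|Qd l w|))).
    apply: norm_mean_le => //; first by apply: all_momentsZ; exact: all_moments_norm.
    by move=> w; rewrite normrM; apply: ler_wpM2r => //; exact: Dle.
  rewrite meanZ; last exact: all_moments_norm.
  apply: ler_wpM2l => //; apply: (mean_norm_quad He); first exact: ltW.
  exact: (no_prod Hb).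
have hD l : l \in s -> `|mean P (fun w => D l (W ^~ w))| <= L.
  move=> ls; rewrite -[leRHS](mean_cst P L); apply: norm_mean_le => //.
    exact: all_moments_cst.
  by move=> w; exact: Dle.
have h1 : `|\sum_(i < n) (A i - C i)| <= 2 * mu4 * L ^+ 2 * (4 * mu4 * m ^+ 2 * th).
  apply: (le_trans (ler_norm_sum _ _ _)).
  apply: (le_trans (ler_sum _ (fun i _ => stein_coordinate i))).
  rewrite -mulr_sumr; apply: ler_wpM2l; last exact: sum_mean_third.
  by rewrite mulr_ge0 ?sqr_ge0//; lra.
have h2 : `|\sum_(l <- s) mean P (fun w => D l (W ^~ w) * Qd l w)|
    <= m * (L * ((2 + mu4) * th)).
  apply: (le_trans (ler_norm_sum _ _ _)); rewrite /m mulr_natl -iter_addr_0.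
  rewrite -(count_predT s) -big_const_seq big_seq [leRHS]big_seq.
  by apply: ler_sum => l; exact: hQ.
have h3 : `|\sum_(l <- rem k0 s) tr l * mean P (fun w => D l (W ^~ w))|
    <= m * (th * L).
  apply: (@le_trans _ _ (\sum_(l <- rem k0 s) th * L)).
    apply: (le_trans (ler_norm_sum _ _ _)); rewrite big_seq [leRHS]big_seq.
    apply: ler_sum => l; rewrite mem_rem_uniq// inE => /andP[lk ls].
    rewrite normrM; apply: ler_pM => //; last exact: hD.
    by apply: (no_trace Hb) => //; rewrite eq_sym.
  rewrite big_const_seq count_predT iter_addr_0 -mulr_natl.
  apply: ler_wpM2r; first by rewrite mulr_ge0// ltW.
  by rewrite /m ler_nat size_rem// leq_pred.
have E : mean P (fun w => W k0 w * F (W ^~ w)) - mean P (fun w => D k0 (W ^~ w)) =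
  2^-1 * (\sum_(i < n) (A i - C i) + (\sum_(l <- s) mean P (fun w => D l (W ^~ w) * Qd l w)
   + \sum_(l <- rem k0 s) tr l * mean P (fun w => D l (W ^~ w)))).
  rewrite EA sumrB EC big_split/=.
  rewrite [X in _ - (_ + X)](big_rem k0)//= tr0.
  set a := \sum_(i < n) A i; set c := \sum_(l <- s) _; set g := \sum_(l <- rem _ _) _.
  by field.
rewrite E normrM ger0_norm// -/m.
set z1 := \sum_(i < n) _ in h1 *; set z2 := \sum_(l <- s) _ in h2 *.
set z3 := \sum_(l <- rem _ _) _ in h3 *.
have t1 : `|z1 + (z2 + z3)| <= `|z1| + (`|z2| + `|z3|).
  by rewrite (le_trans (ler_normD _ _))// lerD2l ler_normD.
(* Every error term is at most a multiple of mu4^2 m^2 L^2 th, because mu4, m and L are at least 1. *)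
have u1 : m * (L * ((2 + mu4) * th)) <= 3 * (mu4 ^+ 2 * m ^+ 2 * L ^+ 2 * th).
  rewrite (_ : 3 * _ = m ^+ 2 * (L ^+ 2 * (3 * mu4 ^+ 2 * th))); last by ring.
  have m2 : m <= m ^+ 2 by rewrite expr2 ler_peMr//; lra.
  have L2 : L <= L ^+ 2 by rewrite expr2 ler_peMr//; lra.
  have mm : mu4 <= mu4 ^+ 2 by rewrite expr2 ler_peMr//; lra.
  have q0 : 0 <= (2 + mu4) * th by rewrite mulr_ge0 ?(ltW th0)//; lra.
  apply: ler_pM => //; first by rewrite mulr_ge0.
  apply: ler_pM => //; apply: ler_wpM2r; [exact: ltW|lra].
have u2 : m * (th * L) <= mu4 ^+ 2 * m ^+ 2 * L ^+ 2 * th.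
  rewrite (_ : mu4 ^+ 2 * _ * _ * _ = m ^+ 2 * (mu4 ^+ 2 * th * L ^+ 2)); last by ring.
  have m2 : m <= m ^+ 2 by rewrite expr2 ler_peMr//; lra.
  have L2 : L <= L ^+ 2 by rewrite expr2 ler_peMr//; lra.
  have mm : 1 <= mu4 ^+ 2 by rewrite expr_ge1//; lra.
  apply: ler_pM => //; first by rewrite mulr_ge0// ltW.
  apply: ler_pM => //; first exact: ltW.
  by rewrite ler_peMl// ltW.
(* The constant is half of 8 + 3 + 1: third-order remainders, fluctuations and traces. *)
rewrite (_ : 6 * _ * _ * _ * _ = 2^-1 * (2 * mu4 * L ^+ 2 * (4 * mu4 * m ^+ 2 * th)
  + (3 * (mu4 ^+ 2 * m ^+ 2 * L ^+ 2 * th) + mu4 ^+ 2 * m ^+ 2 * L ^+ 2 * th))); last by field.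
rewrite ler_wpM2l//; lra.
Qed.

End Functions.

End SteinComparison.

(** * Replacing factors by Gaussian means one at a time *)

Section Telescoping.
Context d (T : measurableType d) (R : realType) (P : probability T R).
Variables (e : nat -> {RV P >-> R}) (mu4 : R).
Hypothesis He : noise e mu4.
Variable n : nat.

Lemma nearly_orthogonalS (s1 s2 : seq nat) (b : nat -> 'I_n -> 'I_n -> R) th :
  {subset s1 <= s2} -> nearly_orthogonal s2 b th -> nearly_orthogonal s1 b th.
Proof.
move=> ss [h1 h2 h3 h4 h5 h6]; split=> //.
- by move=> k /ss; exact: h3.
- by move=> k i /ss; exact: h4.
- by move=> k l /ss ks /ss; exact: h5.
- by move=> k l /ss ks /ss; exact: h6.
Qed.

(* The hypothesis gE says that c G solves the Stein equation of the standard
   normal law for g, so that gam plays the role of the Gaussian mean of g. *)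
Lemma mean_prod_qform (b : nat -> 'I_n -> 'I_n -> R) (s : seq nat) (th L c gam : R)
    (g g' G G' : R -> R) (m : nat) :
  nearly_orthogonal s b th -> uniq s -> (size s <= m)%N ->
  1 <= L -> 0 < th -> 0 <= c -> `|gam| <= 1 ->
  C11 L g g' -> C11 L G G' ->
  (forall x, g x - gam = c * (G' x - x * G x)) ->
  `|mean P (fun w => \prod_(k <- s) g (qform e b k w)) - gam ^+ size s|
   <= (size s)%:R * (c * (6 * mu4 ^+ 2 * m%:R ^+ 2 * L ^+ 2 * th)).
Proof.
move=> + + + L1 th0 c0 gam1 Cg CG gE.
(* The price of one replacement, stated with the fixed bound [m] so that it stays the same along the
   induction. *)
set K := c * _.
have mg k : all_moments P (fun w => g (qform e b k w)).
  exact: (all_moments_C11 P (fun _ => Cg) 0 (all_moments_measurable (all_moments_qform He b k))).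
elim: s => [|k s IH] Hb us ms.
  under eq_fun do rewrite big_nil.
  by rewrite mean_cst expr0 subrr normr0 mul0r.
have /andP[ks us'] := us.
have ss : {subset s <= k :: s} by move=> j js; rewrite inE js orbT.
have {}IH := IH (nearly_orthogonalS ss Hb) us' (ltnW ms).
(* The Stein solution takes the slot [k] and the cutoff the others. For this mixed product
   [stein_prod] says that G' - x G, taken at the k-th form, is nearly orthogonal to the remaining
   product. *)
pose f j := if j == k then G else g.
pose f' j := if j == k then G' else g'.
have HC j : C11 L (f j) (f' j) by rewrite /f /f'; case: eqP.
pose V w := (qform e b) ^~ w.
have ps w : \prod_(j <- s) f j (qform e b j w) = \prod_(j <- s) g (qform e b j w).
  by apply: eq_big_seq => j js; rewrite /f ifN//; apply: contraNneq ks => <-.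
have Fs w : prodF f (k :: s) (V w) = G (qform e b k w) * \prod_(j <- s) g (qform e b j w).
  by rewrite /prodF big_cons ps /f eqxx.
have Ds w : dprodF f f' (k :: s) k (V w) = G' (qform e b k w) * \prod_(j <- s) g (qform e b j w).
  by rewrite /dprodF /= eqxx ps /f' eqxx.
have := stein_prod He HC Hb us (mem_head k s) L1 th0.
rewrite -/(V _).
have -> : mean P (fun w => qform e b k w * prodF f (k :: s) (V w)) =
  mean P (fun w => qform e b k w * (G (qform e b k w) * \prod_(j <- s) g (qform e b j w))).
  by congr mean; apply/funext => w; rewrite Fs.
have -> : mean P (fun w => dprodF f f' (k :: s) k (V w)) =
  mean P (fun w => G' (qform e b k w) * \prod_(j <- s) g (qform e b j w)).
  by congr mean; apply/funext => w; rewrite Ds.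
set A := mean P _; set D := mean P _ => hS.
have nprod : all_moments P (fun w => \prod_(j <- s) g (qform e b j w)).
  by apply: all_moments_prod => j.
have mq := all_moments_measurable (all_moments_qform He b k).
have nG : all_moments P (fun w => G (qform e b k w)).
  exact: (all_moments_C11 P (fun _ => CG) 0 mq).
have nG' : all_moments P (fun w => G' (qform e b k w)).
  exact: (all_moments_dC11 P (fun _ => CG) 0 mq).
have E : mean P (fun w => \prod_(j <- k :: s) g (qform e b j w)) =
  c * (D - A) + gam * mean P (fun w => \prod_(j <- s) g (qform e b j w)).
  rewrite -meanB; last 2 first.
  - exact: all_momentsM.
  - by apply: all_momentsM; [exact: (all_moments_qform He)|exact: all_momentsM].
  rewrite -meanZ; last first.
    apply: all_momentsB; first exact: all_momentsM.
    by apply: all_momentsM; [exact: (all_moments_qform He)|exact: all_momentsM].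
  rewrite -meanZ// -meanD; last 2 first.
  - apply: all_momentsZ; apply: all_momentsB; first exact: all_momentsM.
    by apply: all_momentsM; [exact: (all_moments_qform He)|exact: all_momentsM].
  - exact: all_momentsZ.
  congr mean; apply/funext => w; rewrite big_cons.
  by have := gE (qform e b k w) => /eqP; rewrite subr_eq => /eqP ->; ring.
rewrite E [size _]/= exprS -addrA -mulrBr.
apply: (le_trans (ler_normD _ _)); rewrite -natr1 mulrDl mul1r addrC; apply: lerD.
  by rewrite normrM -[leRHS]mul1r; apply: ler_pM.
rewrite normrM ger0_norm// /K; apply: ler_wpM2l => //; rewrite distrC.
apply: (le_trans hS); apply: ler_wpM2r; first exact: ltW.
apply: ler_wpM2r; first exact: sqr_ge0.
apply: ler_wpM2l; first by apply: mulr_ge0 => //; exact: sqr_ge0.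
by rewrite ler_sqr ?nnegrE// ler_nat.
Qed.

End Telescoping.

(** * A smooth cutoff at a prescribed scale *)

Section SmoothStep.
Context (R : realType).
Implicit Types (f g : R -> R) (x h : R).

(** Differentiates piecewise quadratic functions across their knots, where the quadratic bound
    follows from a case analysis on signs. *)
Lemma is_derive_of_taylor f x (a K : R) :
  (forall h, `|f (x + h) - f x - h * a| <= K * h ^+ 2) -> is_derive x 1 f a.
Proof.
move=> H.
have K0 : 0 <= K by have := H 1; rewrite expr1n mulr1; exact: le_trans.
have cv : h^-1 *: (f (h *: 1 + x) - f x) @[h --> 0^'] --> a.
  apply/cvgrPdist_le => eps eps0; near=> h.
  have h0 : h != 0 by near: h; exact: nbhs_dnbhs_neq.
  have hs : `|h| <= eps / (K + 1).
    near: h; apply: dnbhs0_le; rewrite divr_gt0//; lra.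
  rewrite /GRing.scale/= mulr1 (addrC h) distrC.
  rewrite (_ : _ - a = h^-1 * (f (x + h) - f x - h * a)); last by rewrite [RHS]mulrBr mulKf.
  rewrite normrM normfV; apply: (@le_trans _ _ (`|h|^-1 * (K * h ^+ 2))).
    by apply: ler_wpM2l => //; rewrite invr_ge0.
  rewrite -(real_normK (num_real h)) [leLHS](_ : _ = K * `|h|); last first.
    by field; rewrite normr_eq0.
  apply: (le_trans (ler_wpM2l K0 hs)).
  by rewrite mulrCA ler_piMr ?(ltW eps0)// ler_pdivrMr ?mul1r; lra.
apply: DeriveDef; first by apply/cvg_ex; exists a.
by rewrite /derive; apply/cvg_lim.
Unshelve. all: by end_near. Qed.

Lemma mean_value f f' : (forall x : R, is_derive x 1 f (f' x)) ->
  forall x h, exists c, `|c - x| <= `|h| /\ f (x + h) - f x = h * f' c.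
Proof.
move=> df x h.
have cf : continuous f.
  move=> y; apply: differentiable_continuous; apply/derivable1_diffP.
  by have [] := df y.
have [h0|h0] := leP 0 h.
- have xh : x <= x + h by rewrite lerDl.
  have [|c] := @MVT_segment R f f' x (x + h) xh (fun y _ => df y).
    exact: continuous_subspaceT.
  rewrite in_itv/= => /andP[xc cx] E; exists c.
  by rewrite E (addrC x) addrK mulrC; split => //; rewrite !ger0_norm ?subr_ge0//; lra.
- have xh : x + h <= x by rewrite gerDl ltW.
  have [|c] := @MVT_segment R f f' (x + h) x xh (fun y _ => df y).
    exact: continuous_subspaceT.
  rewrite in_itv/= => /andP[xc cx] E; exists c; split.
    by rewrite ler0_norm ?subr_le0// ltr0_norm//; lra.
  by rewrite -[LHS]opprB E; ring.
Qed.

Lemma derivative_continuous f f' : (forall x : R, is_derive x 1 f (f' x)) -> continuous f.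
Proof.
move=> df y; apply: differentiable_continuous; apply/derivable1_diffP.
by have [] := df y.
Qed.

Lemma lipschitz_of_derivative f f' (K : R) : (forall x : R, is_derive x 1 f (f' x)) ->
  (forall x, `|f' x| <= K) -> forall x h, `|f (x + h) - f x| <= K * `|h|.
Proof.
move=> df fK x h; have [c [_ ->]] := mean_value df x h.
by rewrite normrM mulrC ler_wpM2r.
Qed.

Lemma lipschitz_continuous f (K : R) :
  (forall x h, `|f (x + h) - f x| <= K * `|h|) -> continuous f.
Proof.
move=> H x.
have K0 : 0 <= K by have := H 0 1; rewrite normr1 mulr1; exact: le_trans.
apply/cvgrPdist_le => eps eps0; near=> y.
have hs : `|x - y| <= eps / (K + 1).
  near: y; apply: cvgr_dist_le; [exact: cvg_id|rewrite divr_gt0//; lra].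
have := H x (y - x); rewrite [in f _]addrC subrK distrC => /le_trans; apply.
rewrite distrC; apply: (le_trans (ler_wpM2l K0 hs)).
by rewrite mulrCA ler_piMr ?(ltW eps0)// ler_pdivrMr ?mul1r; lra.
Unshelve. all: by end_near. Qed.

Lemma C11_of_derive (L : R) f f' : 0 <= L ->
  (forall x : R, is_derive x 1 f (f' x)) -> (forall x, `|f x| <= 1) ->
  (forall x, `|f' x| <= L) ->
  (forall x h, `|f' (x + h) - f' x| <= L ^+ 2 * `|h|) -> C11 L f f'.
Proof.
move=> L0 df f1 fL fl; split => //.
- by apply: continuous_measurable_fun; exact: derivative_continuous df.
- by apply: continuous_measurable_fun; exact: lipschitz_continuous fl.
- exact: lipschitz_of_derivative.
- move=> x h; have [c [cx ->]] := mean_value df x h.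
  rewrite -mulrBr normrM -(real_normK (num_real h)).
  have := fl x (c - x); rewrite (addrC x) subrK => /(ler_wpM2l (normr_ge0 h))/le_trans; apply.
  rewrite mulrCA expr2; apply: ler_wpM2l; first exact: sqr_ge0.
  exact: ler_wpM2l.
Qed.

Definition pos_part x : R := Num.max 0 x.

Lemma pos_part_cases x : (0 <= x /\ pos_part x = x) \/ (x <= 0 /\ pos_part x = 0).
Proof.
rewrite /pos_part; have [x0|x0] := leP 0 x; first by left.
by right; rewrite ltW.
Qed.

(* A C^1 spline with value 1 on ]-oo, 0] and 0 on [1, +oo[. *)
Definition step x : R :=
  1 - 2 * pos_part x ^+ 2 + 4 * pos_part (x - 2^-1) ^+ 2 - 2 * pos_part (x - 1) ^+ 2.

Definition dstep x : R :=
  - 4 * pos_part x + 8 * pos_part (x - 2^-1) - 4 * pos_part (x - 1).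

Lemma step_le0 x : x <= 0 -> step x = 1.
Proof.
move=> x0; rewrite /step.
have [[? ->]|[? ->]] := pos_part_cases x;
have [[? ->]|[? ->]] := pos_part_cases (x - 2^-1);
have [[? ->]|[? ->]] := pos_part_cases (x - 1); nra.
Qed.

Lemma step_ge1 x : 1 <= x -> step x = 0.
Proof.
move=> x1; rewrite /step.
have [[? ->]|[? ->]] := pos_part_cases x;
have [[? ->]|[? ->]] := pos_part_cases (x - 2^-1);
have [[? ->]|[? ->]] := pos_part_cases (x - 1); nra.
Qed.

Lemma step_itv x : 0 <= step x <= 1.
Proof.
rewrite /step; apply/andP; split;
have [[? ->]|[? ->]] := pos_part_cases x;
have [[? ->]|[? ->]] := pos_part_cases (x - 2^-1);
have [[? ->]|[? ->]] := pos_part_cases (x - 1); nra.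
Qed.

Lemma dstep_itv x : - 2 <= dstep x <= 0.
Proof.
rewrite /dstep; apply/andP; split;
have [[? ->]|[? ->]] := pos_part_cases x;
have [[? ->]|[? ->]] := pos_part_cases (x - 2^-1);
have [[? ->]|[? ->]] := pos_part_cases (x - 1); lra.
Qed.

Lemma pos_part_lip x h : `|pos_part (x + h) - pos_part x| <= `|h|.
Proof.
have h1 : h <= `|h| by exact: ler_norm.
have h2 : - h <= `|h| by rewrite -normrN ler_norm.
rewrite ler_norml; apply/andP; split;
have [[? ->]|[? ->]] := pos_part_cases x;
have [[? ->]|[? ->]] := pos_part_cases (x + h); lra.
Qed.

Lemma pos_part_sqr_taylor x h :
  `|pos_part (x + h) ^+ 2 - pos_part x ^+ 2 - h * (2 * pos_part x)| <= h ^+ 2.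
Proof.
rewrite ler_norml; apply/andP; split;
have [[? ->]|[? ->]] := pos_part_cases x;
have [[? ->]|[? ->]] := pos_part_cases (x + h); nra.
Qed.

Lemma dstep_lip x h : `|dstep (x + h) - dstep x| <= 16 * `|h|.
Proof.
have h1 := pos_part_lip x h.
have h2 := pos_part_lip (x - 2^-1) h.
have h3 := pos_part_lip (x - 1) h.
rewrite /dstep !(addrAC x h).
move: h1 h2 h3; rewrite !ler_norml => /andP[? ?] /andP[? ?] /andP[? ?].
apply/andP; split; lra.
Qed.

(** For positive [del], equal to 1 up to [u] and to 0 from [u + del] on. *)
Definition cutoff (u del x : R) : R := step (del^-1 * (x - u)).
Definition dcutoff (u del x : R) : R := del^-1 * dstep (del^-1 * (x - u)).

Lemma is_derive_cutoff u del x : is_derive x 1 (cutoff u del) (dcutoff u del x).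
Proof.
apply: (@is_derive_of_taylor _ _ _ (8 * (del^-1) ^+ 2)) => h.
rewrite /cutoff /dcutoff (_ : x + h - u = (x - u) + h) 1?mulrDr; last by ring.
set y := del^-1 * (x - u); rewrite mulrCA mulrA -mulrA.
have h1 := pos_part_sqr_taylor y (del^-1 * h).
have h2 := pos_part_sqr_taylor (y - 2^-1) (del^-1 * h).
have h3 := pos_part_sqr_taylor (y - 1) (del^-1 * h).
rewrite (_ : 8 * _ * _ = 8 * (del^-1 * h) ^+ 2); last by ring.
set k := del^-1 * h in h1 h2 h3 *.
rewrite (_ : del^-1 * (h * dstep y) = k * dstep y); last by rewrite /k; ring.
rewrite /step /dstep !(addrAC y k).
move: h1 h2 h3; rewrite !ler_norml => /andP[? ?] /andP[? ?] /andP[? ?].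
apply/andP; split; lra.
Qed.

(** [dstep] is bounded by 2 and 16-Lipschitz, so L has to satisfy 2 / del <= L and 16 / del^2 <=
    L^2. *)
Lemma cutoff_C11 u del : 0 < del -> C11 (4 * del^-1) (cutoff u del) (dcutoff u del).
Proof.
move=> d0; have i0 : 0 < del^-1 by rewrite invr_gt0.
apply: C11_of_derive.
- lra.
- exact: is_derive_cutoff.
- by move=> x; have /andP[? ?] := step_itv (del^-1 * (x - u)); rewrite ger0_norm.
- move=> x; have /andP[? ?] := dstep_itv (del^-1 * (x - u)).
  rewrite normrM gtr0_norm// mulrC; apply: ler_wpM2r; first exact: ltW.
  rewrite ler_norml; apply/andP; split; lra.
- move=> x h; rewrite /dcutoff -mulrBr normrM gtr0_norm//.
  have := dstep_lip (del^-1 * (x - u)) (del^-1 * h).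
  rewrite -mulrDr (addrAC x) normrM (gtr0_norm i0).
  move=> /(ler_wpM2l (ltW i0))/le_trans; apply.
  by rewrite le_eqVlt; apply/orP; left; apply/eqP; ring.
Qed.

End SmoothStep.

(** * The Gaussian density and Mills ratio bounds *)

Section GaussianTail.
Context (R : realType).
Notation mu := (@lebesgue_measure R).
Implicit Types (x y : R) (h : R -> R).

Definition gpdf x : R := normal_pdf 0 1 x.

Lemma gpdfE x : gpdf x = (Num.sqrt (2 * pi))^-1 * expR (- x ^+ 2 / 2).
Proof.
rewrite /gpdf normal_pdfE ?oner_eq0// /normal_peak /normal_fun.
by rewrite expr1n mul1r subr0 -[pi *+ 2]mulr_natl.
Qed.

Lemma gpdf_gt0 x : 0 < gpdf x.
Proof.
rewrite gpdfE mulr_gt0 ?expR_gt0// invr_gt0 sqrtr_gt0 mulr_gt0//.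
exact: pi_gt0.
Qed.

Lemma gpdfN x : gpdf (- x) = gpdf x.
Proof. by rewrite !gpdfE sqrrN. Qed.

Lemma gpdf_le x y : `|x| <= y -> gpdf y <= gpdf x.
Proof.
move=> xy; rewrite !gpdfE ler_pM2l; last first.
  by rewrite invr_gt0 sqrtr_gt0 mulr_gt0// pi_gt0.
rewrite ler_expR ler_pM2r ?invr_gt0// lerN2 -(real_normK (num_real x)).
by rewrite lerXn2r// nnegrE (le_trans _ xy).
Qed.

Lemma sqrt_2pi_ge1 : 1 <= Num.sqrt (2 * pi) :> R.
Proof. by rewrite -[leLHS]sqrtr1 ler_wsqrtr//; have := @pi_ge2 R; lra. Qed.

Lemma gpdf_le_expR x : gpdf x <= expR (- x ^+ 2 / 2).
Proof.
rewrite gpdfE -[leRHS]mul1r ler_wpM2r ?expR_ge0// invf_le1 ?sqrt_2pi_ge1//.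
exact: lt_le_trans ltr01 sqrt_2pi_ge1.
Qed.

Lemma gpdf_le1 x : gpdf x <= 1.
Proof.
apply: (le_trans (gpdf_le_expR x)); rewrite -expR0 ler_expR mulNr oppr_le0.
by rewrite divr_ge0// sqr_ge0.
Qed.

Lemma is_derive_gpdf x : is_derive x 1 gpdf (- x * gpdf x).
Proof.
have -> : gpdf = (fun x => (Num.sqrt (2 * pi))^-1 * expR (- x ^+ 2 / 2)).
  by apply/funext => y; rewrite gpdfE.
rewrite -gpdfE gpdfE.
have D : is_derive x 1 (fun y : R => - y ^+ 2 / 2) (- x).
  have -> : (fun y : R => - y ^+ 2 / 2) = (fun y : R => (- 2^-1) *: (y ^+ 2)).
    by apply/funext => y; rewrite /GRing.scale/=; field.
  by apply: is_derive_eq; rewrite /GRing.scale/= ?expr1; field.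
have := @is_derive1_comp R expR (fun y : R => - y ^+ 2 / 2) x _ _ (is_derive_expR _) D.
move=> DE.
have -> : (fun x0 : R => (Num.sqrt (2 * pi))^-1 * expR (- x0 ^+ 2 / 2)) =
   (fun x0 : R => (Num.sqrt (2 * pi))^-1 *: (expR \o (fun y : R => - y ^+ 2 / 2)) x0) by [].
apply: is_derive_eq; rewrite /GRing.scale/=; ring.
Qed.

Lemma gpdf_continuous : continuous gpdf.
Proof. exact: derivative_continuous is_derive_gpdf. Qed.

Lemma gpdf_measurable : measurable_fun setT gpdf.
Proof. exact: continuous_measurable_fun gpdf_continuous. Qed.

Lemma gpdf_cvg0 : gpdf x @[x --> +oo] --> (0 : R).
Proof.
apply: (@squeeze_cvgr _ _ _ _ (cst 0) (fun x => expR (- x))).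
- near=> x; rewrite ltW ?gpdf_gt0//=; apply: (le_trans (gpdf_le_expR x)).
  rewrite ler_expR mulNr lerN2 ler_pdivlMr//.
  have x2 : 2 <= x by near: x; exact: nbhs_pinfty_ge.
  nra.
- exact: cvg_cst.
- exact: cvgr_expR.
Unshelve. all: by end_near. Qed.

Lemma integrable_gpdf : mu.-integrable setT (EFin \o gpdf).
Proof. exact: integrable_normal_pdf. Qed.

Lemma Rintegral_gpdf : \int[mu]_x gpdf x = 1.
Proof. by rewrite /Rintegral integral_normal_pdf. Qed.

Definition gtail x : R := \int[mu]_(t in `[x, +oo[) gpdf t.
Definition gcdf x : R := \int[mu]_(t in `]-oo, x]) gpdf t.

Lemma Rintegral_split h x : mu.-integrable setT (EFin \o h) ->
  \int[mu]_t h t = \int[mu]_(t in `]-oo, x]) h t + \int[mu]_(t in `[x, +oo[) h t.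
Proof.
move=> ih.
have S : `]-oo, x]%classic `|` `]x, +oo[%classic = [set: R].
  by rewrite -setCitvl setUv.
rewrite -[in LHS]S Rintegral_setU//=.
- congr (_ + _); apply: Rintegral_itv_obnd_cbnd.
  by apply: integrableS ih.
- by rewrite S.
- by apply/disj_setPS => y [] /=; rewrite !in_itv/= andbT => yx; rewrite ltNge yx.
Qed.

Lemma gcdfD x : gcdf x + gtail x = 1.
Proof. by rewrite -Rintegral_split ?Rintegral_gpdf//; exact: integrable_gpdf. Qed.

Lemma gcdfN x : gcdf (- x) = gtail x.
Proof.
rewrite /gcdf /gtail /Rintegral ge0_integration_by_substitutionNy.
- by congr fine; apply: eq_integral => t _ /=; rewrite gpdfN.
- by apply: continuous_subspaceT; exact: gpdf_continuous.
- by move=> t _; rewrite ltW// gpdf_gt0.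
Qed.

Lemma gtail_ge0 x : 0 <= gtail x.
Proof. by apply: Rintegral_ge0 => t _; rewrite ltW// gpdf_gt0. Qed.

Lemma integral_tailE (F f : R -> R) x : 0 < x ->
  (forall t, x <= t -> 0 <= f t) -> (forall t : R, 0 < t -> is_derive t 1 F (f t)) ->
  (forall t : R, 0 < t -> {for t, continuous f}) ->
  F t @[t --> +oo] --> (0 : R) ->
  (\int[mu]_(t in `[x, +oo[) (f t)%:E = (- F x)%:E)%E.
Proof.
move=> x0 f0 dF cf F0.
rewrite (@ge0_continuous_FTC2y R f F x 0)// ?sub0r//.
- by rewrite -EFinN -EFinD sub0r.
- apply: continuous_in_subspaceT => t; rewrite inE/= in_itv/= andbT => xt.
  by apply: cf; exact: lt_le_trans xt.
- by move=> t xt; have [] := dF t (lt_trans x0 xt).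
- apply: cvg_at_right_filter; apply: differentiable_continuous.
  by apply/derivable1_diffP; have [] := dF x x0.
- move=> t; rewrite in_itv/= andbT => xt; rewrite derive1E.
  by have [_ ->] := dF t (lt_trans x0 xt).
Qed.

Lemma gtailE x : (\int[mu]_(t in `[x, +oo[) (gpdf t)%:E)%E = (gtail x)%:E.
Proof.
rewrite /gtail /Rintegral fineK//; apply: integrable_fin_num => //.
by apply: integrableS integrable_gpdf.
Qed.

Lemma gtail_mulE x (c : R) : (\int[mu]_(t in `[x, +oo[) (c * gpdf t)%:E)%E = (c * gtail x)%:E.
Proof.
under eq_integral do rewrite EFinM.
rewrite integralZl//; first by rewrite gtailE.
by apply: integrableS integrable_gpdf.
Qed.

(** On the tail x gpdf(t) <= t gpdf(t), whose primitive is - gpdf(t). *)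
Lemma gtail_le x : 0 < x -> x * gtail x <= gpdf x.
Proof.
move=> x0; rewrite -lee_fin -gtail_mulE.
have <- : (\int[mu]_(t in `[x, +oo[) (t * gpdf t)%:E = (gpdf x)%:E)%E.
  rewrite -[in RHS](opprK (gpdf x)).
  apply: (@integral_tailE (fun t => - gpdf t) (fun t => t * gpdf t)) => //.
  - by move=> t xt; rewrite mulr_ge0 ?(ltW (gpdf_gt0 t))// (le_trans (ltW x0)).
  - move=> t _; have D := is_derive_gpdf t.
    by apply: is_derive_eq; rewrite mulNr opprK.
  - by move=> t _; apply: continuousM => //; exact: gpdf_continuous.
  - by rewrite -oppr0; apply: cvgN; exact: gpdf_cvg0.
apply: ge0_le_integral => //=.
- by move=> t _; rewrite lee_fin mulr_ge0 ?ltW// gpdf_gt0.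
- by apply/measurable_EFinP; apply: measurable_funM => //; apply: measurable_funTS; exact: gpdf_measurable.
- by apply/measurable_EFinP; apply: measurable_funM => //; apply: measurable_funTS; exact: gpdf_measurable.
- move=> t; rewrite in_itv/= andbT => xt; rewrite lee_fin.
  by rewrite ler_wpM2r// ltW// gpdf_gt0.
Qed.

(** The function - gpdf(t) / t has derivative (1 + t^-2) gpdf(t), and on the tail 1 + t^-2 is at
    most 1 + x^-2. *)
Lemma gtail_ge x : 0 < x -> x * gpdf x <= (1 + x ^+ 2) * gtail x.
Proof.
move=> x0.
have xn : x != 0 by rewrite gt_eqF.
suff : ((x^-1 * gpdf x)%:E <= ((1 + x ^- 2) * gtail x)%:E)%E.
  rewrite lee_fin => h; have := ler_wpM2l (ltW (exprn_gt0 2 x0)) h.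
  rewrite (_ : x ^+ 2 * _ = x * gpdf x); last by field.
  by rewrite (_ : x ^+ 2 * _ = (1 + x ^+ 2) * gtail x)//; field.
rewrite -gtail_mulE.
have cm (t : R) : 0 < t -> {for t, continuous (fun y : R => (1 + y ^- 2) * gpdf y)}.
  move=> t0; apply: continuousM; last exact: gpdf_continuous.
  apply: continuousD; first exact: cst_continuous.
  apply: continuousV; first by rewrite expf_neq0// gt_eqF.
  exact: exprn_continuous.
have <- : (\int[mu]_(t in `[x, +oo[) ((1 + t ^- 2) * gpdf t)%:E = (x^-1 * gpdf x)%:E)%E.
  rewrite -[in RHS](opprK (x^-1 * gpdf x)).
  apply: (@integral_tailE (fun t => - (t^-1 * gpdf t)) (fun t => (1 + t ^- 2) * gpdf t)) => //.
  - move=> t xt; rewrite mulr_ge0 ?(ltW (gpdf_gt0 t))// addr_ge0// invr_ge0.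
    exact: sqr_ge0.
  - move=> t t0; have D := is_derive_gpdf t.
    have tn : t != 0 by rewrite gt_eqF.
    have DV : is_derive t 1 (fun y : R => y^-1) (- t ^- 2).
      have := @is_deriveV R (fun y => y) t 1 1 tn (is_derive_id _ _).
      by rewrite /GRing.scale/= mulr1.
    have := @is_deriveN R R R _ t 1 _ (@is_deriveM R R (fun y : R => y^-1) gpdf t 1 _ _ DV D).
    by move=> DN; apply: (is_derive_eq DN); rewrite /GRing.scale/=; field.
  - apply: (@squeeze_cvgr _ _ _ _ (fun t => - gpdf t) (cst 0)).
    + near=> t.
      have t1 : 1 <= t by near: t; exact: nbhs_pinfty_ge.
      have t0 : 0 < t by exact: lt_le_trans t1.
      have pt := gpdf_gt0 t.
      apply/andP; split; first by rewrite lerN2 ler_piMl ?(ltW pt)// invf_le1.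
      by rewrite /= oppr_le0 mulr_ge0 ?invr_ge0 ?ltW.
    + by rewrite -oppr0; apply: cvgN; exact: gpdf_cvg0.
    + exact: cvg_cst.
apply: ge0_le_integral => //=.
- move=> t; rewrite in_itv/= andbT => xt; rewrite lee_fin mulr_ge0 ?(ltW (gpdf_gt0 t))//.
  by rewrite addr_ge0// invr_ge0 sqr_ge0.
- apply/measurable_EFinP; apply: subspace_continuous_measurable_fun => //.
  apply: continuous_in_subspaceT => t; rewrite inE/= in_itv/= andbT => xt.
  exact: cm (lt_le_trans x0 xt).
- by apply/measurable_EFinP; apply: measurable_funM => //; apply: measurable_funTS; exact: gpdf_measurable.
- move=> t; rewrite in_itv/= andbT => xt; rewrite lee_fin ler_wpM2r ?(ltW (gpdf_gt0 t))//.
  have t0 := lt_le_trans x0 xt; rewrite lerD2l lef_pV2 ?posrE ?exprn_gt0//.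
  by apply: lerXn2r; rewrite ?nnegrE// ltW.
Unshelve. all: by end_near. Qed.

End GaussianTail.

(** * Stein's equation for the cutoff *)

Section SteinEquation.
Context (R : realType).
Notation mu := (@lebesgue_measure R).
Variables (g g' : R -> R) (u v ell : R).
Hypotheses (u0 : 0 <= u) (v1 : 1 <= v) (ell0 : 0 <= ell).
Hypotheses (g01 : forall x, 0 <= g x <= 1) (g_low : forall x, x <= u -> g x = 1)
  (g_up : forall x, v <= x -> g x = 0).
Hypotheses (dg : forall x : R, is_derive x 1 g (g' x)) (g'_le : forall x, `|g' x| <= ell).

Definition gauss_mean : R := \int[mu]_x (g x * gpdf x).

Let cg : continuous g. Proof. exact: derivative_continuous dg. Qed.

Let mgg : measurable_fun setT (fun x => g x * gpdf x).
Proof.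
apply: measurable_funM; last exact: gpdf_measurable.
exact: continuous_measurable_fun.
Qed.

Let igg : mu.-integrable setT (EFin \o (fun x => g x * gpdf x)).
Proof.
apply: (le_integrable _ _ _ (integrable_gpdf R)) => //; first exact/measurable_EFinP.
move=> x _ /=; rewrite lee_fin normrM ler_piMl//.
by have /andP[? ?] := g01 x; rewrite ger0_norm.
Qed.

Lemma gauss_mean_ge : 1 - gtail u <= gauss_mean.
Proof.
rewrite /gauss_mean (Rintegral_split u igg) -(gcdfD u) addrK.
rewrite -[leLHS]addr0; apply: lerD.
  rewrite /gcdf (@eq_Rintegral _ _ _ mu _ (fun x => g x * gpdf x))// => x.
  by rewrite inE/= in_itv/= => /g_low ->; rewrite mul1r.
apply: Rintegral_ge0 => x _; have /andP[? ?] := g01 x.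
by rewrite mulr_ge0// ltW// gpdf_gt0.
Qed.

Lemma gauss_mean_le : gauss_mean <= 1 - gtail v.
Proof.
rewrite /gauss_mean (Rintegral_split v igg) -(gcdfD v) addrK.
rewrite [X in _ + X](_ : _ = 0) ?addr0; last first.
  rewrite /Rintegral integral0_eq// => x; rewrite /= in_itv/= andbT => /g_up ->.
  by rewrite mul0r.
apply: le_Rintegral => //.
- by apply: integrableS igg.
- by apply: integrableS (integrable_gpdf R).
move=> x _; rewrite ler_piMl ?(ltW (gpdf_gt0 x))//.
by have /andP[] := g01 x.
Qed.

Lemma gauss_mean_itv : 0 <= gauss_mean <= 1.
Proof.
rewrite (le_trans gauss_mean_le) ?andbT ?gerBl ?gtail_ge0//.
apply: Rintegral_ge0 => x _; have /andP[? ?] := g01 x.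
by rewrite mulr_ge0// ltW// gpdf_gt0.
Qed.

Let gam := gauss_mean.
Let f x := (g x - gam) * gpdf x.
Let Gam x := \int[mu]_(t in `]-oo, x]) f t.

Let fE (x : R) : f x = g x * gpdf x - gam * gpdf x.
Proof. by rewrite /f mulrBl. Qed.

Let igp (c : R) : mu.-integrable setT (EFin \o (fun x => c * gpdf x)).
Proof. exact: (integrableZl measurableT c (integrable_gpdf R)). Qed.

Let i_f : mu.-integrable setT (EFin \o f).
Proof.
have := integrableB measurableT igg (igp gam).
apply: eq_integrable => // x _ /=.
by rewrite fE EFinB.
Qed.

Let gam_le (x : R) : `|g x - gam| <= 1.
Proof.
have /andP[? ?] := g01 x; have /andP[? ?] := gauss_mean_itv.
rewrite ler_norml; apply/andP; split; rewrite /gam; lra.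
Qed.

Let cf : continuous f.
Proof.
move=> x; apply: (@continuousM _ _ (fun x => g x - gam) (@gpdf R)); last exact: gpdf_continuous.
by apply: (@continuousB _ _ _ g (cst gam)); [exact: cg|exact: cst_continuous].
Qed.

Let int_f0 : \int[mu]_x f x = 0.
Proof.
rewrite (@eq_Rintegral _ _ _ mu _ (fun x => g x * gpdf x - gam * gpdf x)); last first.
  by move=> x _; rewrite fE.
rewrite RintegralB// RintegralZl//; last exact: integrable_gpdf.
by rewrite Rintegral_gpdf mulr1 subrr.
Qed.

Let dGam (x : R) : is_derive x 1 Gam (f x).
Proof.
have xx : x < x + 1 by rewrite ltrDl.
have [] := @continuous_FTC1 R f -oo%O x (x + 1) xx.
- by apply: integrableS i_f.
- by rewrite ltNyr.
- exact: cf.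
by move=> dG GE; apply: DeriveDef; [exact: dG|rewrite -derive1E; exact: GE].
Qed.

(** The total integral of [f] is zero, so [Gam] is also minus the integral over the right tail,
    where [g] vanishes. In this form it decays with the density by which it is divided below. *)
Let Gam_up (x : R) : v <= x -> Gam x = gam * gtail x.
Proof.
move=> vx; have := int_f0; rewrite (Rintegral_split x i_f) => /eqP.
rewrite addr_eq0 /Gam => /eqP ->.
rewrite (@eq_Rintegral _ _ _ mu _ (fun t => (- gam) * gpdf t)); last first.
  move=> t; rewrite inE/= in_itv/= andbT => xt.
  by rewrite /f g_up ?sub0r// (le_trans vx).
rewrite RintegralZl//; first by rewrite mulNr opprK.
by apply: integrableS (integrable_gpdf R).
Qed.

Let Gam_low (x : R) : x <= u -> Gam x = (1 - gam) * gtail (- x).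
Proof.
move=> xu; rewrite -gcdfN opprK.
rewrite /Gam (@eq_Rintegral _ _ _ mu _ (fun t => (1 - gam) * gpdf t)); last first.
  move=> t; rewrite inE/= in_itv/= => tx.
  by rewrite /f g_low// (le_trans tx).
rewrite RintegralZl//.
by apply: integrableS (integrable_gpdf R).
Qed.

Let Gam_le1 (x : R) : `|Gam x| <= 1.
Proof.
have iS : mu.-integrable `]-oo, x] (EFin \o f) by apply: integrableS i_f.
have iP : mu.-integrable `]-oo, x] (EFin \o (@gpdf R)).
  by apply: integrableS (integrable_gpdf R).
apply: (le_trans (le_normr_Rintegral _ iS)) => //.
apply: (@le_trans _ _ (gcdf x)).
  apply: le_Rintegral => //.
    exact: (integrable_norm iS).
  move=> t _; rewrite /f normrM (ger0_norm (ltW (gpdf_gt0 t))).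
  by rewrite ler_piMl// ltW// gpdf_gt0.
by rewrite -(gcdfD x) lerDl gtail_ge0.
Qed.

(** The classical solution of G' - x G = g - gam, followed by its first two derivatives, simplified
    by means of the equation itself. *)
Let G0 (x : R) : R := Gam x * (gpdf x)^-1.
Let G1 (x : R) : R := x * G0 x + (g x - gam).
Let G2 (x : R) : R := G0 x + x * G1 x + g' x.

Let dG0 (x : R) : is_derive x 1 G0 (G1 x).
Proof.
have px : gpdf x != 0 by rewrite gt_eqF// gpdf_gt0.
have DV := @is_deriveV R (@gpdf R) x _ 1 px (is_derive_gpdf x).
have DG := @is_deriveM R R Gam (fun y => (gpdf y)^-1) x 1 _ _ (dGam x) DV.
apply: (is_derive_eq DG); rewrite /GRing.scale/= /G1 /G0 /f.
by field.
Qed.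

Let dG1 (x : R) : is_derive x 1 G1 (G2 x).
Proof.
have DM := @is_deriveM R R (fun y : R => y) G0 x 1 _ _ (is_derive_id _ _) (dG0 x).
have DB := @is_deriveB R R R g (cst gam) x 1 _ _ (dg x) (is_derive_cst _ _ _).
have DD := @is_deriveD R R R _ _ x 1 _ _ DM DB.
apply: (is_derive_eq DD); rewrite /GRing.scale/= /G2; ring.
Qed.

(** On [-v, v] division by the density costs at most 1 / gpdf(v). For v within a constant over [B n]
    of [B n] this is at most a constant times [kn n]. *)
Definition stein_bound : R := (1 + v ^+ 2) * (gpdf v)^-1 + v + ell + 2.

(** The last pair of bounds handles [G2] in the tails, where (1 + y^2) r - y appears, r being the
    Mills ratio: it lies in [0, 1] although both terms grow. *)
Let mills (y : R) : 1 <= y -> 0 <= gtail y / gpdf y /\ y * (gtail y / gpdf y) <= 1 /\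
  y <= (1 + y ^+ 2) * (gtail y / gpdf y) <= y + 1.
Proof.
move=> y1; have y0 : 0 < y by exact: lt_le_trans y1.
have py := gpdf_gt0 y.
have r0 : 0 <= gtail y / gpdf y by rewrite divr_ge0 ?gtail_ge0// ltW.
have r1 : y * (gtail y / gpdf y) <= 1.
  by rewrite mulrA ler_pdivrMr// mul1r gtail_le.
split=> //; split=> //; apply/andP; split.
  by rewrite mulrA ler_pdivlMr// gtail_ge.
set r := gtail y / gpdf y in r0 r1 *.
have : r <= y * r by rewrite ler_peMl.
have : y * (y * r) <= y * 1 by rewrite ler_wpM2l// ltW.
rewrite mulrDl mul1r expr2 mulrA; lra.
Qed.

Let Hv : 1 <= (gpdf v)^-1.
Proof. by rewrite invf_ge1 ?gpdf_gt0// gpdf_le1. Qed.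

Let bounds (x : R) : [/\ `|G0 x| <= stein_bound, `|G1 x| <= stein_bound & `|G2 x| <= stein_bound].
Proof.
have := gam_le x; have /andP[] := gauss_mean_itv; have := g'_le x.
rewrite -/gam /stein_bound => hg' gm0 gm1 hgg; have v1p := v1; have ell0p := ell0; have u0p := u0.
have H1 := Hv; set H := (gpdf v)^-1 in H1 *.
have vH : (1 + v ^+ 2) * H >= 1 + v ^+ 2.
  by rewrite ler_peMr// addr_ge0 ?sqr_ge0.
have v2 : 1 <= v ^+ 2 by rewrite expr_ge1// (le_trans ler01).
move: hg' hgg; rewrite !ler_norml => /andP[? ?] /andP[? ?].
(* Beyond [v] and below -1 the cutoff is constant, since [u] is nonnegative, and Mills bounds apply.
   In between |x| <= v, and |Gam| <= 1 is enough. *)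
have [vx|xv] := leP v x.
  have [r0 [r1 /andP[r2 r3]]] := mills (le_trans v1 vx).
  have E0 : G0 x = gam * (gtail x / gpdf x) by rewrite /G0 Gam_up// mulrA.
  set r := gtail x / gpdf x in r0 r1 r2 r3 E0.
  have x1 : 1 <= x by exact: le_trans vx.
  have rr : r <= 1 by apply: le_trans r1; rewrite ler_peMl.
  have a0 : 0 <= gam * r by rewrite mulr_ge0.
  have a1 : gam * r <= 1 by rewrite mulr_ile1.
  have xr0 : 0 <= x * r by rewrite mulr_ge0//; lra.
  have b0 : 0 <= gam * (x * r) by rewrite mulr_ge0.
  have b1 : gam * (x * r) <= 1 by rewrite mulr_ile1.
  have E1 : G1 x = gam * (x * r) - gam by rewrite /G1 E0 g_up//; ring.
  have E2 : G2 x = gam * ((1 + x ^+ 2) * r - x) + g' x by rewrite /G2 E1 E0; ring.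
  set q := (1 + x ^+ 2) * r in r2 r3 E2.
  have c0 : 0 <= gam * (q - x) by rewrite mulr_ge0// subr_ge0.
  have c1 : gam * (q - x) <= 1 by rewrite mulr_ile1 ?subr_ge0 ?lerBlDl.
  clearbody q r H; rewrite E0 E1 E2; split; apply/andP; split; lra.
have [xl|xl] := leP x (-1).
  have y1 : 1 <= - x by lra.
  have [r0 [r1 /andP[r2 r3]]] := mills y1.
  have E0 : G0 x = (1 - gam) * (gtail (- x) / gpdf (- x)).
    by rewrite /G0 Gam_low ?gpdfN ?mulrA//; lra.
  have gg : g x = 1 by apply: g_low; lra.
  set r := gtail (- x) / gpdf (- x) in r0 r1 r2 r3 E0.
  have hx : (- x) * r <= 1 by [].
  have rr : r <= 1 by apply: le_trans r1; rewrite ler_peMl.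
  have k0 : 0 <= 1 - gam by lra.
  have k1 : 1 - gam <= 1 by lra.
  have a0 : 0 <= (1 - gam) * r by rewrite mulr_ge0.
  have a1 : (1 - gam) * r <= 1 by rewrite mulr_ile1.
  have xr0 : 0 <= (- x) * r by rewrite mulr_ge0//; lra.
  have b0 : 0 <= (1 - gam) * ((- x) * r) by rewrite mulr_ge0.
  have b1 : (1 - gam) * ((- x) * r) <= 1 by rewrite mulr_ile1.
  have E1 : G1 x = - ((1 - gam) * ((- x) * r)) + (1 - gam) by rewrite /G1 E0 gg; ring.
  have E2 : G2 x = (1 - gam) * ((1 + (- x) ^+ 2) * r - (- x)) + g' x.
    by rewrite /G2 E1 E0; ring.
  set q := (1 + (- x) ^+ 2) * r in r2 r3 E2.
  have c0 : 0 <= (1 - gam) * (q - (- x)) by rewrite mulr_ge0// subr_ge0.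
  have c1 : (1 - gam) * (q - (- x)) <= 1 by rewrite mulr_ile1//; lra.
  clearbody q r H; rewrite E0 E1 E2; split; apply/andP; split; lra.
have nx : `|x| <= v by rewrite ler_norml; apply/andP; split; lra.
have hG : `|G0 x| <= H.
  rewrite /G0 normrM -[leRHS]mul1r; apply: ler_pM => //.
  rewrite gtr0_norm ?invr_gt0 ?gpdf_gt0// lef_pV2 ?posrE ?gpdf_gt0//.
  exact: gpdf_le.
have hxG : `|x * G0 x| <= v * H by rewrite normrM; apply: ler_pM.
have hxxG : `|x * (x * G0 x)| <= v * (v * H) by rewrite normrM; apply: ler_pM.
have hxg : `|x * (g x - gam)| <= v * 1.
  by rewrite normrM; apply: ler_pM => //; exact: gam_le.
have e1 : (1 + v ^+ 2) * H = H + v * (v * H) by ring.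
have e2 : v * H <= v * (v * H) by rewrite ler_peMl// mulr_ge0; lra.
have E2 : G2 x = G0 x + x * (x * G0 x) + x * (g x - gam) + g' x.
  by rewrite /G2 /G1; ring.
have E1 : G1 x = x * G0 x + (g x - gam) by [].
rewrite e1 in vH *.
move: hG hxG hxxG hxg; rewrite !ler_norml => /andP[? ?] /andP[? ?] /andP[? ?] /andP[? ?].
by rewrite E1 E2; split; apply/andP; split; lra.
Qed.

Lemma stein_solution : exists G G' : R -> R,
  C11 1 G G' /\ forall x, g x - gauss_mean = stein_bound * (G' x - x * G x).
Proof.
have K0 : 0 < stein_bound.
  have H1 := Hv; have v1p := v1; have ell0p := ell0; rewrite /stein_bound.
  have : 0 <= (1 + v ^+ 2) * (gpdf v)^-1.
    by rewrite mulr_ge0 ?addr_ge0 ?sqr_ge0// (le_trans ler01).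
  lra.
have sc x (z : R) : `|z| <= stein_bound -> `|stein_bound^-1 * z| <= 1.
  by move=> hz; rewrite normrM gtr0_norm ?invr_gt0// ler_pdivrMl// mulr1.
have dZ (a b : R -> R) : (forall x : R, is_derive x 1 a (b x)) ->
    forall x : R, is_derive x 1 (fun y => stein_bound^-1 * a y) (stein_bound^-1 * b x).
  by move=> ab x; exact: (@is_deriveZ R R R a stein_bound^-1 x 1 _ (ab x)).
exists (fun x => stein_bound^-1 * G0 x), (fun x => stein_bound^-1 * G1 x); split.
  apply: C11_of_derive => //.
  - exact: dZ.
  - by move=> x; apply: sc => //; have [] := bounds x.
  - by move=> x; apply: sc => //; have [] := bounds x.
  - rewrite expr1n; apply: lipschitz_of_derivative; first exact: (dZ _ _ dG1).
    by move=> x; apply: sc => //; have [] := bounds x.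
move=> x; rewrite mulrCA -mulrBr mulVKf ?gt_eqF//.
by rewrite /G1 addrAC subrr add0r.
Qed.

End SteinEquation.

(** * From smooth products to the maximum of the forms *)

Section Sandwich.
Context d (T : measurableType d) (R : realType) (P : probability T R).

Lemma C11S (L1 L2 : R) (f g : R -> R) : 0 <= L1 -> L1 <= L2 -> C11 L1 f g -> C11 L2 f g.
Proof.
move=> L0 L12 [h1 h2 h3 h4 h5 h6 h7].
have LL : L1 ^+ 2 <= L2 ^+ 2 by apply: lerXn2r; rewrite ?nnegrE// (le_trans L0).
split=> //.
- by move=> t; exact: le_trans (h4 t) L12.
- by move=> t u; apply: (le_trans (h5 t u)); exact: ler_wpM2r.
- by move=> t u; apply: (le_trans (h6 t u)); exact: ler_wpM2r.
- by move=> t u; apply: (le_trans (h7 t u)); apply: ler_wpM2r => //; exact: sqr_ge0.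
Qed.

(** The error of [mean_prod_qform] for [m] factors and a window of width [del] ending at [v]. The
    constant 1 + 4 / del serves both the cutoff, which needs 4 / del, and the normalised Stein
    solution, which needs 1. *)
Definition clt_error (mu4 v del th : R) (m : nat) : R :=
  m%:R * (stein_bound v (4 / del) * (6 * mu4 ^+ 2 * m%:R ^+ 2 * (1 + 4 / del) ^+ 2 * th)).

Lemma mean_indic (A : set T) : measurable A -> mean P (\1_A) = fine (P A).
Proof.
by move=> mA; rewrite /mean /Rintegral; congr fine; rewrite integral_indic// setIT.
Qed.

Lemma below_measurable (s : seq nat) (V : nat -> T -> R) (x : R) :
  (forall k, measurable_fun setT (V k)) ->
  measurable [set w | forall k, k \in s -> V k w <= x].
Proof.
move=> mV; have -> : [set w | forall k, k \in s -> V k w <= x] =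
    \big[setI/setT]_(k <- s) (V k @^-1` `]-oo, x]).
  rewrite -bigcap_seq; apply/seteqP; split => w /= h k ks.
    by rewrite /= in_itv /=; exact: h.
  by have := h k ks; rewrite /= in_itv.
apply: bigsetI_measurable => k _; rewrite -[X in measurable X]setTI.
exact: mV.
Qed.

Variables (e : nat -> {RV P >-> R}) (mu4 : R).
Hypothesis He : noise e mu4.
Variables (n : nat) (b : nat -> 'I_n -> 'I_n -> R) (s : seq nat) (th : R).
Hypotheses (Hb : nearly_orthogonal s b th) (us : uniq s) (th0 : 0 < th).

Lemma qform_below_measurable (x : R) :
  measurable [set w | forall k, k \in s -> qform e b k w <= x].
Proof. by apply: below_measurable => k; have [] := all_moments_qform He b k. Qed.

(** A product of cutoffs falling from 1 at [u] to 0 at [v] lies between the indicators of the two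
    events, and the Gaussian mean of one cutoff lies between the normal distribution function at [u]
    and at [v]. *)
Lemma qform_max_bounds (u v : R) : 0 <= u -> 1 <= v -> u < v ->
  fine (P [set w | forall k, k \in s -> qform e b k w <= u])
    <= (1 - gtail v) ^+ size s + clt_error mu4 v (v - u) th (size s) /\
  (1 - gtail u) ^+ size s - clt_error mu4 v (v - u) th (size s)
    <= fine (P [set w | forall k, k \in s -> qform e b k w <= v]).
Proof.
move=> u0 v1 uv; pose del := v - u; have d0 : 0 < del by rewrite subr_gt0.
pose g := cutoff u del; pose g' := dcutoff u del.
have Cg : C11 (4 / del) g g' := cutoff_C11 u d0.
have ell0 : 0 <= 4 / del by rewrite divr_ge0// ltW.
have g01 x : 0 <= g x <= 1 by exact: step_itv.
have g_low x : x <= u -> g x = 1.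
  move=> xu; apply: step_le0; rewrite mulr_ge0_le0 ?subr_le0// invr_ge0 ltW//.
have g_up x : v <= x -> g x = 0.
  move=> vx; apply: step_ge1; rewrite mulrC ler_pdivlMr// mul1r /del; lra.
have dg (x : R) : is_derive x 1 g (g' x) by exact: is_derive_cutoff.
have g'_le x : `|g' x| <= 4 / del by exact: (C11_dle Cg).
have [G [G' [CG SE]]] := stein_solution u0 v1 ell0 g01 g_low g_up dg g'_le.
have /andP[gm0 gm1] := gauss_mean_itv g01 g_up dg.
have gmu := gauss_mean_ge g01 g_low dg.
have gmv := gauss_mean_le g01 g_up dg.
set gam := gauss_mean g in SE gm0 gm1 gmu gmv.
have K0 : 0 <= stein_bound v (4 / del).
  have h : 0 <= (1 + v ^+ 2) / gpdf v.
    by rewrite divr_ge0 ?addr_ge0 ?sqr_ge0// ltW// gpdf_gt0.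
  rewrite /stein_bound; lra.
have gamN : `|gam| <= 1 by rewrite ger0_norm.
have Lg : C11 (1 + 4 / del) g g' by apply: C11S Cg => //; rewrite lerDr.
have LG : C11 (1 + 4 / del) G G' by apply: C11S CG => //; rewrite lerDl.
have L1 : 1 <= 1 + 4 / del by rewrite lerDl.
have := mean_prod_qform He Hb us (leqnn _) L1 th0 K0 gamN Lg LG SE.
rewrite -/(clt_error mu4 v del th (size s)) -/del.
set E := clt_error _ _ _ _ _.
have nprod : all_moments P (fun w => \prod_(k <- s) g (qform e b k w)).
  apply: all_moments_prod => k.
  exact: (all_moments_C11 P (fun _ => Lg) 0 (all_moments_measurable (all_moments_qform He b k))).
have nind x : all_moments P (\1_[set w | forall k, k \in s -> qform e b k w <= x] : T -> R).
  apply: (@all_moments_bounded _ _ _ _ _ 1).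
    by apply: measurable_indic; exact: qform_below_measurable.
  by move=> w; rewrite indicE; case: (_ \in _); rewrite ?normr1 ?normr0.
have p01 w : 0 <= \prod_(k <- s) g (qform e b k w) <= 1.
  by apply/andP; split; [apply: prodr_ge0 => k _|apply: prodr_ile1 => k];
    have /andP[? ?] := g01 (qform e b k w) => //; apply/andP.
have lo : fine (P [set w | forall k, k \in s -> qform e b k w <= u]) <=
    mean P (fun w => \prod_(k <- s) g (qform e b k w)).
  rewrite -mean_indic; last exact: qform_below_measurable.
  apply: le_mean => // w; rewrite indicE.
  case: (boolP (w \in _)) => [|_]; last by have /andP[] := p01 w.
  rewrite inE/= => h; rewrite big1_seq// => k /andP[_ ks].
  by apply: g_low; exact: h.
have up : mean P (fun w => \prod_(k <- s) g (qform e b k w)) <=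
    fine (P [set w | forall k, k \in s -> qform e b k w <= v]).
  rewrite -mean_indic; last exact: qform_below_measurable.
  apply: le_mean => // w; rewrite indicE.
  case: (boolP (w \in _)) => [_|]; first by have /andP[] := p01 w.
  rewrite notin_setE/= => h.
  have [k [ks /negP]] : exists k, k \in s /\ ~ (qform e b k w <= v).
    apply: contrapT => hn; apply: h => k ks; apply: contrapT => hk; apply: hn.
    by exists k.
  rewrite -ltNge => /ltW/g_up gk.
  by rewrite (big_rem k)//= gk mul0r.
have tv0 := gtail_ge0 v; have tu0 := gtail_ge0 u.
have gv : gam ^+ size s <= (1 - gtail v) ^+ size s.
  by apply: lerXn2r => //; rewrite nnegrE// (le_trans gm0).
have gu : (1 - gtail u) ^+ size s <= gam ^+ size s.
  apply: lerXn2r => //; rewrite nnegrE//.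
  by rewrite -(gcdfD u) addrK Rintegral_ge0// => t _; rewrite ltW// gpdf_gt0.
rewrite ler_norml => /andP[h1 h2]; split; lra.
Qed.

End Sandwich.

(** * Spectral smoothing matrices and their off-diagonal parts *)

Section Smoother.
Context (R : realType) (n : nat).
Implicit Types (M : 'M[R]_n) (d : 'I_n -> R).

Definition frob2 M : R := \sum_(i < n) \sum_(j < n) M i j ^+ 2.

Lemma row_sqrE M i : \sum_(j < n) M i j ^+ 2 = (M *m M^T) i i.
Proof. by rewrite mxE; apply: eq_bigr => j _; rewrite mxE expr2. Qed.

Lemma frob2D M1 M2 : frob2 (M1 + M2) <= 2 * frob2 M1 + 2 * frob2 M2.
Proof.
rewrite /frob2 !mulr_sumr -big_split/=; apply: ler_sum => i _.
rewrite !mulr_sumr -big_split/=; apply: ler_sum => j _; rewrite mxE.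
have := sqr_ge0 (M1 i j - M2 i j); nra.
Qed.

Lemma frob2Z (c : R) M : frob2 (c *: M) = c ^+ 2 * frob2 M.
Proof.
rewrite /frob2 mulr_sumr; apply: eq_bigr => i _.
by rewrite mulr_sumr; apply: eq_bigr => j _; rewrite mxE exprMn.
Qed.

Lemma row_sqr_orthogonal M (V : 'M[R]_n) i : V *m V^T = 1%:M ->
  \sum_(j < n) (M *m V) i j ^+ 2 = \sum_(j < n) M i j ^+ 2.
Proof.
move=> VV; rewrite !row_sqrE trmx_mul.
by rewrite mulmxA -(mulmxA M V) VV mulmx1.
Qed.

Lemma row_sqr_diag M d i : (forall j, 0 <= d j <= 1) ->
  \sum_(j < n) (M *m diag_mx (\row_j d j)) i j ^+ 2 <= \sum_(j < n) M i j ^+ 2.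
Proof.
move=> d01; apply: ler_sum => j _; rewrite mul_mx_diag !mxE exprMn.
have /andP[? ?] := d01 j.
by rewrite ler_piMr ?sqr_ge0// exprn_ile1.
Qed.

Lemma frob2_diag M d : (forall j, 0 <= d j <= 1) ->
  frob2 (M *m diag_mx (\row_j d j)) <= frob2 M.
Proof. by move=> d01; apply: ler_sum => i _; exact: row_sqr_diag. Qed.

Variable U : 'M[R]_n.
Hypothesis UU : U^T *m U = 1%:M.

Let UU' : U *m U^T = 1%:M. Proof. exact: mulmx1C UU. Qed.

Definition smoother d : 'M[R]_n := U *m diag_mx (\row_j d j) *m U^T.

Lemma smootherE d i j : smoother d i j = \sum_(nu < n) d nu * (U i nu * U j nu).
Proof.
rewrite /smoother mxE; apply: eq_bigr => nu _.
rewrite mul_mx_diag !mxE; ring.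
Qed.

Lemma smoother_sym d i j : smoother d i j = smoother d j i.
Proof. by rewrite !smootherE; apply: eq_bigr => nu _; rewrite (mulrC (U i nu)). Qed.

Lemma row_sqr_smoother M d i : (forall j, 0 <= d j <= 1) ->
  \sum_(j < n) (M *m smoother d) i j ^+ 2 <= \sum_(j < n) M i j ^+ 2.
Proof.
move=> d01; rewrite /smoother !mulmxA row_sqr_orthogonal ?trmxK//.
by rewrite (le_trans (row_sqr_diag _ _ d01))// row_sqr_orthogonal.
Qed.

Lemma frob2_smoother M d : (forall j, 0 <= d j <= 1) ->
  frob2 (M *m smoother d) <= frob2 M.
Proof. by move=> d01; apply: ler_sum => i _; exact: row_sqr_smoother. Qed.

Lemma smoother_row_le1 d i : (forall j, 0 <= d j <= 1) ->
  \sum_(j < n) smoother d i j ^+ 2 <= 1.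
Proof.
move=> d01; rewrite -[smoother d]mul1mx.
rewrite (le_trans (row_sqr_smoother _ _ d01))// row_sqrE trmx1 mulmx1 mxE eqxx.
exact: lexx.
Qed.

(** A diagonal entry is an average of the [d nu] with weights [U i nu ^+ 2], which sum to 1. *)
Lemma smoother_diag_itv d i : (forall j, 0 <= d j <= 1) -> 0 <= smoother d i i <= 1.
Proof.
move=> d01; rewrite smootherE; apply/andP; split.
  by apply: sumr_ge0 => nu _; have /andP[? _] := d01 nu; rewrite mulr_ge0// -expr2 sqr_ge0.
have <- : \sum_(nu < n) U i nu ^+ 2 = 1 by rewrite row_sqrE UU' mxE eqxx.
apply: ler_sum => nu _; have /andP[? ?] := d01 nu.
by rewrite -expr2 ler_piMl ?sqr_ge0.
Qed.

Lemma smoother_dot d1 d2 :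
  \sum_(i < n) \sum_(j < n) smoother d1 i j * smoother d2 i j = \sum_(nu < n) d1 nu * d2 nu.
Proof.
transitivity (\tr (smoother d1 *m smoother d2)).
  rewrite /mxtrace; apply: eq_bigr => i _; rewrite mxE; apply: eq_bigr => j _.
  by rewrite (smoother_sym d2 i j).
have -> : smoother d1 *m smoother d2 = U *m (diag_mx (\row_j d1 j) *m diag_mx (\row_j d2 j) *m U^T).
  by rewrite /smoother -!mulmxA (mulmxA U^T U) UU mul1mx.
rewrite mxtrace_mulC -(mulmxA _ U^T U) UU mulmx1 mulmx_diag mxtrace_diag.
by apply: eq_bigr => nu _; rewrite !mxE.
Qed.

Lemma smoother_trace d : \sum_(i < n) smoother d i i = \sum_(nu < n) d nu.
Proof.
transitivity (\tr (smoother d)); first by [].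
by rewrite /smoother mxtrace_mulC mulmxA UU mul1mx mxtrace_diag; apply: eq_bigr => nu _; rewrite !mxE.
Qed.

Definition offdiag d : 'M[R]_n := \matrix_(i, j) (if i == j then 0 else smoother d i j).

Lemma offdiagE d : offdiag d = smoother d - diag_mx (\row_i smoother d i i).
Proof.
apply/matrixP => i j; rewrite !mxE; case: eqVneq => [->|ij].
  by rewrite mulr1n subrr.
by rewrite mulr0n subr0.
Qed.

Lemma frob2_offdiag d :
  frob2 (offdiag d) = \sum_(nu < n) d nu ^+ 2 - \sum_(i < n) smoother d i i ^+ 2.
Proof.
under eq_bigr do rewrite expr2.
rewrite -smoother_dot -sumrB; apply: eq_bigr => i _.
rewrite (bigD1 i)//= [in RHS](bigD1 i)//= mxE eqxx expr0n add0r.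
rewrite -expr2 addrAC subrr add0r; apply: eq_bigr => j ij.
by rewrite mxE eq_sym (negbTE ij) expr2.
Qed.

(** Right multiplication by the smoother and by its diagonal both contract the Frobenius norm; the 4
    comes from squaring their difference. *)
Lemma frob2_offdiag_mul d1 d2 : (forall j, 0 <= d2 j <= 1) ->
  frob2 (offdiag d1 *m offdiag d2) <= 4 * frob2 (offdiag d1).
Proof.
move=> d01; rewrite [offdiag d2]offdiagE mulmxBr.
have h1 := frob2_smoother (offdiag d1) d01.
have h2 := @frob2_diag (offdiag d1) (fun i => smoother d2 i i) (fun i => smoother_diag_itv i d01).
apply: (le_trans (frob2D _ _)); rewrite -[X in _ + 2 * frob2 X <= _]scaleN1r frob2Z sqrrN expr1n mul1r.
lra.
Qed.

(** The full inner product and its diagonal part both lie between 0 and the trace of the second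
    smoother. The asymmetry is deliberate: the second smoother will be the one of larger bandwidth,
    with the sharper trace bound. *)
Lemma offdiag_dot_le d1 d2 : (forall j, 0 <= d1 j <= 1) -> (forall j, 0 <= d2 j <= 1) ->
  `|\sum_(i < n) \sum_(j < n) offdiag d1 i j * offdiag d2 i j| <= \sum_(nu < n) d2 nu.
Proof.
move=> h1 h2.
have -> : \sum_(i < n) \sum_(j < n) offdiag d1 i j * offdiag d2 i j =
  \sum_(nu < n) d1 nu * d2 nu - \sum_(i < n) smoother d1 i i * smoother d2 i i.
  rewrite -smoother_dot -sumrB; apply: eq_bigr => i _.
  rewrite (bigD1 i)//= [in RHS](bigD1 i)//= !mxE eqxx mul0r add0r.
  rewrite addrAC subrr add0r; apply: eq_bigr => j ij.
  by rewrite !mxE eq_sym (negbTE ij).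
have a0 : 0 <= \sum_(nu < n) d1 nu * d2 nu.
  by apply: sumr_ge0 => nu _; have /andP[? _] := h1 nu; have /andP[? _] := h2 nu; rewrite mulr_ge0.
have a1 : \sum_(nu < n) d1 nu * d2 nu <= \sum_(nu < n) d2 nu.
  by apply: ler_sum => nu _; have /andP[? ?] := h1 nu; have /andP[? _] := h2 nu; rewrite ler_piMl.
have b0 : 0 <= \sum_(i < n) smoother d1 i i * smoother d2 i i.
  apply: sumr_ge0 => i _; have /andP[? _] := smoother_diag_itv i h1.
  by have /andP[? _] := smoother_diag_itv i h2; rewrite mulr_ge0.
have b1 : \sum_(i < n) smoother d1 i i * smoother d2 i i <= \sum_(nu < n) d2 nu.
  rewrite -smoother_trace; apply: ler_sum => i _; have /andP[? ?] := smoother_diag_itv i h1.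
  by have /andP[? _] := smoother_diag_itv i h2; rewrite ler_piMl.
rewrite ler_norml; apply/andP; split; lra.
Qed.

End Smoother.

(** * Near orthogonality of the normalised weights *)

Section NearlyOrthogonal.
Context (R : realType) (n : nat).
Variables (U : 'M[R]_n) (d : nat -> 'I_n -> R) (s : seq nat).
Hypotheses (UU : U^T *m U = 1%:M) (d01 : forall k j, 0 <= d k j <= 1).

(** The square of the denominator of [tau]. The 2 in [weights] offsets the half in [qform], so that
    [qform] becomes the off-diagonal part of [tau]. *)
Definition scale2 k : R := 2 * frob2 (offdiag U (d k)).
Definition weights k (i j : 'I_n) : R := 2 / Num.sqrt (scale2 k) * offdiag U (d k) i j.

Lemma weights_nearly_orthogonal (th : R) : 0 <= th ->
  (forall k, k \in s -> 0 < scale2 k) ->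
  (forall k, k \in s -> 32 / scale2 k <= th ^+ 2) ->
  (forall k l, k \in s -> l \in s -> (k < l)%N ->
    4 / Num.sqrt (scale2 k) / Num.sqrt (scale2 l) * \sum_(nu < n) d l nu <= th) ->
  nearly_orthogonal s weights th.
Proof.
move=> t0 S0 hr ht.
have off_sym k i j : offdiag U (d k) i j = offdiag U (d k) j i.
  by rewrite mxE [RHS]mxE eq_sym smoother_sym.
have sq k : k \in s -> Num.sqrt (scale2 k) ^+ 2 = scale2 k.
  by move=> ks; rewrite sqr_sqrtr// ltW// S0.
have sq0 k : k \in s -> 0 < Num.sqrt (scale2 k) by move=> ks; rewrite sqrtr_gt0 S0.
have fac k : k \in s -> (2 / Num.sqrt (scale2 k)) ^+ 2 = 4 / scale2 k.
  by move=> ks; rewrite exprMn exprVn sq//; congr (_ * _); rewrite -natrX.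
split.
- by move=> k i j; rewrite /weights off_sym.
- by move=> k i; rewrite /weights mxE eqxx mulr0.
- move=> k ks; rewrite /weights.
  under eq_bigr do under eq_bigr do rewrite exprMn.
  under eq_bigr do rewrite -mulr_sumr.
  rewrite -mulr_sumr fac// -/(frob2 _).
  have := S0 _ ks; rewrite /scale2 => h.
  have f0 : frob2 (offdiag U (d k)) != 0.
    by apply: contraTneq h => ->; rewrite mulr0 ltxx.
  by field.
- move=> k i ks; rewrite /weights; under eq_bigr do rewrite exprMn.
  rewrite -mulr_sumr fac//; apply: le_trans (hr k ks).
  have h1 : \sum_(j < n) offdiag U (d k) i j ^+ 2 <= 1.
    apply: le_trans (smoother_row_le1 UU i (d01 k)); apply: ler_sum => j _.
    by rewrite mxE; case: ifP => // _; rewrite expr0n sqr_ge0.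
  have h2 : 0 < (scale2 k)^-1 by rewrite invr_gt0 S0.
  apply: (@le_trans _ _ (4 / scale2 k * 1)).
    by apply: ler_wpM2l => //; rewrite mulr_ge0// ltW.
  lra.
- move=> k l ks ls.
  apply: (@le_trans _ _ (4 / scale2 k * (4 / scale2 l) * frob2 (offdiag U (d k) *m offdiag U (d l)))).
    rewrite /frob2 mulr_sumr; apply: ler_sum => j _; rewrite mulr_sumr; apply: ler_sum => m _.
    rewrite -(fac k)// -(fac l)// -!exprMn mxE mulr_sumr le_eqVlt; apply/orP; left; apply/eqP.
    congr (_ ^+ 2); apply: eq_bigr => i _; rewrite /weights (off_sym k i j); ring.
  apply: le_trans (hr l ls).
  (* Since [frob2] is half of [scale2 k], the three factors 4 leave 32 / scale2 l, the same quantity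
     as in the hypothesis on rows. *)
  have h := frob2_offdiag_mul UU (d k) (d01 l).
  have Sk := S0 k ks; have Sl := S0 l ls.
  have c0 : 0 <= 4 / scale2 k * (4 / scale2 l) by rewrite !mulr_ge0 ?invr_ge0 ?ltW.
  apply: (le_trans (ler_wpM2l c0 h)).
  rewrite (_ : frob2 (offdiag U (d k)) = scale2 k / 2); last by rewrite /scale2; field.
  rewrite le_eqVlt; apply/orP; left; apply/eqP; field.
  by rewrite !gt_eqF.
- move=> k l ks ls kl.
  wlog klt : k l ks ls kl / (k < l)%N.
    move=> H; have [klt|lkt|kE] := ltngtP k l; [exact: H| |by rewrite kE eqxx in kl].
    rewrite (_ : \sum_(i < n) _ = \sum_(i < n) \sum_(j < n) weights l i j * weights k i j).
      by apply: H => //; rewrite eq_sym.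
    by apply: eq_bigr => i _; apply: eq_bigr => j _; rewrite mulrC.
  apply: le_trans (ht k l ks ls klt).
  have -> : \sum_(i < n) \sum_(j < n) weights k i j * weights l i j =
    4 / Num.sqrt (scale2 k) / Num.sqrt (scale2 l) *
    \sum_(i < n) \sum_(j < n) offdiag U (d k) i j * offdiag U (d l) i j.
    rewrite mulr_sumr; apply: eq_bigr => i _; rewrite mulr_sumr; apply: eq_bigr => j _.
    rewrite /weights; field.
    by rewrite !gt_eqF// sq0.
  have c0 : 0 <= 4 / Num.sqrt (scale2 k) / Num.sqrt (scale2 l).
    by rewrite !mulr_ge0 ?invr_ge0 ?ltW ?sq0.
  rewrite normrM (ger0_norm c0); apply: ler_wpM2l => //.
  exact: offdiag_dot_le.
Qed.

End NearlyOrthogonal.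

(** * The test statistic under the null hypothesis *)

Section Statistics.
Context (R : realType).

Lemma integrable01_sum (I : Type) (s : seq I) (F : I -> R -> R) :
  (forall i, integrable01 (F i)) -> integrable01 (fun t => \sum_(i <- s) F i t).
Proof.
move=> iF; elim: s => [|i s IH].
  under eq_fun do rewrite big_nil; rewrite /integrable01.
  have -> : EFin \o (fun=> 0 : R) = cst 0%E by [].
  exact: integrable0.
under eq_fun do rewrite big_cons.
have := @integrableD _ _ _ lebesgue_measure _ (measurable_itv _) _ _ (iF i) IH.
by apply: eq_integrable => // t _ /=; rewrite EFinD.
Qed.

Lemma integral01_sum (I : Type) (s : seq I) (F : I -> R -> R) :
  (forall i, integrable01 (F i)) ->
  integral01 (fun t => \sum_(i <- s) F i t) = \sum_(i <- s) integral01 (F i).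
Proof.
move=> iF; elim: s => [|i s IH].
  under eq_fun do rewrite big_nil.
  by rewrite big_nil /integral01 Rintegral_cst// mul0r.
rewrite big_cons -IH; under eq_fun do rewrite big_cons.
by rewrite /integral01 RintegralD//; [exact: iF|exact: integrable01_sum].
Qed.

Lemma integrable01Z (c : R) (f : R -> R) : integrable01 f -> integrable01 (fun t => c * f t).
Proof.
move=> h; have := @integrableZl _ _ _ (@lebesgue_measure R) _ (measurable_itv _) c _ h.
by apply: eq_integrable => // t _ /=; rewrite EFinM.
Qed.

Lemma integral01Z (c : R) (f : R -> R) : integrable01 f ->
  integral01 (fun t => c * f t) = c * integral01 f.
Proof. by move=> h; rewrite /integral01 RintegralZl. Qed.

(** [Chat] is a finite sum of products, so the double integral splits into products of entries of
    [Omega]; integrability of [X i t * phi nu t] justifies exchanging sums and integrals. *)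
Lemma Omega_orthogonal n (X phi : 'I_n -> R -> R) : empirical_basis X phi ->
  (0 < n)%N -> (Omega X phi)^T *m Omega X phi = n%:R%:M.
Proof.
move=> [iX V] n0; apply/matrixP => nu mu; rewrite !mxE.
have := V nu mu; rewrite /Vhat /Chat => VE.
have E : integral01 (fun t => integral01 (fun s =>
    n%:R^-1 * (\sum_(i < n) X i s * X i t) * phi nu s * phi mu t)) =
    n%:R^-1 * \sum_(i < n) Omega X phi i nu * Omega X phi i mu.
  have E1 t : integral01 (fun s =>
    n%:R^-1 * (\sum_(i < n) X i s * X i t) * phi nu s * phi mu t) =
    n%:R^-1 * \sum_(i < n) Omega X phi i nu * (X i t * phi mu t).
    rewrite (_ : (fun s => _) = (fun s => \sum_(i < n)
        (n%:R^-1 * (X i t * phi mu t)) * (X i s * phi nu s))).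
      rewrite integral01_sum => [|i]; last exact: integrable01Z.
      rewrite mulr_sumr; apply: eq_bigr => i _; rewrite integral01Z// mxE; ring.
    apply/funext => s; rewrite -!mulrA mulr_suml mulr_sumr.
    by apply: eq_bigr => i _; ring.
  under eq_fun do rewrite E1.
  rewrite integral01Z; last by apply: integrable01_sum => i; exact: integrable01Z.
  congr (_ * _); rewrite integral01_sum => [|i]; last exact: integrable01Z.
  by apply: eq_bigr => i _; rewrite integral01Z//; congr (_ * _); rewrite mxE.
have nn : n%:R != 0 :> R by rewrite pnatr_eq0 -lt0n.
under eq_bigr do rewrite mxE.
move: VE; rewrite E => /(congr1 (fun z => n%:R * z)); rewrite mulrA divff// mul1r => ->.
by rewrite mulr_natr.
Qed.

Lemma lambda_ge0 (c0 : R) n k : 0 <= lambda c0 n k.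
Proof.
by rewrite /lambda !mulr_ge0 ?powR_ge0// exprM exprn_ge0 ?sqr_ge0.
Qed.

Lemma dcoef_itv (c0 : R) n k nu : 0 <= dcoef c0 n k nu <= 1.
Proof.
have h : 0 <= lambda c0 n k * nu%:R ^+ (2 * k) by rewrite mulr_ge0 ?lambda_ge0 ?exprn_ge0.
rewrite /dcoef div1r invr_ge0 addr_ge0//= invf_le1 ?lerDl//.
exact: ltr_wpDr.
Qed.

Definition eig (c0 : R) n k (nu : 'I_n) : R := dcoef c0 n k nu.+1.

Section Fixed.
Variables (c0 : R) (n : nat) (W : 'M[R]_n).
Hypotheses (n0 : (0 < n)%N) (WW : W^T *m W = n%:R%:M).

Definition orth : 'M[R]_n := (Num.sqrt n%:R)^-1 *: W.

Let n0R : 0 < n%:R :> R. Proof. by rewrite ltr0n. Qed.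

Let sn : Num.sqrt n%:R ^+ 2 = n%:R :> R.
Proof. by rewrite sqr_sqrtr// ltW. Qed.

Lemma orth_orthogonal : orth^T *m orth = 1%:M.
Proof.
rewrite /orth [(_ *: W)^T]linearZ/= -scalemxAl -scalemxAr WW scalerA -invfM -expr2 sn.
by rewrite scale_scalar_mx mulVf// gt_eqF.
Qed.

Lemma mul_penalty k :
  diag_mx (\row_nu eig c0 k nu) *m (1%:M + lambda c0 n k *: Lambda n k) = 1%:M.
Proof.
have -> : 1%:M + lambda c0 n k *: Lambda n k =
    diag_mx (\row_(nu < n) (1 + lambda c0 n k * nu.+1%:R ^+ (2 * k))).
  apply/matrixP => i j; rewrite !mxE; case: eqVneq => [->|_].
    by rewrite !mulr1n.
  by rewrite !mulr0n mulr0 addr0.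
rewrite mulmx_diag -diag_const_mx; congr diag_mx; apply/rowP => nu; rewrite !mxE.
by rewrite /eig /dcoef div1r mulVf// gt_eqF// ltr_wpDr// mulr_ge0 ?lambda_ge0.
Qed.

Lemma penalty_unit k : 1%:M + lambda c0 n k *: Lambda n k \in unitmx.
Proof. by have [] := mulmx1_unit (mul_penalty k). Qed.

Lemma inv_penalty k : invmx (1%:M + lambda c0 n k *: Lambda n k) = diag_mx (\row_nu eig c0 k nu).
Proof.
rewrite -[LHS]mul1mx -[X in X *m _](mul_penalty k) -mulmxA mulmxV ?mulmx1//.
exact: penalty_unit.
Qed.

Lemma AmatE k : Amat c0 W k = smoother orth (eig c0 k).
Proof.
rewrite /Amat inv_penalty /smoother /orth [(_ *: W)^T]linearZ/= -!scalemxAl -scalemxAr scalerA.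
by rewrite -invfM -expr2 sn.
Qed.

Lemma PLRTE (Y : 'cV[R]_n) k :
  - (2 * n%:R) * PLRT c0 W Y k = (Y^T *m smoother orth (eig c0 k) *m Y) ord0 ord0.
Proof.
rewrite /PLRT -AmatE /Amat mulrA mulrNN divff ?mul1r; last by rewrite mulf_neq0// gt_eqF.
have -> : n%:R%:M + (n%:R * lambda c0 n k) *: Lambda n k =
    n%:R *: (1%:M + lambda c0 n k *: Lambda n k) :> 'M[R]_n.
  by rewrite scalerDr scale_scalar_mx mulr1 scalerA.
have -> : invmx (n%:R *: (1%:M + lambda c0 n k *: Lambda n k)) =
    n%:R^-1 *: invmx (1%:M + lambda c0 n k *: Lambda n k).
  by rewrite invmxZ// unitmxZ ?penalty_unit// unitfE gt_eqF.
by rewrite -!(scalemxAl, scalemxAr) !mulmxA.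
Qed.

Lemma sqrt_arg k : 2 * \sum_(i < n) \sum_(j < n | i != j) Amat c0 W k i j ^+ 2
   = scale2 orth (@eig c0 n) k.
Proof.
rewrite /scale2 AmatE; congr (_ * _); apply: eq_bigr => i _.
rewrite big_mkcond; apply: eq_bigr => j _; rewrite [in RHS]mxE.
by case: eqVneq => //= _; rewrite expr0n.
Qed.

Definition diag_part k (y : 'I_n -> R) : R :=
  (Num.sqrt (scale2 orth (@eig c0 n) k))^-1 *
  \sum_(i < n) smoother orth (eig c0 k) i i * (y i ^+ 2 - 1).

(** The centring sum of the [dcoef] is the trace of the smoother, so it takes exactly the i-th
    diagonal entry away from the i-th squared observation. *)
Lemma tauE (y : 'I_n -> R) k : tau c0 W (\col_i y i) k =
  2^-1 * \sum_(i < n) y i * \sum_(j < n) weights orth (@eig c0 n) k i j * y j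
  + diag_part k y.
Proof.
rewrite /tau PLRTE sqrt_arg /diag_part.
set sg := Num.sqrt _; set A := smoother _ _.
have -> : (((\col_i y i)^T *m A) *m \col_i y i) ord0 ord0 =
    \sum_(i < n) \sum_(j < n) y i * (A i j * y j).
  rewrite mxE; under eq_bigr do rewrite mxE mulr_suml.
  rewrite exchange_big/=; apply: eq_bigr => i _; apply: eq_bigr => j _.
  by rewrite !mxE mulrA.
have -> : \sum_(1 <= nu < n.+1) dcoef c0 n k nu = \sum_(i < n) A i i.
  by rewrite /A (smoother_trace orth_orthogonal) big_add1 /= big_mkord.
rewrite -sumrB mulrC !mulr_sumr -big_split/=; apply: eq_bigr => i _.
have -> : \sum_(j < n) weights orth (@eig c0 n) k i j * y j =
    2 / sg * \sum_(j < n | j != i) A i j * y j.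
  rewrite (bigD1 i)//= {1}/weights mxE eqxx mulr0 mul0r add0r mulr_sumr.
  apply: eq_bigr => j ji; rewrite /weights mxE eq_sym (negbTE ji) -/A -/sg; ring.
rewrite (bigD1 i)//= -mulr_sumr; set S := \sum_(j < n | _) _.
by move: (sg^-1) => t; field.
Qed.

End Fixed.

Lemma integral01_beta0 (f beta : R -> R) : (forall t : R, t \in `[0, 1] -> beta t = 0) ->
  integral01 (fun t => f t * beta t) = 0.
Proof.
move=> b0; rewrite /integral01 /Rintegral integral0_eq// => t /= t01.
by rewrite b0 ?mulr0.
Qed.

Lemma response0 n (X : 'I_n -> R -> R) beta (e : 'I_n -> R) :
  (forall t : R, t \in `[0, 1] -> beta t = 0) -> response X beta e = \col_i e i.
Proof.
by move=> b0; apply/colP => i; rewrite !mxE integral01_beta0// add0r.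
Qed.

Lemma bigmax_seq_le (I : eqType) (s : seq I) (f : I -> R) (x0 x : R) :
  (\big[Num.max/x0]_(k <- s) f k <= x) = (x0 <= x) && all (fun k => f k <= x) s.
Proof.
elim: s => [|k s IH]; rewrite ?big_nil ?andbT// big_cons ge_max IH/=.
by rewrite andbCA.
Qed.

Lemma AT_le c0 n (W : 'M[R]_n) (Y : 'cV[R]_n) (m : nat) (B c : R) : (0 < m)%N -> 0 < B ->
  (AT c0 W Y m B <= c) <-> forall k, k \in index_iota 1 m.+1 -> tau c0 W Y k <= B + c / B.
Proof.
move=> m0 B0; rewrite /AT mulrC -ler_pdivlMr// lerBlDl /ATstar bigmax_seq_le.
split=> [/andP[_ /allP]//|h].
apply/andP; split; last exact/allP.
by apply: h; rewrite mem_index_iota; apply/andP; split.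
Qed.

End Statistics.

(** * Moments of sub-Gaussian errors *)

Section NoiseOfHypotheses.
Context d (T : measurableType d) (R : realType) (P : probability T R).

(** The p-th power of t <= exp t at t = |x| / (p + 1); the shift by one covers p = 0. *)
Lemma normX_le_expR (x : R) (p : nat) :
  `|x| ^+ p <= p.+1%:R ^+ p * (expR x + expR (- x)).
Proof.
have a0 : 0 < p.+1%:R :> R by rewrite ltr0n.
have h : `|x| / p.+1%:R <= expR (`|x| / p.+1%:R).
  by apply: le_trans (expR_ge1Dx _); rewrite lerDr.
have h1 : `|x| <= p.+1%:R * expR (`|x| / p.+1%:R).
  by rewrite -ler_pdivrMl// mulrC.
apply: (@le_trans _ _ ((p.+1%:R * expR (`|x| / p.+1%:R)) ^+ p)).
  by apply: lerXn2r; rewrite ?nnegrE// mulr_ge0 ?expR_ge0.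
rewrite exprMn ler_wpM2l ?exprn_ge0// -expRM_natl.
apply: (@le_trans _ _ (expR `|x|)).
  rewrite ler_expR mulrCA ler_piMr// ler_pdivrMr// mul1r ler_nat; exact: leqnSn.
case: (leP 0 x) => x0.
  by rewrite ger0_norm// lerDl expR_ge0.
by rewrite ltr0_norm// lerDr expR_ge0.
Qed.

Lemma all_moments_sub_gaussian (Z : {RV P >-> R}) : sub_gaussian Z -> all_moments P Z.
Proof.
move=> [C [C0 mgf]].
have mZ : measurable_fun setT Z by [].
have iE (t : R) : P.-integrable setT (EFin \o (fun w => expR (Z w * t))).
  apply/integrableP; split.
    apply/measurable_EFinP; apply: measurableT_comp => //.
    exact: measurable_funM.
  apply: (@le_lt_trans _ _ (expR (C * t ^+ 2))%:E); last exact: ltry.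
  apply: le_trans (mgf t); rewrite /mmt_gen_fun expectation.unlock.
  apply: ge0_le_integral => //=.
  - apply/measurable_EFinP; apply: measurableT_comp => //.
    by apply: measurableT_comp => //; exact: measurable_funM.
  - apply/measurable_EFinP; apply: measurableT_comp => //.
    exact: measurable_funM.
  - by move=> w _; rewrite lee_fin ger0_norm ?expR_ge0.
split=> // p.
have I2 := integrableD measurableT (iE 1) (iE (-1)).
have I3 := integrableZl measurableT (p.+1%:R ^+ p) I2.
apply: (le_integrable _ _ _ I3) => //.
  apply/measurable_EFinP; apply: measurable_funX; exact: measurableT_comp.
move=> w _ /=; rewrite mulr1 mulrN1 lee_fin normrX normr_id.
apply: (le_trans (normX_le_expR _ _)); exact: ler_norm.
Qed.

Variables (epsilon : {RV P >-> R}) (eps : nat -> {RV P >-> R}).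
Hypothesis iid : iid_copies epsilon eps.

Lemma integral_iid i (f : R -> R) : measurable_fun setT f ->
  P.-integrable setT (EFin \o (fun w => f (epsilon w))) ->
  P.-integrable setT (EFin \o (fun w => f (eps i w))) /\
  mean P (fun w => f (eps i w)) = mean P (fun w => f (epsilon w)).
Proof.
move=> mf If.
have mf' : measurable_fun setT (EFin \o f) by exact/measurable_EFinP.
have De (A : set R) : measurable A -> distribution P (eps i) A = distribution P epsilon A.
  exact: iid.2.
have Ii : P.-integrable setT (EFin \o (fun w => f (eps i w))).
  have mfe : measurable_fun setT (fun w => f (eps i w)) by exact: measurableT_comp.
  apply/integrableP; split; first exact/measurable_EFinP.
  have /integrableP[_] := If.
  have mn : measurable_fun setT (fun x => `|f x|%:E).
    by apply/measurable_EFinP; exact: measurableT_comp.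
  rewrite -(@ge0_integral_distribution _ _ _ _ _ P epsilon (fun x => `|f x|%:E))//.
  rewrite -(@ge0_integral_distribution _ _ _ _ _ P (eps i) (fun x => `|f x|%:E))//.
  rewrite (@eq_measure_integral _ _ _ _ (distribution P (eps i)))//.
  by move=> A mA _; apply/esym; exact: De.
split=> //; rewrite /mean /Rintegral; congr fine.
rewrite -(@integral_distribution _ _ _ _ _ P epsilon (EFin \o f))//.
rewrite -(@integral_distribution _ _ _ _ _ P (eps i) (EFin \o f))//.
by apply: eq_measure_integral => A mA _; exact: De.
Qed.

Lemma noise_of_iid : ('E_P[epsilon] = 0)%E -> ('V_P[epsilon] = 1)%E ->
  sub_gaussian epsilon -> noise eps (mean P (fun w => epsilon w ^+ 4)).
Proof.
move=> m0 v1 sg; have ne := all_moments_sub_gaussian sg.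
have nX p : P.-integrable setT (EFin \o (fun w => epsilon w ^+ p)).
  exact/all_moments_integrable/all_momentsX.
have mi i p : mean P (fun w => eps i w ^+ p) = mean P (fun w => epsilon w ^+ p).
  exact: (integral_iid i (@exprn_measurable R _ p) (nX p)).2.
split.
- exact: iid.1.
- move=> i; split=> // p.
  apply: (integral_iid i (f := fun x => `|x| ^+ p) _ _).1.
    by apply: measurable_funX; exact: normr_measurable.
  by have [_] := ne; exact.
- move=> i; have := mi i 1%N.
  under eq_fun do rewrite expr1.
  move=> ->; under eq_fun do rewrite expr1.
  by move: m0; rewrite expectation.unlock /mean /Rintegral => ->.
- move=> i; rewrite mi; move: v1.
  rewrite /variance covariance.unlock m0 expectation.unlock /mean /Rintegral.
  rewrite (_ : (fun w => _) = (fun w => (epsilon w ^+ 2)%:E)) => [->//|].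
  by apply/funext => w; rewrite expr2 !fctE /cst/= !subr0.
- by move=> i; rewrite mi.
Qed.

End NoiseOfHypotheses.

(** * Second moment of the diagonal part *)

Section DiagonalPart.
Context d (T : measurableType d) (R : realType) (P : probability T R).
Variables (e : nat -> {RV P >-> R}) (mu4 : R).
Hypothesis He : noise e mu4.
Variables (c0 : R) (n : nat) (W : 'M[R]_n).

Definition diag_rv k (w : T) : R := diag_part c0 W k (fun i : 'I_n => e i w).

(** A diagonal matrix that makes the diagonal part a centred quadratic form, so that [mean_quad_sqr]
    applies to it. *)
Let M k (i j : 'I_n) : R :=
  if i == j then (Num.sqrt (scale2 (orth W) (@eig R c0 n) k))^-1 * smoother (orth W) (eig c0 k) i i
  else 0.

Let diag_rvE k w : diag_rv k w = quad e (index_enum 'I_n) (M k) w.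
Proof.
rewrite /diag_rv /diag_part /quad mulr_sumr -sumrB; apply: eq_bigr => i _.
rewrite (bigD1 i)//= big1 ?addr0 /M ?eqxx; first by ring.
by move=> j ji; rewrite eq_sym (negbTE ji) mul0r.
Qed.

Lemma all_moments_diag_rv k : all_moments P (diag_rv k).
Proof.
have -> : diag_rv k = quad e (index_enum 'I_n) (M k) by apply/funext => w; rewrite diag_rvE.
exact: (all_moments_quad He).
Qed.

Lemma mean_diag_rv_sqr k : 0 < scale2 (orth W) (@eig R c0 n) k ->
  mean P (fun w => diag_rv k w ^+ 2) <= (2 + mu4) *
   ((\sum_(i < n) smoother (orth W) (eig c0 k) i i ^+ 2) / scale2 (orth W) (@eig R c0 n) k).
Proof.
move=> S0; under eq_fun do rewrite diag_rvE.
apply: (le_trans (mean_quad_sqr He (M k) (index_enum_uniq _))).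
rewrite le_eqVlt; apply/orP; left; apply/eqP; congr (_ * _).
rewrite mulr_suml; apply: eq_bigr => i _.
rewrite (bigD1 i)//= big1 ?addr0 /M ?eqxx; last first.
  by move=> j ji; rewrite eq_sym (negbTE ji) expr0n.
by rewrite exprMn exprVn sqr_sqrtr 1?mulrC// ltW.
Qed.

End DiagonalPart.

(** * Small perturbations of a maximum *)

Section Perturbation.
Context d (T : measurableType d) (R : realType) (P : probability T R).

Lemma below_perturb (s : seq nat) (V V' : nat -> T -> R) (x t : R) : 0 < t ->
  (forall k, all_moments P (V k)) -> (forall k, all_moments P (V' k)) ->
  fine (P [set w | forall k, k \in s -> V k w <= x]) <=
  fine (P [set w | forall k, k \in s -> V' k w <= x + t]) +
  t ^- 2 * \sum_(k <- s) mean P (fun w => (V k w - V' k w) ^+ 2).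
Proof.
move=> t0 nV nV'.
have mV k : measurable_fun setT (V k) by case: (nV k).
have mV' k : measurable_fun setT (V' k) by case: (nV' k).
have nD k : all_moments P (fun w => (V k w - V' k w) ^+ 2).
  by apply: all_momentsX; exact: all_momentsB.
have nI (A : set T) : measurable A -> all_moments P (\1_A : T -> R).
  move=> mA; apply: (@all_moments_bounded _ _ _ _ _ 1); first exact: measurable_indic.
  by move=> w; rewrite indicE; case: (_ \in _); rewrite ?normr1 ?normr0.
have mA := below_measurable s x mV.
have mB := below_measurable s (x + t) mV'.
have nS : all_moments P (fun w => \sum_(k <- s) (V k w - V' k w) ^+ 2).
  exact: all_moments_sum.
rewrite -(mean_indic P mA) -(mean_indic P mB) -mean_sum// -meanZ//.
rewrite -meanD; [|exact: nI|exact: all_momentsZ].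
apply: le_mean => [||w]; first exact: nI.
  by apply: all_momentsD; [exact: nI|exact: all_momentsZ].
have S0 : 0 <= t ^- 2 * \sum_(k <- s) (V k w - V' k w) ^+ 2.
  by rewrite mulr_ge0 ?invr_ge0 ?sqr_ge0// sumr_ge0// => k _; exact: sqr_ge0.
rewrite !indicE; case: (boolP (w \in _)) => [|_]; last by rewrite addr_ge0.
rewrite inE/= => wA; case: (boolP (w \in _)) => [_|]; first by rewrite lerDl.
rewrite notin_setE/= => h; rewrite add0r.
have [k [ks /negP]] : exists k, k \in s /\ ~ (V' k w <= x + t).
  apply: contrapT => hn; apply: h => k ks; apply: contrapT => hk; apply: hn.
  by exists k.
rewrite -ltNge => hk; have hv := wA k ks.
rewrite mulrC ler_pdivlMr ?exprn_gt0// mul1r (big_rem k)//=.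
apply: (@le_trans _ _ ((V k w - V' k w) ^+ 2)); last first.
  by rewrite lerDl sumr_ge0// => j _; exact: sqr_ge0.
have : t <= V' k w - V k w by lra.
nra.
Qed.

End Perturbation.

(** * Sums of the shrinkage coefficients *)

Section EigenvalueSums.
Context (R : realType).

(** The bound is uniform in [k]: terms with h nu < 1 are at most 1, and beyond them (h nu)^(2k)
    dominates (h nu)^2, whose inverses telescope. *)
Lemma sum_eig_le (h : R) (k n : nat) : 0 < h -> h <= 1 -> (0 < k)%N ->
  \sum_(nu < n) (1 + (h * nu.+1%:R) ^+ (2 * k))^-1 <= 4 / h.
Proof.
move=> h0 h1 k0.
pose S n := \sum_(nu < n) (1 + (h * nu.+1%:R) ^+ (2 * k))^-1.
have dge1 nu : 1 <= 1 + (h * nu.+1%:R) ^+ (2 * k) by rewrite lerDl exprn_ge0// mulr_ge0// ltW.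
have Sn i : S i <= i%:R.
  have -> : i%:R = \sum_(nu < i) (1 : R) by rewrite sumr_const card_ord.
  apply: ler_sum => nu _; rewrite invf_le1//; exact: lt_le_trans (dge1 _).
(* The subtracted term carries the telescoping 1 / (i+1)^2 <= 1/i - 1/(i+1). At the first index with
   y = h i >= 1 one has y <= 2, hence y + 1/y <= 4. *)
have Sh i : 1 <= h * i%:R -> S i <= 4 / h - (h ^+ 2 * i%:R)^-1.
  elim: i => [|i IH]; first by rewrite mulr0 ler10.
  move=> hi; have [hi1|hi1] := leP 1 (h * i%:R).
    have i0 : 0 < i%:R :> R.
      by rewrite -(pmulr_rgt0 _ h0); exact: lt_le_trans hi1.
    rewrite /S big_ord_recr/= -/(S i).
    have hd : (1 + (h * i.+1%:R) ^+ (2 * k))^-1 <= (h ^+ 2 * i%:R)^-1 - (h ^+ 2 * i.+1%:R)^-1.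
      have i1 : 0 < i.+1%:R :> R by rewrite ltr0n.
      apply: (@le_trans _ _ ((h * i.+1%:R) ^+ 2)^-1).
        rewrite lef_pV2 ?posrE ?exprn_gt0 ?mulr_gt0//; last exact: lt_le_trans (dge1 _).
        apply: (@le_trans _ _ ((h * i.+1%:R) ^+ (2 * k))); last by rewrite lerDr.
        by apply: ler_weXn2l => //; rewrite leq_pmulr.
      have -> : (h ^+ 2 * i%:R)^-1 - (h ^+ 2 * i.+1%:R)^-1 = (h ^+ 2 * (i%:R * i.+1%:R))^-1.
        rewrite -natr1; field.
        by rewrite natr1 !gt_eqF.
      rewrite lef_pV2 ?posrE ?exprn_gt0 ?mulr_gt0 ?exprn_gt0// exprMn.
      apply: ler_wpM2l; first exact: sqr_ge0.
      by rewrite expr2; apply: ler_wpM2r; [exact: ltW|rewrite ler_nat].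
    have := IH hi1; move: hd.
    set p := (h ^+ 2 * i%:R)^-1; set q := (h ^+ 2 * i.+1%:R)^-1; set r := (1 + _)^-1.
    move: (4 / h) (S i) p q r => ? ? ? ? ?; lra.
  apply: (le_trans (Sn _)).
  set y := h * i.+1%:R in hi.
  have y2 : y <= 2 by rewrite /y -natr1 mulrDr mulr1; lra.
  have -> : i.+1%:R = y / h by rewrite /y mulrC mulKf// gt_eqF.
  have -> : (h ^+ 2 * (y / h))^-1 = y^-1 / h.
    by field; rewrite !gt_eqF// (lt_le_trans _ hi).
  rewrite -mulrBl ler_pM2r ?invr_gt0// lerBrDr.
  have : y^-1 <= 1 by rewrite invf_le1// (lt_le_trans _ hi).
  lra.
have [hn|hn] := leP 1 (h * n%:R).
  apply: (le_trans (Sh n hn)); rewrite gerBl invr_ge0 mulr_ge0 ?sqr_ge0//.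
by apply: (le_trans (Sn n)); rewrite ler_pdivlMr// [leLHS]mulrC; apply: (le_trans (ltW hn)); rewrite ler1n.
Qed.

(** The first [N] terms, [N] being the integer part of 1 / h, are at least 1/4 each, and N >= 1 /
    (2h) because N >= 1 and N + 1 > 1 / h. *)
Lemma sum_eig_sqr_ge (h : R) (k n : nat) : 0 < h -> h <= 1 -> 1 <= h * n%:R ->
  (8 * h)^-1 <= \sum_(nu < n) (1 + (h * nu.+1%:R) ^+ (2 * k))^-1 ^+ 2.
Proof.
move=> h0 h1 hn.
pose N := Num.truncn h^-1.
have hi0 : 0 <= h^-1 by rewrite invr_ge0 ltW.
have /andP[N1 N2] : N%:R <= h^-1 < N.+1%:R by exact: truncn_itv.
have Nn : (N <= n)%N.
  rewrite -(ler_nat R); apply: (le_trans N1).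
  by rewrite -[leLHS]mul1r ler_pdivrMr// mulrC.
have Ngt0 : (0 < N)%N.
  rewrite lt0n; apply/eqP => NE; move: N2; rewrite NE.
  by rewrite invf_lt1// ltNge h1.
apply: (@le_trans _ _ (\sum_(nu < n) if (nu < N)%N then 4^-1 else 0)); last first.
  apply: ler_sum => nu _; case: ifP => [nN|_]; last exact: sqr_ge0.
  have hx : (h * nu.+1%:R) ^+ (2 * k) <= 1.
    apply: exprn_ile1; first by rewrite mulr_ge0// ltW.
    rewrite mulrC -ler_pdivlMr// mul1r; apply: le_trans N1.
    by rewrite ler_nat.
  have hx0 : 0 <= (h * nu.+1%:R) ^+ (2 * k) by rewrite exprn_ge0// mulr_ge0// ltW.
  rewrite exprVn lef_pV2 ?posrE ?exprn_gt0//; last by lra.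
  set x := _ ^+ (2 * k) in hx hx0 *; nra.
rewrite -big_mkcond/= -(big_mkord (fun i => (i < N)%N) (fun=> 4^-1)).
rewrite (big_cat_nat (n := N))//= [X in _ + X]big_nat_cond [X in _ + X]big1; last first.
  by move=> i /andP[/andP[Ni _]]; rewrite ltnNge Ni.
rewrite addr0 big_nat_cond (eq_bigl (fun i => (0 <= i < N)%N)); last first.
  by move=> i; rewrite leq0n/= andbb.
rewrite -big_nat sumr_const_nat subn0.
have N1R : 1 <= N%:R :> R by rewrite ler1n.
move: N2; rewrite -natr1 => N2.
rewrite invfM -mulr_natr; set q := h^-1 in N1 N2 *; lra.
Qed.

(** Squaring a diagonal entry gives a double sum over [nu] and [mu]; summing over [i], the mixed
    products are bounded by fourth-power sums through the arithmetic-geometric mean inequality. *)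
Lemma sum_diag_sqr_le n (W : 'M[R]_n) (d : 'I_n -> R) (M4 : R) : (0 < n)%N ->
  (forall nu, 0 <= d nu) -> (forall nu, \sum_(i < n) W i nu ^+ 4 <= M4) ->
  \sum_(i < n) smoother (orth W) d i i ^+ 2 <= n%:R ^- 2 * M4 * (\sum_(nu < n) d nu) ^+ 2.
Proof.
move=> n0 d0 hM.
have n0R : 0 < n%:R :> R by rewrite ltr0n.
pose a i := \sum_(nu < n) d nu * W i nu ^+ 2.
have aE i : smoother (orth W) d i i = n%:R^-1 * a i.
  rewrite smootherE mulr_sumr; apply: eq_bigr => nu _.
  rewrite /orth mxE (_ : _ * _ * (_ * _) = (Num.sqrt n%:R)^-1 ^+ 2 * W i nu ^+ 2); last by ring.
  by rewrite exprVn sqr_sqrtr ?ltW//; ring.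
under eq_bigr do rewrite aE exprMn.
rewrite -mulr_sumr exprVn -mulrA ler_wpM2l ?invr_ge0 ?sqr_ge0//.
have -> : \sum_(i < n) a i ^+ 2 = \sum_(nu < n) \sum_(mu < n) d nu * d mu *
    \sum_(i < n) W i nu ^+ 2 * W i mu ^+ 2.
  under [RHS]eq_bigr do under eq_bigr do rewrite mulr_sumr.
  under [RHS]eq_bigr do rewrite exchange_big/=.
  rewrite [RHS]exchange_big/=; apply: eq_bigr => i _.
  rewrite expr2 /a big_distrlr/=; apply: eq_bigr => nu _; apply: eq_bigr => mu _; ring.
have h nu mu : \sum_(i < n) W i nu ^+ 2 * W i mu ^+ 2 <= M4.
  apply: (@le_trans _ _ (2^-1 * \sum_(i < n) W i nu ^+ 4 + 2^-1 * \sum_(i < n) W i mu ^+ 4)).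
    rewrite !mulr_sumr -big_split/=; apply: ler_sum => i _.
    have := sqr_ge0 (W i nu ^+ 2 - W i mu ^+ 2).
    rewrite (_ : (_ - _) ^+ 2 = W i nu ^+ 4 + W i mu ^+ 4 - 2 * (W i nu ^+ 2 * W i mu ^+ 2)); last by ring.
    lra.
  by have := hM nu; have := hM mu; lra.
rewrite expr2 big_distrlr/= mulr_sumr; apply: ler_sum => nu _.
rewrite mulr_sumr; apply: ler_sum => mu _; rewrite [leRHS]mulrC.
by apply: ler_wpM2l; rewrite ?mulr_ge0.
Qed.

End EigenvalueSums.

(** * Bandwidths of different orders of magnitude *)

Section Bandwidths.
Context (R : realType).
Variables (c0 : R) (n : nat).
Hypothesis c0_gt0 : 0 < c0.

Definition loglog : R := ln (ln n%:R).
(** The logarithm of n^2 / log log n, of which all the bandwidths are negative powers up to the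
    factor [c0]. *)
Definition log_ratio : R := 2 * ln n%:R - ln loglog.

(* lambda_k = h_k^(2k), where h_k is the bandwidth below. *)
Definition bandwidth (k : nat) : R := c0 * expR (- log_ratio / (4 * k + 1)%:R).

(* Bounds h_j / h_k for 1 <= j < k <= m, as (4 j + 1) (4 k + 1) <= 25 m^2. *)
Definition spread (m : nat) : R := expR (- log_ratio / (25 * m%:R ^+ 2)).

Lemma bandwidth_gt0 k : 0 < bandwidth k.
Proof. by rewrite mulr_gt0 ?expR_gt0. Qed.

Lemma spread_gt0 m : 0 < spread m. Proof. exact: expR_gt0. Qed.

Hypotheses (n0 : (0 < n)%N) (LL1 : 1 <= loglog).

Let LL0 : 0 < loglog. Proof. exact: lt_le_trans LL1. Qed.

Let four_k1 j : (4 * j + 1)%:R = 4 * j%:R + 1 :> R.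
Proof. by rewrite -natrM natr1 addn1. Qed.

Lemma lambdaE k : lambda c0 n k = bandwidth k ^+ (2 * k).
Proof.
rewrite /lambda /bandwidth exprMn -mulrA; congr (_ * _).
rewrite -/loglog /powR !gt_eqF ?ltr0n// -expRD -expRM_natl; congr expR.
rewrite /log_ratio four_k1 !natrM; field.
by rewrite gt_eqF// ltr_wpDl// mulr_ge0.
Qed.

Lemma eigE k (nu : 'I_n) : eig c0 k nu = (1 + (bandwidth k * nu.+1%:R) ^+ (2 * k))^-1.
Proof. by rewrite /eig /dcoef div1r lambdaE -exprMn. Qed.

Lemma eig_itv k (nu : 'I_n) : 0 <= eig c0 k nu <= 1.
Proof. exact: dcoef_itv. Qed.

Hypothesis Z0 : 0 <= log_ratio.

Lemma bandwidth_le k l : (k <= l)%N -> bandwidth k <= bandwidth l.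
Proof.
move=> kl; rewrite /bandwidth ler_wpM2l ?(ltW c0_gt0)// ler_expR !mulNr lerN2.
apply: ler_wpM2l => //; rewrite lef_pV2 ?posrE ?ltr0n ?addn1// ler_nat.
by rewrite ltnS leq_mul2l.
Qed.

Lemma bandwidth_ratio k l m : (0 < k)%N -> (k < l)%N -> (l <= m)%N ->
  bandwidth k <= spread m * bandwidth l.
Proof.
move=> k0 kl lm; rewrite /bandwidth /spread mulrCA -expRD.
rewrite ler_wpM2l ?(ltW c0_gt0)// ler_expR !mulNr -opprD lerN2 -mulrDr.
apply: ler_wpM2l => //.
have k1R : 1 <= k%:R :> R by rewrite ler1n.
have klR : k%:R + 1 <= l%:R :> R by rewrite natr1 ler_nat.
have lmR : l%:R <= m%:R :> R by rewrite ler_nat.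
rewrite !four_k1; move: (k%:R) (l%:R) (m%:R) k1R klR lmR => x y z x1 xy yz.
have p1 : 0 < 4 * x + 1 by lra.
have p2 : 0 < 4 * y + 1 by lra.
have p3 : 0 < 25 * z ^+ 2 by rewrite mulr_gt0// exprn_gt0//; lra.
have E : (4 * x + 1)^-1 - (4 * y + 1)^-1 = 4 * (y - x) / ((4 * x + 1) * (4 * y + 1)).
  by field; rewrite !gt_eqF.
suff : (25 * z ^+ 2)^-1 <= (4 * x + 1)^-1 - (4 * y + 1)^-1 by lra.
rewrite E -[leLHS]mul1r ler_pdivrMr// mulrAC ler_pdivlMr ?mulr_gt0// mul1r.
have q1 : (4 * x + 1) * (4 * y + 1) <= (5 * z) * (5 * z) by apply: ler_pM; lra.
have q2 : 0 <= (y - x - 1) * z ^+ 2 by rewrite mulr_ge0 ?sqr_ge0//; lra.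
have q3 : 0 <= z ^+ 2 by exact: sqr_ge0.
rewrite expr2 in q2 q3 *; nra.
Qed.

Lemma bandwidth_spread k m : (0 < k)%N -> (k <= m)%N -> bandwidth k <= c0 * spread m.
Proof.
move=> k0 km; rewrite /bandwidth /spread ler_wpM2l ?(ltW c0_gt0)// ler_expR !mulNr lerN2.
apply: ler_wpM2l => //.
have k1R : 1 <= k%:R :> R by rewrite ler1n.
have kmR : k%:R <= m%:R :> R by rewrite ler_nat.
rewrite four_k1; move: (k%:R) (m%:R) k1R kmR => x z x1 xz.
rewrite lef_pV2 ?posrE; [|rewrite mulr_gt0// exprn_gt0//; lra|lra].
rewrite expr2; nra.
Qed.

Variables (W : 'M[R]_n) (m : nat) (eta : R).
Hypotheses (WW : W^T *m W = n%:R%:M) (hm : c0 * spread m <= 1)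
  (hn : 1 <= bandwidth 1 * n%:R) (eta0 : 0 <= eta) (eta_le : 256 * eta <= c0).
Hypothesis hM4 : forall nu, \sum_(i < n) W i nu ^+ 4 <=
   eta * (n%:R `^ (8 / 5) * loglog `^ (- (14 / 5))).

Let sc k := scale2 (orth W) (@eig R c0 n) k.

Lemma diag_sqr_bandwidth k : (0 < k)%N -> (k <= m)%N ->
  \sum_(i < n) smoother (orth W) (eig c0 k) i i ^+ 2 <=
  16 * (eta / c0) * loglog ^- 3 * (bandwidth 1 / bandwidth k) / bandwidth k.
Proof.
move=> k0 km.
have hk : bandwidth k <= 1 by exact: le_trans (bandwidth_spread k0 km) hm.
have bk := bandwidth_gt0 k.
have d0 (nu : 'I_n) : 0 <= eig c0 k nu by have /andP[? _] := eig_itv k nu.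
apply: (le_trans (sum_diag_sqr_le n0 d0 hM4)).
(* The fourth-power condition is calibrated to the smallest bandwidth: bandwidth 1 / c0 is n^(-2/5)
   (log log n)^(1/5), and -14/5 = -3 + 1/5. *)
have E : n%:R ^- 2 * (eta * (n%:R `^ (8 / 5) * loglog `^ (- (14 / 5)))) =
    eta / c0 * loglog ^- 3 * bandwidth 1.
  have n0R : 0 < n%:R :> R by rewrite ltr0n.
  have -> : n%:R ^- 2 = expR (- (2 * ln n%:R)) :> R.
    by rewrite expRN expRM_natl lnK// posrE.
  have -> : loglog ^- 3 = expR (- (3 * ln loglog)).
    by rewrite expRN expRM_natl lnK// posrE.
  rewrite /powR !gt_eqF// /bandwidth.
  have c0n : c0 != 0 by rewrite gt_eqF.
  transitivity (eta * (expR (- (2 * ln n%:R)) * expR (8 / 5 * ln n%:R) * expR (- (14 / 5) * ln loglog))).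
    ring.
  transitivity (eta * (expR (- (3 * ln loglog)) * expR (- log_ratio / (4 * 1 + 1)%:R))); last first.
    by field.
  rewrite -!expRD; congr (_ * expR _); rewrite /log_ratio (_ : (4 * 1 + 1)%:R = 5)//.
  by field.
rewrite E.
have S0 : 0 <= \sum_(nu < n) eig c0 k nu by apply: sumr_ge0.
have hs : \sum_(nu < n) eig c0 k nu <= 4 / bandwidth k.
  by under eq_bigr do rewrite eigE; exact: sum_eig_le.
apply: (@le_trans _ _ (eta / c0 * loglog ^- 3 * bandwidth 1 * (4 / bandwidth k) ^+ 2)).
  apply: ler_wpM2l; last by apply: lerXn2r; rewrite ?nnegrE// divr_ge0// ltW.
  rewrite mulr_ge0 ?(ltW (bandwidth_gt0 _))// mulr_ge0 ?divr_ge0 ?(ltW c0_gt0)//.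
  by rewrite invr_ge0 exprn_ge0// ltW.
rewrite le_eqVlt; apply/orP; left; apply/eqP; field.
by rewrite !gt_eqF.
Qed.

(** With 256 eta <= c0 the diagonal takes away at most half of the lower bound 1 / (8h) of
    [sum_eig_sqr_ge]; the factor 2 in [scale2] restores it. *)
Lemma scale2_ge k : (0 < k)%N -> (k <= m)%N -> (8 * bandwidth k)^-1 <= sc k.
Proof.
move=> k0 km; rewrite /sc /scale2 (frob2_offdiag (orth_orthogonal n0 WW)).
have hk : bandwidth k <= 1 by exact: le_trans (bandwidth_spread k0 km) hm.
have bk := bandwidth_gt0 k; have b1 := bandwidth_gt0 1.
have b1k := bandwidth_le k0.
have hD := diag_sqr_bandwidth k0 km.
have hS : (8 * bandwidth k)^-1 <= \sum_(nu < n) eig c0 k nu ^+ 2.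
  under eq_bigr do rewrite eigE; apply: sum_eig_sqr_ge => //.
  by apply: (le_trans hn); rewrite ler_wpM2r.
have hDD : 16 * (eta / c0) * loglog ^- 3 * (bandwidth 1 / bandwidth k) / bandwidth k <=
    (16 * bandwidth k)^-1.
  rewrite (_ : (16 * bandwidth k)^-1 = 16^-1 / bandwidth k); last by rewrite [LHS]invfM.
  apply: ler_wpM2r; first by rewrite invr_ge0 ltW.
  have e1 : 16 * (eta / c0) <= 16^-1.
    by rewrite mulrA ler_pdivrMr//; have := eta_le; lra.
  have e0 : 0 <= 16 * (eta / c0) by rewrite mulr_ge0// divr_ge0// ltW.
  have l1 : loglog ^- 3 <= 1.
    by rewrite invf_le1 ?exprn_gt0// exprn_ege1.
  have l0 : 0 <= loglog ^- 3 by rewrite invr_ge0 exprn_ge0// ltW.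
  have r1 : bandwidth 1 / bandwidth k <= 1 by rewrite ler_pdivrMr// mul1r.
  have r0 : 0 <= bandwidth 1 / bandwidth k by rewrite divr_ge0// ltW.
  rewrite -[leRHS]mulr1; apply: ler_pM => //; first by rewrite mulr_ge0.
  by rewrite -[leRHS]mulr1; apply: ler_pM.
move: hS hD hDD; set A := \sum_(nu < n) _; set D := \sum_(i < n) _; set Q := _ / bandwidth k.
move: Q (bandwidth k) => Q b; rewrite !invfM; lra.
Qed.

Lemma scale2_gt0 k : (0 < k)%N -> (k <= m)%N -> 0 < sc k.
Proof.
move=> k0 km; apply: lt_le_trans (scale2_ge k0 km).
by rewrite invr_gt0 mulr_gt0// bandwidth_gt0.
Qed.

Lemma diag_ratio k : (0 < k)%N -> (k <= m)%N ->
  (\sum_(i < n) smoother (orth W) (eig c0 k) i i ^+ 2) / sc k <=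
  128 * (eta / c0) * loglog ^- 3 * (bandwidth 1 / bandwidth k).
Proof.
move=> k0 km; rewrite ler_pdivrMr ?scale2_gt0//.
apply: (le_trans (diag_sqr_bandwidth k0 km)).
have bk := bandwidth_gt0 k; have b1 := bandwidth_gt0 1.
set Q := 128 * _ * _ * _.
have Q0 : 0 <= Q.
  rewrite /Q !mulr_ge0 ?invr_ge0 ?(ltW c0_gt0) ?(ltW bk) ?(ltW b1)// exprn_ge0//.
  exact: ltW.
apply: le_trans (ler_wpM2l Q0 (scale2_ge k0 km)).
rewrite le_eqVlt; apply/orP; left; apply/eqP; rewrite /Q; field.
by rewrite !gt_eqF.
Qed.

(** As [scale2 k] is at least 1 / (8 h_k), rows and products are of order h_k, and the trace of a
    pair k < l is at most 128 sqrt(h_k / h_l), with 128 = 4 * 8 * 4. This square root explains the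
    one in the bound. *)
Lemma weights_spread : nearly_orthogonal (index_iota 1 m.+1)
  (weights (orth W) (@eig R c0 n)) (128 * (1 + c0) * Num.sqrt (spread m)).
Proof.
have c0p := c0_gt0; have sp := spread_gt0 m.
have in_s k : k \in index_iota 1 m.+1 -> (0 < k)%N /\ (k <= m)%N.
  by rewrite mem_index_iota ltnS => /andP[].
apply: weights_nearly_orthogonal.
- exact: orth_orthogonal.
- by move=> k j; exact: eig_itv.
- by rewrite !mulr_ge0 ?sqrtr_ge0// addr_ge0// ltW.
- by move=> k /in_s[k0 km]; exact: scale2_gt0.
- move=> k /in_s[k0 km]; rewrite exprMn sqr_sqrtr ?(ltW sp)// -/(sc k).
  have bk := bandwidth_gt0 k.
  apply: (@le_trans _ _ (256 * bandwidth k)).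
    rewrite ler_pdivrMr ?scale2_gt0//.
    have := ler_wpM2l (mulr_ge0 (ler0n R 256) (ltW bk)) (scale2_ge k0 km).
    apply: le_trans; rewrite le_eqVlt; apply/orP; left; apply/eqP; field.
    by rewrite gt_eqF.
  have := bandwidth_spread k0 km; set r := spread m in sp *; set b := bandwidth k => hb.
  have K1 : 1 <= 128 :> R by rewrite ler1n.
  rewrite (_ : 256 * b = 2 * 128 * b); last by rewrite -natrM.
  move: (128 : R) K1 => K K1.
  have h1 : 0 <= r by exact: ltW.
  apply: (@le_trans _ _ (2 * K * (c0 * r))); first by rewrite ler_wpM2l// mulr_ge0//; lra.
  rewrite mulrA ler_wpM2r// exprMn.
  have K2 : K <= K ^+ 2 by rewrite expr2 ler_peMr//; lra.
  have c2 : 2 * c0 <= (1 + c0) ^+ 2 by rewrite expr2; nra.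
  rewrite (_ : 2 * K * c0 = K * (2 * c0)); last by ring.
  by apply: ler_pM => //; [lra|rewrite mulr_ge0// ltW].
- move=> k l /in_s[k0 km] /in_s[l0 lm] kl.
  have bk := bandwidth_gt0 k; have bl := bandwidth_gt0 l.
  have hl : bandwidth l <= 1 by exact: le_trans (bandwidth_spread l0 lm) hm.
  have hs : \sum_(nu < n) eig c0 l nu <= 4 / bandwidth l.
    by under eq_bigr do rewrite eigE; exact: sum_eig_le.
  have inv_le j : (0 < j)%N -> (j <= m)%N ->
      (Num.sqrt (sc j))^-1 <= Num.sqrt (8 * bandwidth j).
    move=> j0 jm; have bj := bandwidth_gt0 j.
    rewrite -[leRHS]invrK -[in leRHS]sqrtrV; last by rewrite mulr_ge0// ltW.
    have s0 := scale2_gt0 j0 jm.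
    have i0 : 0 < (8 * bandwidth j)^-1 by rewrite invr_gt0 mulr_gt0.
    rewrite lef_pV2 ?posrE ?sqrtr_gt0//.
    by apply: ler_wsqrtr; exact: scale2_ge.
  have iv0 j : 0 <= (Num.sqrt (sc j))^-1 by rewrite invr_ge0 sqrtr_ge0.
  have S0 : 0 <= \sum_(nu < n) eig c0 l nu.
    by apply: sumr_ge0 => nu _; have /andP[] := dcoef_itv c0 n l nu.+1.
  apply: (@le_trans _ _ (4 * (Num.sqrt (8 * bandwidth k) * Num.sqrt (8 * bandwidth l)) * (4 / bandwidth l))).
    apply: ler_pM => //.
    rewrite -mulrA ler_wpM2l//; apply: ler_pM => //; exact: inv_le.
  have E : Num.sqrt (8 * bandwidth k) * Num.sqrt (8 * bandwidth l) <=
     8 * bandwidth l * Num.sqrt (spread m).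
    rewrite -sqrtrM; last by rewrite mulr_ge0// ltW.
    rewrite [X in _ <= X * _](_ : _ = Num.sqrt ((8 * bandwidth l) ^+ 2)); last first.
      by rewrite sqrtr_sqr gtr0_norm// mulr_gt0.
    rewrite -[leRHS]sqrtrM ?sqr_ge0//; apply: ler_wsqrtr; have := bandwidth_ratio k0 kl lm => h.
    rewrite [leLHS](_ : _ = 64 * bandwidth l * bandwidth k); last by ring.
    rewrite [leRHS](_ : _ = 64 * bandwidth l * (spread m * bandwidth l)); last by ring.
    by rewrite ler_wpM2l// mulr_ge0// ltW.
  have c4 : 0 <= 4 / bandwidth l by rewrite divr_ge0// ltW.
  have := ler_wpM2r c4 (ler_wpM2l (ler0n R 4) E) => /le_trans; apply.
  rewrite (_ : 4 * _ * _ = 128 * Num.sqrt (spread m)); last by field; rewrite gt_eqF.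
  rewrite ler_wpM2r ?sqrtr_ge0//; lra.
Qed.

End Bandwidths.

(** * Two-sided bounds at a fixed sample size *)

Section FixedSampleSize.
Context d (T : measurableType d) (R : realType) (P : probability T R).
Variables (e : nat -> {RV P >-> R}) (mu4 : R).
Hypothesis He : noise e mu4.
Variables (c0 : R) (n : nat) (W : 'M[R]_n) (m : nat) (eta B c t : R).
Hypotheses (c0_gt0 : 0 < c0) (n0 : (0 < n)%N) (LL1 : 1 <= loglog R n)
  (Z0 : 0 <= log_ratio R n) (WW : W^T *m W = n%:R%:M)
  (hm : c0 * spread R n m <= 1) (hn : 1 <= bandwidth c0 n 1 * n%:R)
  (eta0 : 0 <= eta) (eta_le : 256 * eta <= c0)
  (hM4 : forall nu, \sum_(i < n) W i nu ^+ 4 <=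
     eta * (n%:R `^ (8 / 5) * loglog R n `^ (- (14 / 5))))
  (m0 : (0 < m)%N) (B0 : 0 < B) (t0 : 0 < t).

Definition theta : R := 128 * (1 + c0) * Num.sqrt (spread R n m).
(** The term 1 is the contribution of k = 1; each other k has bandwidth 1 / bandwidth k at most
    [spread]. *)
Definition diag_error : R :=
  (2 + mu4) * (128 * (eta / c0) * loglog R n ^- 3) * (1 + m%:R * spread R n m).

Let s := index_iota 1 m.+1.
Let b := weights (orth W) (@eig R c0 n).
Let tau_rv k w := qform e b k w + diag_rv e c0 W k w.

Lemma theta_gt0 : 0 < theta.
Proof. by rewrite /theta !mulr_gt0 ?sqrtr_gt0 ?expR_gt0// addr_gt0. Qed.

Lemma tau_rvE k w : tau c0 W (\col_i e i w) k = tau_rv k w.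
Proof. by rewrite (tauE c0 n0 WW). Qed.

Lemma AT_setE : [set w | AT c0 W (\col_i e i w) m B <= c] =
  [set w | forall k, k \in s -> tau_rv k w <= B + c / B].
Proof.
apply/seteqP; split => w /=.
  by move=> /(AT_le c0 W _ c m0 B0) h k ks; rewrite -tau_rvE; exact: h.
by move=> h; apply/(AT_le c0 W _ c m0 B0) => k ks; rewrite tau_rvE; exact: h.
Qed.

Lemma all_moments_tau_rv k : all_moments P (tau_rv k).
Proof.
by apply: all_momentsD; [exact: (all_moments_qform He)|exact: (all_moments_diag_rv He)].
Qed.

Lemma sum_diag_error : \sum_(k <- s) mean P (fun w => diag_rv e c0 W k w ^+ 2) <= diag_error.
Proof.
have hm4 := fourth_moment_ge1 He.
pose K := (2 + mu4) * (128 * (eta / c0) * loglog R n ^- 3).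
have K0 : 0 <= K.
  have l0 : 0 <= loglog R n ^- 3.
    by rewrite invr_ge0 exprn_ge0//; exact: le_trans ler01 LL1.
  have q0 : 0 <= eta / c0 by rewrite divr_ge0// ltW.
  apply: mulr_ge0; first lra.
  by apply: mulr_ge0 => //; exact: mulr_ge0.
have hk k : (0 < k)%N -> (k <= m)%N -> mean P (fun w => diag_rv e c0 W k w ^+ 2) <=
    K * (bandwidth c0 n 1 / bandwidth c0 n k).
  move=> k0 km.
  have S0 := scale2_gt0 c0_gt0 n0 LL1 Z0 WW hm hn eta0 eta_le hM4 k0 km.
  apply: (le_trans (mean_diag_rv_sqr He S0)).
  rewrite /K -[leRHS]mulrA; apply: ler_wpM2l; first lra.
  exact: (diag_ratio c0_gt0 n0 LL1 Z0 WW hm hn eta0 eta_le hM4 k0 km).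
have b0 k := bandwidth_gt0 n c0_gt0 k.
rewrite /s big_ltn ?ltnS//.
rewrite /diag_error -/K mulrDr mulr1; apply: lerD.
  by apply: (le_trans (hk 1%N _ _)) => //; rewrite divff ?mulr1// gt_eqF.
apply: (@le_trans _ _ (\sum_(2 <= k < m.+1) K * spread R n m)).
  rewrite big_nat [leRHS]big_nat; apply: ler_sum => k; rewrite ltnS => /andP[k2 km].
  apply: (le_trans (hk k _ km)); first exact: ltnW.
  apply: ler_wpM2l => //; rewrite ler_pdivrMr//.
  exact: (bandwidth_ratio c0_gt0 Z0 (ltn0Sn 0) k2 km).
rewrite sumr_const_nat -[leLHS]mulr_natr -mulrA ler_wpM2l// mulrC.
by rewrite ler_wpM2r ?(ltW (spread_gt0 _ _ _))// ler_nat leq_subLR add2n leqW.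
Qed.

Let nearly := weights_spread c0_gt0 n0 LL1 Z0 WW hm hn eta0 eta_le hM4.

Let size_s : size s = m.
Proof. by rewrite size_iota subn1. Qed.

Let t2 : 0 <= t ^- 2. Proof. by rewrite invr_ge0 sqr_ge0. Qed.

(** The level moves twice by [t]: once to discard the diagonal part, once across the window of the
    cutoff. The lower bound makes the same two moves downwards. *)
Lemma AT_prob_le : 0 <= B + c / B + t -> 1 <= B + c / B + 2 * t ->
  fine (P [set w | AT c0 W (\col_i e i w) m B <= c]) <=
  (1 - gtail (B + c / B + 2 * t)) ^+ m +
  clt_error mu4 (B + c / B + 2 * t) t theta m + t ^- 2 * diag_error.
Proof.
move=> h1 h2; rewrite AT_setE.
apply: (le_trans (below_perturb s _ t0 all_moments_tau_rv (all_moments_qform He b))).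
apply: lerD; last first.
  apply: ler_wpM2l => //; apply: le_trans sum_diag_error.
  by apply: ler_sum => k _; rewrite /tau_rv; under eq_fun do rewrite addrAC subrr add0r.
have uv : B + c / B + t < B + c / B + 2 * t by rewrite ltrD2l ltr_pMl// ltr1n.
have [+ _] := qform_max_bounds He nearly (iota_uniq _ _) theta_gt0 h1 h2 uv.
have -> : B + c / B + 2 * t - (B + c / B + t) = t by ring.
by rewrite -/s size_s.
Qed.

Lemma AT_prob_ge : 0 <= B + c / B - 2 * t -> 1 <= B + c / B - t ->
  (1 - gtail (B + c / B - 2 * t)) ^+ m -
  clt_error mu4 (B + c / B - t) t theta m - t ^- 2 * diag_error
  <= fine (P [set w | AT c0 W (\col_i e i w) m B <= c]).
Proof.
move=> h1 h2; rewrite AT_setE lerBlDr.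
have uv : B + c / B - 2 * t < B + c / B - t by rewrite ltrD2l ltrN2 ltr_pMl// ltr1n.
have [_] := qform_max_bounds He nearly (iota_uniq _ _) theta_gt0 h1 h2 uv.
have -> : B + c / B - t - (B + c / B - 2 * t) = t by ring.
rewrite -/s size_s => /le_trans; apply.
apply: (le_trans (below_perturb s _ t0 (all_moments_qform He b) all_moments_tau_rv)).
rewrite subrK lerD2l.
apply: ler_wpM2l => //; apply: le_trans sum_diag_error.
apply: ler_sum => k _; rewrite /tau_rv.
by under eq_fun do rewrite opprD addNKr sqrrN.
Qed.

End FixedSampleSize.

(** * Divergent sequences and the Gumbel limit *)

Section Divergence.
Context (R : realType).
Implicit Types (u : nat -> R).

Definition unbounded u := forall A : R, \forall n \near \oo, A <= u n.

Lemma unbounded_natr : unbounded (fun n => n%:R).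
Proof. by move=> A; exact: nbhs_infty_ger. Qed.

Lemma unbounded_ln u : unbounded u -> unbounded (fun n => ln (u n)).
Proof.
move=> hu A; near=> n.
have h : expR A <= u n by near: n; exact: hu.
by rewrite -[A]expRK ler_ln ?posrE ?expR_gt0// (lt_le_trans _ h) ?expR_gt0.
Unshelve. all: by end_near. Qed.

Lemma unbounded_mul (c : R) u : 0 < c -> unbounded u -> unbounded (fun n => c * u n).
Proof.
move=> c0 hu A; near=> n.
rewrite mulrC -ler_pdivrMr//; near: n; exact: hu.
Unshelve. all: by end_near. Qed.

Lemma unbounded_le u v : (\forall n \near \oo, u n <= v n) -> unbounded u -> unbounded v.
Proof.
move=> uv hu A; near=> n; apply: (@le_trans _ _ (u n)); near: n => //; exact: hu.
Unshelve. all: by end_near. Qed.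

Lemma unbounded_powR (a : R) u : 0 < a -> unbounded u -> unbounded (fun n => u n `^ a).
Proof.
move=> a0 hu A; near=> n.
have u0 : 0 < u n by apply: (@lt_le_trans _ _ 1) => //; near: n; exact: hu.
rewrite /powR gt_eqF//; apply: le_trans (expR_ge1Dx _).
apply: (@le_trans _ _ (a * ln (u n))); last by rewrite lerDr.
near: n; apply: unbounded_mul => //; exact: unbounded_ln.
Unshelve. all: by end_near. Qed.

Lemma unbounded_inv_le u (eps : R) : 0 < eps -> unbounded u ->
  \forall n \near \oo, 0 < u n /\ (u n)^-1 <= eps.
Proof.
move=> e0 hu; near=> n.
have h : eps^-1 <= u n by near: n; exact: hu.
have i0 : 0 < eps^-1 by rewrite invr_gt0.
have u0 : 0 < u n by exact: lt_le_trans h.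
by split=> //; rewrite -[leRHS]invrK lef_pV2 ?posrE.
Unshelve. all: by end_near. Qed.

Lemma unbounded_inv_cvg0 u : unbounded u -> (u n)^-1 @[n --> \oo] --> (0 : R).
Proof.
move=> hu; apply/cvgr0Pnorm_le => eps e0; near=> n.
have [u0 h] : 0 < u n /\ (u n)^-1 <= eps by near: n; exact: unbounded_inv_le.
by rewrite gtr0_norm// invr_gt0.
Unshelve. all: by end_near. Qed.

Lemma one_minus_expn_le (t : R) (m : nat) : 0 <= t -> t <= 1 ->
  (1 - t) ^+ m <= expR (- (m%:R * t)).
Proof.
move=> t0 t1; rewrite -mulrN expRM_natl.
by apply: lerXn2r; rewrite ?nnegrE ?subr_ge0 ?expR_ge0//; exact: expR_ge1Dx.
Qed.

(** Because 1 / (1 - t) = 1 + t / (1 - t) <= exp (t / (1 - t)). *)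
Lemma one_minus_expn_ge (t : R) (m : nat) : t < 1 ->
  expR (- (m%:R * (t / (1 - t)))) <= (1 - t) ^+ m.
Proof.
move=> t1; have p : 0 < 1 - t by rewrite subr_gt0.
rewrite -mulrN expRM_natl; apply: lerXn2r; rewrite ?nnegrE ?expR_ge0 ?(ltW p)//.
rewrite expRN -[leRHS]invrK lef_pV2 ?posrE ?expR_gt0 ?invr_gt0//.
rewrite [leLHS](_ : _ = 1 + t / (1 - t)); last by field; rewrite gt_eqF.
exact: expR_ge1Dx.
Qed.

Lemma cvg_expR_seq u (l : R) : u n @[n --> \oo] --> l -> expR (u n) @[n --> \oo] --> expR l.
Proof. by move=> h; exact: (cvg_comp u expR h (@continuous_expR R l)). Qed.

(** Equivalently, M gpdf(b) = b. *)
Lemma level_rootE (b M : R) : 0 < b -> 0 <= M ->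
  2 * pi * b ^+ 2 * expR (b ^+ 2) = M ^+ 2 -> M = Num.sqrt (2 * pi) * b * expR (b ^+ 2 / 2).
Proof.
move=> b0 M0 bE; have pp : 0 <= 2 * pi :> R by rewrite mulr_ge0// pi_ge0.
have e2 : expR (b ^+ 2 / 2) ^+ 2 = expR (b ^+ 2).
  by rewrite -expRM_natl; congr expR; field.
apply/eqP; rewrite -(@eqrXn2 _ 2)// ?mulr_ge0 ?sqrtr_ge0 ?expR_ge0 ?(ltW b0)//.
by rewrite -bE !exprMn sqr_sqrtr// e2.
Qed.

(* B_n is the level at which m_n gpdf(B_n) = B_n, so m_n gtail(B_n + s / B_n) tends to exp(-s). *)
Lemma gumbel_limit (B : nat -> R) (m : nat -> nat) (s : R) :
  (forall n, 0 < B n) -> unbounded B ->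
  (forall n, 2 * pi * B n ^+ 2 * expR (B n ^+ 2) = (m n)%:R ^+ 2) ->
  (1 - gtail (B n + s / B n)) ^+ m n @[n --> \oo] --> expR (- expR (- s)).
Proof.
move=> B0 uB BE.
have mE n := level_rootE (B0 n) (ler0n R (m n)) (BE n).
pose z n := (B n)^-1.
(* For v = B + s / B one has v = B w and m gpdf(v) = B E. Below, [hi] and [lo] are the Mills bounds
   for m gtail(v), and [tt], equal to 1 / v, bounds gtail(v). *)
pose w n := 1 + s * z n ^+ 2.
pose E n := expR (- s - s ^+ 2 * z n ^+ 2 / 2).
have zc : z n @[n --> \oo] --> (0 : R) by exact: unbounded_inv_cvg0.
have z2c : z n ^+ 2 @[n --> \oo] --> (0 : R).
  rewrite -[X in _ --> X](mulr0 (0 : R)); under eq_fun do rewrite expr2.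
  exact: cvgM.
have wc : w n @[n --> \oo] --> (1 : R).
  rewrite -[X in _ --> X]addr0; apply: cvgD; first exact: cvg_cst.
  by rewrite -[X in _ --> X](mulr0 s); apply: cvgM => //; exact: cvg_cst.
have Ec : E n @[n --> \oo] --> expR (- s).
  apply: cvg_expR_seq.
  rewrite -[X in _ --> X]subr0; apply: cvgB; first exact: cvg_cst.
  rewrite -[X in _ --> X](mul0r (2^-1 : R)); apply: cvgM; last exact: cvg_cst.
  by rewrite -[X in _ --> X](mulr0 (s ^+ 2)); apply: cvgM => //; exact: cvg_cst.
pose hi n := E n / w n.
pose lo n := w n / (z n ^+ 2 + w n ^+ 2) * E n.
pose tt n := z n / w n.
have wVc : (w n)^-1 @[n --> \oo] --> (1 : R).
  by rewrite -[X in _ --> X]invr1; apply: cvgV => //; exact: oner_neq0.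
have hic : hi n @[n --> \oo] --> expR (- s).
  by rewrite -[X in _ --> X]mulr1; apply: cvgM.
have ttc : tt n @[n --> \oo] --> (0 : R).
  by rewrite -[X in _ --> X](mul0r (1 : R)); apply: cvgM.
have loc : lo n @[n --> \oo] --> expR (- s).
  rewrite -[X in _ --> X]mul1r; apply: cvgM => //.
  rewrite -[X in _ --> X](mulr1 (1 : R)); apply: cvgM => //.
  rewrite -[X in _ --> X]invr1; apply: cvgV; first exact: oner_neq0.
  rewrite -[X in _ --> X]add0r; apply: cvgD => //.
  rewrite -[X in _ --> X](mulr1 (1 : R)); under eq_fun do rewrite expr2.
  exact: cvgM.
have hitc : hi n / (1 - tt n) @[n --> \oo] --> expR (- s).
  rewrite -[X in _ --> X]mulr1; apply: cvgM => //.
  rewrite -[X in _ --> X]invr1; apply: cvgV; first exact: oner_neq0.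
  by rewrite -[X in _ --> X]subr0; apply: cvgB => //; exact: cvg_cst.
apply: (@squeeze_cvgr _ _ _ _ (fun n => expR (- (hi n / (1 - tt n)))) (fun n => expR (- lo n))).
- near=> n.
  have Bn := B0 n.
  have zn : 0 < z n by rewrite invr_gt0.
  have wn : 2^-1 < w n.
    near: n; apply: (cvgr_gt (1 : R)) => //; rewrite invf_lt1//; lra.
  have w0 : 0 < w n by lra.
  have tn : tt n < 1 by near: n; apply: (cvgr_lt (0 : R)).
  set v := B n + s / B n.
  have vE : v = B n * w n by rewrite /v /w /z; field; rewrite gt_eqF.
  have v0 : 0 < v by rewrite vE mulr_gt0.
  have pv : (m n)%:R * gpdf v = B n * E n.
    rewrite gpdfE mE /E.
    transitivity (B n * (expR (B n ^+ 2 / 2) * expR (- v ^+ 2 / 2))).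
      by field; rewrite sqrtr_eq0 -ltNge mulr_gt0// pi_gt0.
    rewrite -expRD; congr (_ * expR _); rewrite /v /z; field.
    by rewrite gt_eqF.
  have T0 := gtail_ge0 v.
  have T1 : v * gtail v <= gpdf v := gtail_le v0.
  have T2 : v * gpdf v <= (1 + v ^+ 2) * gtail v := gtail_ge v0.
  have p1 : gpdf v <= 1 := gpdf_le1 v.
  have Ttt : gtail v <= tt n.
    have -> : tt n = v^-1 by rewrite vE invfM.
    by rewrite -[leRHS]mul1r ler_pdivlMr// mulrC (le_trans T1).
  have T_lt1 : gtail v < 1 by exact: le_lt_trans Ttt tn.
  have mT : (m n)%:R * gtail v <= hi n.
    have -> : hi n = (m n)%:R * gpdf v / v.
      by rewrite pv vE /hi; field; rewrite !gt_eqF.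
    by rewrite ler_pdivlMr// -mulrA ler_wpM2l// mulrC.
  have mTl : lo n <= (m n)%:R * gtail v.
    have -> : lo n = (m n)%:R * (v * gpdf v / (1 + v ^+ 2)).
      transitivity (v * ((m n)%:R * gpdf v) / (1 + v ^+ 2)); last by ring.
      rewrite pv.
      have -> : 1 + v ^+ 2 = B n ^+ 2 * (z n ^+ 2 + w n ^+ 2).
        by rewrite vE /z; field; rewrite gt_eqF.
      rewrite vE /lo; field; rewrite !gt_eqF//.
      by rewrite ltr_wpDl ?sqr_ge0// exprn_gt0.
    by rewrite ler_wpM2l// ler_pdivrMr ?ltr_pwDl ?sqr_ge0// [leRHS]mulrC.
  apply/andP; split.
    apply: le_trans (one_minus_expn_ge _ T_lt1).
    rewrite ler_expR lerN2 mulrA; apply: ler_pM => //.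
    + by rewrite mulr_ge0.
    + by rewrite invr_ge0 subr_ge0 ltW.
    + by rewrite lef_pV2 ?posrE ?subr_gt0// lerD2l lerN2.
  apply: (le_trans (one_minus_expn_le _ T0 (ltW T_lt1))).
  by rewrite ler_expR lerN2.
- by apply: cvg_expR_seq; exact: cvgN.
- by apply: cvg_expR_seq; exact: cvgN.
Unshelve. all: by end_near. Qed.

End Divergence.

(** * Rates of growth and decay *)

Section Rates.
Context (R : realType).
Variables (c0 d0 : R) (kn : nat -> nat) (B : nat -> R).
Hypotheses (c0_gt0 : 0 < c0) (kn_gt0 : forall n, (0 < kn n)%N)
  (d0_gt0 : 0 < d0) (d0_lt : d0 < 1 / 2)
  (kn_asymp :
    (fun n : nat => (kn n)%:R : R) =Theta_\oo (fun n : nat => ln n%:R `^ d0))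
  (B_gt0 : forall n, 0 < B n)
  (B_eq : forall n, 2 * pi * B n ^+ 2 * expR (B n ^+ 2) = (kn n)%:R ^+ 2).

Let Ln (n : nat) : R := ln n%:R.
Let m n : R := (kn n)%:R.

Let m1 n : 1 <= m n. Proof. by rewrite /m ler1n. Qed.

Lemma unbounded_lnn : unbounded Ln.
Proof. exact/unbounded_ln/unbounded_natr. Qed.

Lemma unbounded_loglog : unbounded (loglog R).
Proof. exact/unbounded_ln/unbounded_lnn. Qed.

Lemma kn_upper : exists2 C : R, 0 < C & \forall n \near \oo, m n <= C * Ln n `^ d0.
Proof.
move: kn_asymp; rewrite eqThetaE bigThetaE => -[/eqO_exP [C C0 h] _].
exists C => //; near=> n.
have : `|(kn n)%:R : R| <= C * `|ln n%:R `^ d0| by near: n.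
by rewrite ger0_norm// ger0_norm// powR_ge0.
Unshelve. all: by end_near. Qed.

Lemma unbounded_kn : unbounded m.
Proof.
move: kn_asymp; rewrite eqThetaE bigThetaE eqOmegaO => -[_ /eqO_exP [C C0 h]].
have u : unbounded (fun n => C^-1 * Ln n `^ d0).
  by apply: unbounded_mul; [rewrite invr_gt0|apply: unbounded_powR => //; exact: unbounded_lnn].
apply: unbounded_le u; near=> n.
have : `|ln n%:R `^ d0| <= C * `|(kn n)%:R : R| by near: n.
by rewrite ger0_norm ?powR_ge0// ger0_norm// ler_pdivrMl.
Unshelve. all: by end_near. Qed.

Lemma kn_le_ln : \forall n \near \oo, m n <= Ln n.
Proof.
have [C C0 hC] := kn_upper.
near=> n.
have L1 : 1 <= Ln n by near: n; exact: unbounded_lnn.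
apply: (@le_trans _ _ (C * Ln n `^ d0)); first by near: n.
have hc : C <= Ln n `^ (1 / 2).
  by near: n; apply: unbounded_powR; [lra|exact: unbounded_lnn].
apply: (@le_trans _ _ (Ln n `^ (1 / 2) * Ln n `^ (1 / 2))).
  apply: ler_pM => //; rewrite ?(ltW C0) ?powR_ge0//.
  by apply: ler_powR => //; exact: ltW.
rewrite -powRD; last by apply/implyP => _; rewrite gt_eqF//; lra.
rewrite (_ : 1 / 2 + 1 / 2 = 1); last by field.
by rewrite powRr1// (le_trans ler01).
Unshelve. all: by end_near. Qed.

Lemma unbounded_level : unbounded B.
Proof.
move=> A; pose A' := Num.max A 1.
have A1 : 1 <= A' by rewrite le_max lexx orbT.
near=> n; apply: (@le_trans _ _ A'); first by rewrite le_max lexx.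
rewrite leNgt; apply/negP => BA.
have h : 2 * pi * A' ^+ 2 * expR (A' ^+ 2) + 1 <= m n by near: n; exact: unbounded_kn.
have B0 := B_gt0 n.
have B2 : B n ^+ 2 <= A' ^+ 2 by apply: lerXn2r; rewrite ?nnegrE; lra.
have h2 : m n ^+ 2 <= 2 * pi * A' ^+ 2 * expR (A' ^+ 2).
  rewrite -B_eq; apply: ler_pM; rewrite ?expR_ge0 ?ler_expR//.
    by rewrite mulr_ge0 ?sqr_ge0// mulr_ge0// pi_ge0.
  by rewrite ler_wpM2l// mulr_ge0// pi_ge0.
have := m1 n => hm.
have : m n <= m n ^+ 2 by rewrite expr2 ler_peMl// (le_trans ler01).
lra.
Unshelve. all: by end_near. Qed.

(** Once B >= 1, the defining equation gives B^2 <= k_n^2 and exp (B^2) <= k_n^2, and eventually k_n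
    <= log n. *)
Lemma level_bounds : \forall n \near \oo,
  [/\ 1 <= B n, B n <= m n & B n ^+ 2 <= 2 * loglog R n].
Proof.
near=> n.
have B1 : 1 <= B n by near: n; exact: unbounded_level.
have mL : m n <= Ln n by near: n; exact: kn_le_ln.
have B2 : 1 <= B n ^+ 2 by exact: exprn_ege1.
have p2 := @pi_ge2 R.
have BE := B_eq n; have hm := m1 n.
have e1 : 1 <= expR (B n ^+ 2) by rewrite -expR0 ler_expR sqr_ge0.
have hB : B n ^+ 2 <= m n ^+ 2.
  rewrite -BE (mulrC (2 * pi)) -mulrA ler_peMr ?sqr_ge0//.
  by rewrite -[leLHS]mul1r; apply: ler_pM => //; lra.
have he : expR (B n ^+ 2) <= m n ^+ 2.
  rewrite -BE ler_peMl ?expR_ge0//.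
  by rewrite -[leLHS]mul1r; apply: ler_pM => //; lra.
split=> //.
  by rewrite -(@ler_pXn2r _ 2)// nnegrE; lra.
have m0 : 0 < m n by lra.
have : ln (expR (B n ^+ 2)) <= ln (m n ^+ 2).
  by rewrite ler_ln// posrE ?expR_gt0// exprn_gt0.
rewrite expRK => /le_trans; apply.
rewrite lnXn// -[leLHS]mulr_natl ler_wpM2l//.
by rewrite ler_ln// posrE (lt_le_trans m0).
Unshelve. all: by end_near. Qed.

Lemma log_ratio_bounds : \forall n \near \oo, Ln n <= log_ratio R n <= 2 * Ln n.
Proof.
near=> n.
have LL1 : 1 <= loglog R n by near: n; exact: unbounded_loglog.
have L1 : 1 <= Ln n by near: n; exact: unbounded_lnn.
have le_ln x : 0 < x -> ln x <= x :> R.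
  by move=> x0; exact: ltW (ln_sublinear x0).
have LL0 : 0 < loglog R n by lra.
have L0 : 0 < Ln n by lra.
have h1 : ln (loglog R n) <= loglog R n := le_ln _ LL0.
have h2 : loglog R n <= Ln n := le_ln _ L0.
have h3 : 0 <= ln (loglog R n) by rewrite ln_ge0.
rewrite /log_ratio -/(Ln n); apply/andP; split; lra.
Unshelve. all: by end_near. Qed.

(** Here d0 < 1/2 is decisive: log n / k_n^2 grows at least like a constant times (log n)^(1 - 2
    d0), so the exponential beats every power of k_n. It is replaced by an inverse N-th power to
    reduce the claim to powers of log n. *)
Lemma spread_decay (p : nat) (eps : R) : 0 < eps ->
  \forall n \near \oo, m n ^+ p * spread R n (kn n) <= eps.
Proof.
move=> eps0; have [C C0 hC] := kn_upper.
have q0 : 0 < 1 - 2 * d0 by have := d0_lt; lra.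
(* N is chosen so that d0 (p + 2 N) <= N - 1. *)
pose N := (Num.truncn ((p%:R * d0 + 1) / (1 - 2 * d0))).+1.
have hN : d0 * (p + 2 * N)%:R <= N%:R - 1.
  have : (p%:R * d0 + 1) / (1 - 2 * d0) < N%:R by exact: truncnS_gt.
  rewrite ltr_pdivrMr// natrD natrM; lra.
pose K := C ^+ (p + 2 * N) * (2 * N.+1%:R ^+ N * 25 ^+ N).
have K0 : 0 < K by rewrite !mulr_gt0 ?exprn_gt0.
near=> n.
have L1 : 1 <= Ln n by near: n; exact: unbounded_lnn.
have L0 : 0 < Ln n by lra.
have hm := m1 n; have m0 : 0 < m n by lra.
have mC : m n <= C * Ln n `^ d0 by near: n.
have /andP[Z1 _] : Ln n <= log_ratio R n <= 2 * Ln n by near: n; exact: log_ratio_bounds.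
have KL : K <= eps * Ln n.
  by rewrite mulrC -ler_pdivrMr//; near: n; exact: unbounded_lnn.
pose y := Ln n / (25 * m n ^+ 2).
have m2 : 0 < 25 * m n ^+ 2 by rewrite mulr_gt0// exprn_gt0.
have y0 : 0 < y by rewrite divr_gt0.
have hs : spread R n (kn n) <= expR (- y).
  by rewrite /spread ler_expR mulNr lerN2 ler_wpM2r// invr_ge0 ltW.
have hy : y ^+ N <= N.+1%:R ^+ N * (2 * expR y).
  have := normX_le_expR y N; rewrite gtr0_norm// => /le_trans; apply.
  apply: ler_wpM2l; first by rewrite exprn_ge0.
  have : expR (- y) <= expR y by rewrite ler_expR; lra.
  lra.
have hs2 : spread R n (kn n) <= 2 * N.+1%:R ^+ N / y ^+ N.
  apply: (le_trans hs); rewrite ler_pdivlMr ?exprn_gt0// expRN mulrC ler_pdivrMr ?expR_gt0//.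
  by apply: (le_trans hy); rewrite le_eqVlt; apply/orP; left; apply/eqP; ring.
have hmp : m n ^+ (p + 2 * N) <= C ^+ (p + 2 * N) * (Ln n ^+ N / Ln n).
  apply: (@le_trans _ _ ((C * Ln n `^ d0) ^+ (p + 2 * N))).
    by apply: lerXn2r => //; rewrite nnegrE ?mulr_ge0 ?powR_ge0 ?(ltW C0) ?(ltW m0).
  rewrite exprMn ler_wpM2l ?exprn_ge0 ?(ltW C0)//.
  rewrite -[leLHS]powR_mulrn ?powR_ge0// -powRrM.
  apply: (@le_trans _ _ (Ln n `^ (N%:R - 1))); first exact: ler_powR.
  rewrite powRB; last by apply/implyP => _; rewrite gt_eqF.
  by rewrite powR_mulrn ?powRr1 ?(ltW L0).
apply: (@le_trans _ _ (m n ^+ p * (2 * N.+1%:R ^+ N / y ^+ N))).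
  by rewrite ler_wpM2l// exprn_ge0// ltW.
have -> : m n ^+ p * (2 * N.+1%:R ^+ N / y ^+ N) =
   m n ^+ (p + 2 * N) * (2 * N.+1%:R ^+ N * 25 ^+ N / Ln n ^+ N).
  rewrite /y exprD exprM expr_div_n exprMn; field.
  by rewrite !gt_eqF ?exprn_gt0// exprn_gt0.
have c1 : 0 <= 2 * N.+1%:R ^+ N * 25 ^+ N / Ln n ^+ N.
  by rewrite divr_ge0 ?exprn_ge0 ?(ltW L0)// !mulr_ge0// exprn_ge0.
apply: (le_trans (ler_wpM2r c1 hmp)).
have -> : C ^+ (p + 2 * N) * (Ln n ^+ N / Ln n) * (2 * N.+1%:R ^+ N * 25 ^+ N / Ln n ^+ N) = K / Ln n.
  by rewrite /K; field; rewrite expf_neq0 ?gt_eqF.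
by rewrite ler_pdivrMr.
Unshelve. all: by end_near. Qed.

Lemma spread_sqrt_decay (p : nat) (eps : R) : 0 < eps ->
  \forall n \near \oo, m n ^+ p * Num.sqrt (spread R n (kn n)) <= eps.
Proof.
move=> e0; have e2 : 0 < eps ^+ 2 by rewrite exprn_gt0.
have := spread_decay (p * 2) e2; apply: filterS => n h.
have s0 := spread_gt0 R n (kn n); have hm := m1 n.
have mp : 0 <= m n ^+ p by rewrite exprn_ge0//; lra.
rewrite -(@ler_pXn2r _ 2)// ?nnegrE ?mulr_ge0 ?sqrtr_ge0 ?(ltW e0)//.
by rewrite exprMn sqr_sqrtr ?(ltW s0)// -exprM.
Qed.

Lemma clt_error_decay (mu4 s eta eps : R) : 0 < eta -> 0 < eps ->
  \forall n \near \oo,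
    clt_error mu4 (B n + s / B n) (eta / B n) (theta c0 n (kn n)) (kn n) <= eps.
Proof.
move=> eta0 eps0.
pose a := 1 + `|s|; pose q := 4 / eta; pose K1 := expR (`|s| + s ^+ 2 / 2).
pose K2 := (1 + a ^+ 2) * K1 + a + q + 2.
pose K3 := K2 * (6 * mu4 ^+ 2) * (1 + q) ^+ 2 * (128 * (1 + c0)).
have a0 : 0 <= a by rewrite addr_ge0.
have q0 : 0 <= q by rewrite divr_ge0// ltW.
have k1 : 0 <= K1 by exact: expR_ge0.
have k2 : 0 <= K2.
  have : 0 <= (1 + a ^+ 2) * K1 by rewrite mulr_ge0// addr_ge0// sqr_ge0.
  rewrite /K2; lra.
have k3 : 0 <= K3.
  rewrite /K3; apply: mulr_ge0; last by rewrite mulr_ge0// addr_ge0// ltW.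
  apply: mulr_ge0; last exact: sqr_ge0.
  by apply: mulr_ge0 => //; rewrite mulr_ge0// sqr_ge0.
have e0 : 0 < eps / (K3 + 1) by rewrite divr_gt0//; lra.
near=> n.
have [B1 Bm B2] : [/\ 1 <= B n, B n <= m n & B n ^+ 2 <= 2 * loglog R n].
  by near: n; exact: level_bounds.
(* The power 8 is 1 + 3 + 2 + 2: the number of factors, the Stein bound v^2 / gpdf(v), the squared
   number of forms in the comparison, and the squared inverse window. *)
have hdec : m n ^+ 8 * Num.sqrt (spread R n (kn n)) <= eps / (K3 + 1).
  by near: n; exact: spread_sqrt_decay.
have hm := m1 n; have b0 := B_gt0 n.
have mE := level_rootE b0 (ler0n R (kn n)) (B_eq n).
rewrite -/(m n) in mE.
set b := B n in B1 Bm B2 b0 mE *; set M := m n in hdec hm Bm mE *.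
pose v := b + s / b.
have bV : b^-1 <= 1 by rewrite invf_le1.
have bV0 : 0 <= b^-1 by rewrite invr_ge0 ltW.
have hsb : `|s / b| <= `|s|.
  by rewrite normrM (ger0_norm bV0) ler_piMr.
have hv : `|v| <= a * M.
  have : `|v| <= b + `|s|.
    by apply: (le_trans (ler_normD _ _)); rewrite ger0_norm ?(ltW b0)// lerD2l.
  have : `|s| <= `|s| * M by rewrite ler_peMr.
  rewrite /a mulrDl mul1r; lra.
have hv2 : v ^+ 2 <= a ^+ 2 * M ^+ 2.
  rewrite -exprMn -(real_normK (num_real v)); apply: lerXn2r => //.
  by rewrite nnegrE mulr_ge0//; lra.
(* At b itself 1 / gpdf(b) = M / b; passing to v = b + s / b changes it by a factor at most K1. *)
have hg : (gpdf v)^-1 <= M * K1.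
  have s2 : 0 < Num.sqrt (2 * pi) :> R by rewrite sqrtr_gt0 mulr_gt0// pi_gt0.
  have -> : (gpdf v)^-1 = Num.sqrt (2 * pi) * expR (v ^+ 2 / 2).
    by rewrite gpdfE invfM invrK mulNr expRN invrK.
  apply: (@le_trans _ _ (Num.sqrt (2 * pi) * (expR (b ^+ 2 / 2) * K1))).
    rewrite ler_pM2l// /K1 -expRD ler_expR.
    have -> : v ^+ 2 / 2 = b ^+ 2 / 2 + (s + (s / b) ^+ 2 / 2).
      by rewrite /v; field; rewrite gt_eqF.
    have h1 : (s / b) ^+ 2 <= s ^+ 2.
      rewrite -(real_normK (num_real (s / b))) -(real_normK (num_real s)).
      by apply: lerXn2r.
    have := ler_norm s; lra.
  rewrite mulrA ler_wpM2r// [leRHS]mE [leRHS]mulrAC ler_peMr// mulr_ge0 ?expR_ge0 ?(ltW s2)//.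
have gp : 0 <= (gpdf v)^-1 by rewrite invr_ge0 ltW// gpdf_gt0.
have M0 : 0 <= M by lra.
have M2 : 1 <= M ^+ 2 by exact: exprn_ege1.
have M3 : M <= M ^+ 3.
  by rewrite exprS ler_peMr.
have qE : 4 / (eta / b) = q * b by rewrite /q; field; rewrite !gt_eqF.
have qb : q * b <= q * M by rewrite ler_wpM2l.
have qb0 : 0 <= q * b by rewrite mulr_ge0// ltW.
have hst : stein_bound v (4 / (eta / b)) <= M ^+ 3 * K2.
  rewrite /stein_bound qE.
  have h1 : (1 + v ^+ 2) / gpdf v <= (M ^+ 2 * (1 + a ^+ 2)) * (M * K1).
    apply: ler_pM => //; first by rewrite addr_ge0// sqr_ge0.
    rewrite mulrDr mulr1 (mulrC (M ^+ 2) (a ^+ 2)); lra.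
  have h2 : v <= a * M by apply: le_trans (ler_norm v) hv.
  have h3 : (M ^+ 2 * (1 + a ^+ 2)) * (M * K1) = M ^+ 3 * ((1 + a ^+ 2) * K1) by ring.
  have h4 : a * M <= M ^+ 3 * a by rewrite mulrC ler_wpM2r.
  have h5 : q * M <= M ^+ 3 * q by rewrite mulrC ler_wpM2r.
  have h6 : 1 <= M ^+ 3 by lra.
  rewrite h3 in h1.
  have := lerD (lerD (lerD h1 (le_trans h2 h4)) (le_trans qb h5)) (ler_wpM2r (ler0n R 2) h6).
  rewrite mul1r => /le_trans; apply.
  by rewrite /K2 le_eqVlt; apply/orP; left; apply/eqP; ring.
have hd : (1 + 4 / (eta / b)) ^+ 2 <= (1 + q) ^+ 2 * M ^+ 2.
  rewrite -exprMn qE; apply: lerXn2r; rewrite ?nnegrE ?mulr_ge0 ?addr_ge0//.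
  rewrite mulrDl mul1r; lra.
rewrite /clt_error -/M -/v /theta.
set sq := Num.sqrt _ in hdec *; have sq0 : 0 <= sq by exact: sqrtr_ge0.
have c1 : 0 <= 1 + c0 by rewrite addr_ge0// ltW.
have th0 : 0 <= 128 * (1 + c0) * sq by rewrite !mulr_ge0.
have mu0 : 0 <= 6 * mu4 ^+ 2 by apply: mulr_ge0 => //; exact: sqr_ge0.
have X0 : 0 <= 6 * mu4 ^+ 2 * M ^+ 2 by rewrite mulr_ge0// sqr_ge0.
apply: (@le_trans _ _ (M * (M ^+ 3 * K2 * (6 * mu4 ^+ 2 * M ^+ 2 * ((1 + q) ^+ 2 * M ^+ 2) *
    (128 * (1 + c0) * sq))))).
  apply: ler_wpM2l => //.
  apply: (@le_trans _ _ (M ^+ 3 * K2 * (6 * mu4 ^+ 2 * M ^+ 2 * (1 + 4 / (eta / b)) ^+ 2 *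
    (128 * (1 + c0) * sq)))).
    apply: ler_wpM2r => //; apply: mulr_ge0 => //.
    by apply: mulr_ge0 => //; exact: sqr_ge0.
  apply: ler_wpM2l; first by rewrite mulr_ge0// exprn_ge0.
  by apply: ler_wpM2r => //; apply: ler_wpM2l.
rewrite [leLHS](_ : _ = K3 * (M ^+ 8 * sq)); last by rewrite /K3; ring.
apply: (le_trans (ler_wpM2l k3 hdec)).
by rewrite mulrCA ler_piMr ?(ltW eps0)// ler_pdivrMr ?mul1r; lra.
Unshelve. all: by end_near. Qed.

(** Chebyshev's inequality at scale eta / B costs B^2 / eta^2, at most 2 log log n / eta^2, while
    [diag_error] contains (log log n)^(-3); a constant times (log log n)^(-2) remains. *)
Lemma diag_error_decay (mu4 eta eps : R) : 0 <= mu4 -> 0 < eta -> 0 < eps ->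
  \forall n \near \oo,
    (eta / B n) ^- 2 * diag_error mu4 c0 n (kn n) (c0 / 256) <= eps.
Proof.
move=> mu0 eta0 eps0.
set e' : R := c0 / 256.
pose K := 4 * (eta ^- 2 * ((2 + mu4) * (128 * (e' / c0)))).
have e'0 : 0 < e' by exact: divr_gt0 c0_gt0 (ltr0Sn _ _).
clearbody e'.
have r0 : 0 <= e' / c0 by rewrite divr_ge0// ltW.
have K0 : 0 <= K.
  rewrite /K; apply: mulr_ge0 => //; apply: mulr_ge0.
    by rewrite invr_ge0 sqr_ge0.
  by apply: mulr_ge0; [rewrite addr_ge0|apply: mulr_ge0].
near=> n.
have [B1 Bm B2] : [/\ 1 <= B n, B n <= m n & B n ^+ 2 <= 2 * loglog R n].
  by near: n; exact: level_bounds.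
have hs : m n ^+ 1 * spread R n (kn n) <= 1 by near: n; exact: spread_decay.
have LL1 : 1 <= loglog R n by near: n; exact: unbounded_loglog.
have LLK : K / eps <= loglog R n by near: n; exact: unbounded_loglog.
have sp := spread_gt0 R n (kn n); have hm := m1 n.
rewrite /diag_error -/(m n); move: hs LL1 LLK B2 sp; rewrite expr1.
move: (loglog R n) (spread R n (kn n)) => L sp hs L1 LK B2 sp0.
have L0 : 0 < L by lra.
have b0 := B_gt0 n.
have -> : (eta / B n) ^- 2 = B n ^+ 2 * eta ^- 2.
  by field; rewrite !gt_eqF.
set r := e' / c0 in r0 *.
have L30 : 0 <= L ^- 3 by rewrite invr_ge0 exprn_ge0// ltW.
have i0 : 0 <= eta ^- 2 by rewrite invr_ge0 sqr_ge0.
have X0 : 0 <= (2 + mu4) * (128 * r * L ^- 3).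
  by apply: mulr_ge0; [rewrite addr_ge0|apply: mulr_ge0 => //; exact: mulr_ge0].
have ms0 : 0 <= m n * sp by rewrite mulr_ge0//; lra.
apply: (@le_trans _ _ ((2 * L * eta ^- 2) * ((2 + mu4) * (128 * r * L ^- 3) * 2))).
  apply: ler_pM.
  - by rewrite mulr_ge0// sqr_ge0.
  - by rewrite mulr_ge0// addr_ge0.
  - exact: ler_wpM2r.
  - by apply: ler_wpM2l => //; lra.
rewrite [leLHS](_ : _ = K / L / L); last first.
  by rewrite /K -/r; field; rewrite !gt_eqF.
have hK : K / L <= eps.
  by rewrite ler_pdivrMr// mulrC -ler_pdivrMr.
have KL0 : 0 <= K / L by rewrite divr_ge0// ltW.
apply: le_trans hK; rewrite ler_pdivrMr// ler_peMr//.
Unshelve. all: by end_near. Qed.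

Lemma regular_regime : \forall n \near \oo,
  [/\ 1 <= loglog R n, 0 <= log_ratio R n, c0 * spread R n (kn n) <= 1 &
      1 <= bandwidth c0 n 1 * n%:R].
Proof.
have e0 : 0 < c0^-1 by rewrite invr_gt0.
near=> n.
have LL1 : 1 <= loglog R n by near: n; exact: unbounded_loglog.
have L1 : 1 <= Ln n by near: n; exact: unbounded_lnn.
have hs : m n ^+ 0 * spread R n (kn n) <= c0^-1 by near: n; exact: spread_decay.
have /andP[Z1 Z2] : Ln n <= log_ratio R n <= 2 * Ln n by near: n; exact: log_ratio_bounds.
have hL : 5 / 3 * c0^-1 <= Ln n by near: n; exact: unbounded_lnn.
have n1 : 1 <= n%:R :> R by near: n; exact: unbounded_natr.
have n0 : 0 < n%:R :> R by lra.
split=> //; first by lra.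
  by rewrite mulrC -ler_pdivlMr// mul1r; rewrite expr0 mul1r in hs.
(* As [log_ratio] is at most 2 log n, the product is at least c0 n^(3/5). *)
rewrite /bandwidth -[X in _ * X](@lnK R n%:R) ?posrE// -mulrA -expRD -ler_pdivrMl// mulr1.
apply: le_trans (expR_ge1Dx _); rewrite -/(Ln n) (_ : (4 * 1 + 1)%:R = 5)//.
set Z := log_ratio R n in Z1 Z2 *; lra.
Unshelve. all: by end_near. Qed.

End Rates.

(** * The Gumbel distribution function and the conclusion *)

Section Limit.
Context (R : realType).

Definition gumbel_cdf (s : R) : R := expR (- expR (- s)).

Lemma gumbel_cdf_quantile (alpha : R) : 0 < alpha -> alpha < 1 ->
  gumbel_cdf (- ln (- ln (1 - alpha))) = 1 - alpha.
Proof.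
move=> a0 a1; have h : 0 < - ln (1 - alpha) by rewrite oppr_gt0 ln_lt0//; apply/andP; split; lra.
by rewrite /gumbel_cdf opprK lnK// opprK lnK// posrE; lra.
Qed.

Lemma gumbel_cdf_continuous : continuous gumbel_cdf.
Proof.
move=> s; rewrite /gumbel_cdf.
have h0 : - y @[y --> s] --> - s by apply: cvgN; exact: cvg_id.
have h1 : expR (- y) @[y --> s] --> expR (- s).
  exact: (cvg_comp _ expR h0 (@continuous_expR R _)).
have h2 : - expR (- y) @[y --> s] --> - expR (- s) by exact: cvgN.
exact: (cvg_comp _ expR h2 (@continuous_expR R _)).
Qed.

Lemma littleo_bigmax_le (f : forall n : nat, 'I_n -> R) (g : nat -> R) (eta : R) :
  0 < eta -> (forall n, 0 <= g n) ->
  (fun n : nat => \big[Num.max/0]_(nu < n) f n nu) =o_\oo g ->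
  \forall n \near \oo, forall nu : 'I_n, f n nu <= eta * g n.
Proof.
move=> eta0 g0 /eqoP /(_ _ eta0); apply: filterS => n + nu.
rewrite (ger0_norm (g0 n)); apply: le_trans; apply: le_trans (ler_norm _).
exact: le_bigmax.
Qed.

Lemma perturbed_level_ge1 (b s : R) : 1 + `|s| <= b -> 1 <= b + s / b.
Proof.
move=> hb; have b1 : 1 <= b by have := normr_ge0 s; lra.
have : `|s / b| <= `|s|.
  by rewrite normrM normfV (ger0_norm (le_trans ler01 b1)) ler_piMr// invf_le1//; lra.
have := ler_norm (- (s / b)); rewrite normrN; lra.
Qed.

End Limit.

Theorem theorem6p3 (R : realType) (d : measure_display) (T : measurableType d)
  (P : probability T R)
  (epsilon : {RV P >-> R}) (eps : nat -> {RV P >-> R})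
  (X phi : forall n : nat, 'I_n -> R -> R) (beta : R -> R)
  (c0 d0 : R) (kn : nat -> nat) (B : nat -> R) (alpha : R)
  (mean0 : ('E_P[epsilon] = 0)%E)
  (var1 : ('V_P[epsilon] = 1)%E)
  (eps_iid : iid_copies epsilon eps)
  (subG : sub_gaussian epsilon)
  (basis : forall n : nat, empirical_basis (X n) (phi n))
  (c0_gt0 : 0 < c0)
  (kn_gt0 : forall n : nat, (0 < kn n)%N)
  (d0_gt0 : 0 < d0) (d0_lt : d0 < 1 / 2)
  (kn_asymp :
    (fun n : nat => (kn n)%:R : R) =Theta_\oo (fun n : nat => ln n%:R `^ d0))
  (B_gt0 : forall n : nat, 0 < B n)
  (B_eq : forall n : nat,
    2 * pi * B n ^+ 2 * expR (B n ^+ 2) = (kn n)%:R ^+ 2)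
  (omega4 :
    (fun n : nat => \big[Num.max/0]_(nu < n)
       \sum_(i < n) Omega (X n) (phi n) i nu ^+ 4)
    =o_\oo (fun n : nat => n%:R `^ (8 / 5) * ln (ln n%:R) `^ (- (14 / 5))))
  (alpha_gt0 : 0 < alpha) (alpha_lt1 : alpha < 1)
  (H0 : forall t : R, t \in `[0, 1] -> beta t = 0) :
  P [set w : T |
      AT c0 (Omega (X n) (phi n))
         (response (X n) beta (fun i : 'I_n => eps i w)) (kn n) (B n)
      <= - ln (- ln (1 - alpha))]
    @[n --> \oo] --> (1 - alpha)%:E.

Proof.
pose W n := Omega (X n) (phi n); pose q := @gumbel_cdf R.
pose c := - ln (- ln (1 - alpha)).
have He := noise_of_iid eps_iid mean0 var1 subG.
set mu4 := mean P _ in He.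
have mu1 : 1 <= mu4 := fourth_moment_ge1 He.
have uB := unbounded_level kn_gt0 d0_gt0 kn_asymp B_gt0 B_eq.
have hW n : (0 < n)%N -> (W n)^T *m W n = n%:R%:M by exact: Omega_orthogonal.
rewrite (_ : (fun n => P _) = fun n => P [set w |
    AT c0 (W n) (\col_i eps i w) (kn n) (B n) <= c]); last first.
  by apply/funext => n; under eq_set do rewrite (response0 _ _ H0).
apply/fine_cvgP; split.
  near=> n.
  have n0 : (0 < n)%N by near: n; exact: nbhs_infty_gt.
  rewrite (AT_setE eps c0 c n0 (hW n n0) (kn_gt0 n) (B_gt0 n)).
  apply: fin_num_measure; apply: below_measurable => k.
  by have [] := all_moments_tau_rv He c0 (W n) k.
apply/cvgrPdist_le => e e0.
(* Four errors are to be kept below e / 4: continuity of the Gumbel law, the Gumbel limit, the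
   Gaussian comparison and the diagonal part. *)
have e4 : 0 < e / 4 by rewrite divr_gt0.
have := @gumbel_cdf_continuous R c => /cvgrPdist_le /(_ _ e4) /nbhs_ballP[r /= r0 hr].
(* With t = eta / B n the two moves of the level shift the Gumbel argument by 2 eta = r / 2, inside
   the ball of continuity. *)
pose eta := r / 4; have eta0 : 0 < eta by rewrite divr_gt0.
have hp : `|q c - q (c + 2 * eta)| <= e / 4.
  by apply: hr; rewrite /ball/= opprD addNKr normrN ger0_norm /eta; lra.
have hq : `|q c - q (c - 2 * eta)| <= e / 4.
  by apply: hr; rewrite /ball/= opprB addrC subrK ger0_norm /eta; lra.
have gl s : \forall n \near \oo,
    `|q s - (1 - gtail (B n + s / B n)) ^+ kn n| <= e / 4.
  by have /cvgrPdist_le := gumbel_limit (s := s) B_gt0 uB B_eq; exact.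
have mu0 : 0 <= mu4 by exact: le_trans mu1.
have c256 : 0 < c0 / 256 by exact: divr_gt0 c0_gt0 (ltr0Sn _ _).
near=> n.
have n0 : (0 < n)%N by near: n; exact: nbhs_infty_gt.
have [LL1 Z0 hm hn] : [/\ 1 <= loglog R n, 0 <= log_ratio R n,
    c0 * spread R n (kn n) <= 1 & 1 <= bandwidth c0 n 1 * n%:R].
  by near: n; exact: (regular_regime c0_gt0 kn_gt0 d0_lt kn_asymp).
(* The little-o is used at the ratio c0 / 256, the threshold of [scale2_ge]. *)
have hM4 : forall nu, \sum_(i < n) W n i nu ^+ 4 <=
    c0 / 256 * (n%:R `^ (8 / 5) * loglog R n `^ (- (14 / 5))).
  near: n; apply: littleo_bigmax_le omega4 => // n.
  by rewrite mulr_ge0 ?powR_ge0.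
have b0 := B_gt0 n.
have B1 : 2 + `|c| + 2 * eta <= B n by near: n; exact: uB.
have d1 : (eta / B n) ^- 2 * diag_error mu4 c0 n (kn n) (c0 / 256) <= e / 4.
  by near: n; exact: (diag_error_decay c0_gt0 kn_gt0 d0_gt0 d0_lt kn_asymp B_gt0 B_eq).
have l1 : clt_error mu4 (B n + (c + 2 * eta) / B n) (eta / B n)
    (theta c0 n (kn n)) (kn n) <= e / 4.
  by near: n; exact: (clt_error_decay c0_gt0 kn_gt0 d0_gt0 d0_lt kn_asymp B_gt0 B_eq).
have l2 : clt_error mu4 (B n + (c - eta) / B n) (eta / B n)
    (theta c0 n (kn n)) (kn n) <= e / 4.
  by near: n; exact: (clt_error_decay c0_gt0 kn_gt0 d0_gt0 d0_lt kn_asymp B_gt0 B_eq).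
have g1 : `|q (c + 2 * eta) - (1 - gtail (B n + (c + 2 * eta) / B n)) ^+ kn n| <= e / 4.
  by near: n; exact: gl.
have g2 : `|q (c - 2 * eta) - (1 - gtail (B n + (c - 2 * eta) / B n)) ^+ kn n| <= e / 4.
  by near: n; exact: gl.
have t0 : 0 < eta / B n by rewrite divr_gt0.
have c256' : 256 * (c0 / 256) <= c0 by rewrite mulrC (divfK (lt0r_neq0 (ltr0Sn R _))).
have E1 : B n + c / B n + 2 * (eta / B n) = B n + (c + 2 * eta) / B n by ring.
have E2 : B n + c / B n - 2 * (eta / B n) = B n + (c - 2 * eta) / B n by ring.
have E3 : B n + c / B n - eta / B n = B n + (c - eta) / B n by ring.
have shift (s : R) : `|s| <= `|c| + 2 * eta -> 1 <= B n + s / B n.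
  move=> hs; apply: perturbed_level_ge1; apply: le_trans B1.
  by rewrite -addrA lerD// ler1n.
have nc (s : R) : `|s| <= 2 * eta -> `|c + s| <= `|c| + 2 * eta.
  by move=> h; apply: (le_trans (ler_normD _ _)); rewrite lerD2l.
have s1 : 1 <= B n + (c + 2 * eta) / B n.
  by apply: shift; apply: nc; rewrite gtr0_norm ?mulr_gt0.
have s2 : 1 <= B n + (c - 2 * eta) / B n.
  by apply: shift; apply: nc; rewrite normrN gtr0_norm ?mulr_gt0.
have s3 : 1 <= B n + (c - eta) / B n.
  by apply: shift; apply: nc; rewrite normrN gtr0_norm// ler_peMl ?ler1n// ltW.
have s4 : 0 <= B n + c / B n + eta / B n.
  rewrite -E3 lerBrDr in s3; apply: addr_ge0 (ltW t0).
  by apply: le_trans s3; rewrite addr_ge0// ltW.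
have := AT_prob_le He c0_gt0 n0 LL1 Z0 (hW n n0) hm hn (ltW c256) c256' hM4 (kn_gt0 n) b0 t0 s4.
have := AT_prob_ge (c := c) He c0_gt0 n0 LL1 Z0 (hW n n0) hm hn (ltW c256) c256' hM4 (kn_gt0 n) b0 t0.
rewrite E1 E2 E3 => /(_ (le_trans ler01 s2) s3) lo /(_ s1) hi.
have qc : q c = 1 - alpha by exact: gumbel_cdf_quantile.
move: hp hq g1 g2; rewrite -qc !ler_norml /= => /andP[p1 p2] /andP[q1 q2] /andP[v1 v2] /andP[w1 w2].
move: (q c) (q (c + 2 * eta)) (q (c - 2 * eta)) p1 p2 q1 q2 v1 v2 w1 w2 l1 l2 d1 lo hi.
move: (fine _) (clt_error _ _ _ _ _) (clt_error _ _ _ _ _) (_ ^- 2 * _) (_ ^+ _) (_ ^+ _).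
clear; move=> p a1 a2 a3 a4 a5 x y z *; apply/andP; split; lra.
Unshelve. all: by end_near. Qed.
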